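(* Let $\mathbb F$ be a field and let $\mathrm{Nat}:=\mathrm{Nat}_{\mathrm{Com}}([1,0],[1,0])$ be the complex of formal operations $C(\Phi)\to C(\Phi)$ on the Hochschild complex, natural in all dg-functors $\Phi:\mathrm{Com}\to \mathrm{Ch}$. Then the homology $H_*(\mathrm{Nat})$ is concentrated in degrees $0$ and $1$, and in these degrees it is described as follows. (1) Every element of $H_0(\mathrm{Nat})$ can be uniquely written as $\sum_{k=0}^\infty c_k[sh^k]$ with $c_k\in\mathbb F$, where $[sh^k]$ is the homology class of the cycle $sh^k$. In the $i$-th component of the product this is given by the finite sum $\sum_{k=0}^i c_k[(sh^k)_i]$. (2) Every element of $H_1(\mathrm{Nat})$ can be uniquely written as $\sum_{k=0}^\infty c_k[B^k]$ with $c_k\in\mathbb F$, where $[B^k]$ is the homology class of the cycle $B^k$. In the $i$-th component of the product this is given by the finite sum $\sum_{k=0}^i c_k[(B^k)_i]$.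
   Context: **Categories.** $\mathrm{Ch}$ is the category of chain complexes over $\mathbb F$. $\mathrm{Com}$ is the dg-category (PROP) with objects the natural numbers $n\ge 0$ and morphisms $\mathrm{Com}(m,n)=\mathbb F[\mathrm{FinSet}(\{1,\dots,m\},\{1,\dots,n\})]$, concentrated in degree $0$; $+$ denotes disjoint union. A dg-functor is a functor enriched over $\mathrm{Ch}$. For $1\le i<k$, $m^k_{i,i+1}\in\mathrm{Com}(k,k-1)$ is the surjection identifying $i$ and $i+1$ and monotone; $m^k_{k,k+1}:=m^k_{k,1}$ sends $k$ and $1$ to $1$ and is the identity on $\{1,\dots,k-1\}$. **Hochschild complex.** For a dg-functor $\Phi:\mathrm{Com}\to\mathrm{Ch}$, $C(\Phi)(n)=\bigoplus_{k\ge1}\Phi(k+n)[k-1]$, where $(A[r])_q=A_{q-r}$, with differential, for $x\in\Phi(k+n)$ and $|x|$ the degree of $x$ in $\Phi(k+n)$, $d(x)=d_\Phi(x)+(-1)^{|x|}\sum_{i=1}^k(-1)^i\Phi(m^k_{i,i+1}+\mathrm{id}_n)(x)$ (the sum being $0$ if $k=1$). Write $C(\Phi)=C(\Phi)(0)=\bigoplus_{k\ge0}\Phi(k+1)[k]$. **Formal operations.** $\mathrm{Nat}_{\mathrm{Com}}([1,0],[1,0])$ is the chain complex of graded linear maps $C(\Phi)\to C(\Phi)$ natural in all dg-functors $\Phi:\mathrm{Com}\to\mathrm{Ch}$, with the usual differential $f\mapsto d f-(-1)^{|f|}f d$. Its degree $l$ part is identified with $\prod_{k\ge0}\mathrm{Com}(k+1,k+l+1)$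 (factors with $k+l<0$ being $0$): $f=(f_k)_k$ acts on the summand $\Phi(k+1)$ by $\Phi(f_k)$, with the usual Koszul sign. $f_k$ is called the $k$-th component (the part in the $k$-th degree of the product). An infinite sum of operations is meaningful if in each component only finitely many terms are non-zero; $\sum_k c_k[x^k]$ denotes the homology class of the cycle $\sum_k c_kx^k$. **Shuffle operations.** For $\sigma\in\Sigma_n$ a descent is an $i$ with $\sigma(i)>\sigma(i+1)$. Let $\Sigma_{n,k}$ be the set of $\sigma\in\Sigma_n$ with exactly $k-1$ descents, and let $\Sigma^1_{n+1,k}\subset\Sigma_{n+1}$ be its image under the embedding $\Sigma_n\to\Sigma_{n+1}$ letting a permutation fix $1$ and act on $\{2,\dots,n+1\}$. View permutations in $\Sigma_{n+1}$ as elements of $\mathrm{Com}(n+1,n+1)$. For $n\ge1$, $1\le k\le n$ put $l_n^k=\sum_{\sigma\in\Sigma^1_{n+1,k}}\mathrm{sgn}(\sigma)\sigma$ and $sh_n^k=\sum_{i=1}^k\binom{n-i}{k-i}l_n^i$. Put $sh_0^0=\mathrm{id}$, $sh_n^0=0$ for $n>0$, and $sh_n^k=0$ for $n<k$. Then $sh^k=(sh^k_n)_{n\ge0}\in\prod_n\mathrm{Com}(n+1,n+1)$ is an operation of degree $0$, which is a cycle; $(sh^k)_n:=sh^k_n$. **The operations $B^k$.** For $l\ge1$ let $B_l=\sum_{i=1}^l(-1)^{i(l+1)}g_i\in\mathrm{Com}(l,l+1)$, where $g_i(t)=t+i+1$ if $t+i+1\le l+1$ and $g_i(t)=t+i+1-l$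 otherwise (so $g_i^{-1}(1)=\emptyset$ and the $g_i$ are the cyclic bijections onto $\{2,\dots,l+1\}$). This gives a degree $1$ cycle $B$ (Connes' boundary operator). Set $B^k=B\circ sh^k$ (first $sh^k$, then $B$), i.e. $(B^k)_n=B_{n+1}\circ sh^k_n\in\mathrm{Com}(n+1,n+2)$; it is a cycle of degree $1$. *)

(* Defs.v *)
From HB Require Import structures.
From mathcomp Require Import all_boot all_order all_algebra fingroup perm.
From mathcomp Require Import zify.
From mathcomp Require Import boolp classical_sets cardinality fsbigop.

Set Implicit Arguments.
Unset Strict Implicit.
Unset Printing Implicit Defensive.

Import Order.TTheory GRing.Theory Num.Theory.
Local Open Scope ring_scope.

Definition mk_linear (F : fieldType) (U V : lmodType F) (f : U -> V)
    (fL : linear f) : {linear U -> V} :=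
  HB.pack f (GRing.isLinear.Build F U V *:%R f fL).

Section DirectSum.
Variables (F : fieldType) (V : nat -> lmodType F).

Record dsum := DSum {
  dcoord :> forall k, V k;
  dsum_fin : exists N, forall k, (N <= k)%N -> dcoord k = 0 }.

Lemma dsumP (x y : dsum) : (forall k, x k = y k) -> x = y.
Proof.
case: x y => [x xf] [y yf] /= xy.
have exy : x = y by apply: functional_extensionality_dep.
by rewrite exy in xf *; congr DSum; apply: Prop_irrelevance.
Qed.

HB.instance Definition _ := gen_eqMixin dsum.
HB.instance Definition _ := gen_choiceMixin dsum.

Lemma dsum0_fin : exists N, forall k, (N <= k)%N -> (0 : V k) = 0.
Proof. by exists 0%N. Qed.

Lemma dsumD_fin (x y : dsum) :
  exists N, forall k, (N <= k)%N -> x k + y k = 0.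
Proof.
have [N xN] := dsum_fin x; have [M yM] := dsum_fin y; exists (maxn N M) => k.
by rewrite geq_max => /andP[/xN-> /yM->]; rewrite addr0.
Qed.

Lemma dsumN_fin (x : dsum) : exists N, forall k, (N <= k)%N -> - x k = 0.
Proof. by have [N xN] := dsum_fin x; exists N => k /xN->; rewrite oppr0. Qed.

Lemma dsumZ_fin (a : F) (x : dsum) :
  exists N, forall k, (N <= k)%N -> a *: x k = 0.
Proof. by have [N xN] := dsum_fin x; exists N => k /xN->; rewrite scaler0. Qed.

Definition dsum_zero := DSum dsum0_fin.
Definition dsum_add x y := DSum (dsumD_fin x y).
Definition dsum_opp x := DSum (dsumN_fin x).
Definition dsum_scale a x := DSum (dsumZ_fin a x).

Lemma dsum_addA : associative dsum_add.
Proof. by move=> x y z; apply: dsumP => k /=; rewrite addrA. Qed.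
Lemma dsum_addC : commutative dsum_add.
Proof. by move=> x y; apply: dsumP => k /=; rewrite addrC. Qed.
Lemma dsum_add0 : left_id dsum_zero dsum_add.
Proof. by move=> x; apply: dsumP => k /=; rewrite add0r. Qed.
Lemma dsum_addN : left_inverse dsum_zero dsum_opp dsum_add.
Proof. by move=> x; apply: dsumP => k /=; rewrite addNr. Qed.

HB.instance Definition _ :=
  GRing.isZmodule.Build dsum dsum_addA dsum_addC dsum_add0 dsum_addN.

Lemma dsum_scaleA a b x : dsum_scale a (dsum_scale b x) = dsum_scale (a * b) x.
Proof. by apply: dsumP => k /=; rewrite scalerA. Qed.
Lemma dsum_scale1 : left_id 1 dsum_scale.
Proof. by move=> x; apply: dsumP => k /=; rewrite scale1r. Qed.
Lemma dsum_scaleDr : right_distributive dsum_scale +%R.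
Proof. by move=> a x y; apply: dsumP => k /=; rewrite scalerDr. Qed.
Lemma dsum_scaleDl x : {morph dsum_scale^~ x : a b / a + b}.
Proof. by move=> a b; apply: dsumP => k /=; rewrite scalerDl. Qed.

HB.instance Definition _ := GRing.Zmodule_isLmodule.Build F dsum
  dsum_scaleA dsum_scale1 dsum_scaleDr dsum_scaleDl.

Lemma dcoord0 k : (0 : dsum) k = 0. Proof. by []. Qed.
Lemma dcoordD (x y : dsum) k : (x + y) k = x k + y k. Proof. by []. Qed.
Lemma dcoordN (x : dsum) k : (- x) k = - x k. Proof. by []. Qed.
Lemma dcoordZ a (x : dsum) k : (a *: x) k = a *: x k. Proof. by []. Qed.

Lemma dinj_fin k (v : V k) :
  exists N, forall j, (N <= j)%N -> dfwith (fun i => 0 : V i) v j = 0.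
Proof. by exists k.+1 => j kj; rewrite dfwith_out // neq_ltn kj. Qed.

Lemma dinj_linear k : linear (fun v : V k => DSum (dinj_fin v)).
Proof.
move=> a u v; apply: dsumP => j; rewrite dcoordD dcoordZ /=.
have [<-|kj] := eqVneq k j; first by rewrite !dfwith_in.
by rewrite !dfwith_out // scaler0 addr0.
Qed.

Definition dinj k : {linear V k -> dsum} := mk_linear (@dinj_linear k).

Variable W : lmodType F.

(* The linear map out of the direct sum with the given restrictions to the
   summands; the sum is finite because x is finitely supported. *)
Definition delim_fun (g : forall k, {linear V k -> W}) (x : dsum) : W :=
  \sum_(k \in [set: nat]) g k (x k).

Lemma delim_funE g (x : dsum) N : (forall k, (N <= k)%N -> x k = 0) ->
  delim_fun g x = \sum_(k < N) g k (x k).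
Proof.
move=> xN; rewrite (fsbig_ord _ N (fun k => g k (x k))) /delim_fun.
apply/esym/fsbig_widen => // k /= [_ /negP]; rewrite -leqNgt => /xN ->.
by rewrite linear0.
Qed.

Lemma delim_linear g : linear (delim_fun g).
Proof.
move=> a x y; have [N xN] := dsum_fin x; have [M yM] := dsum_fin y.
have xK k : (maxn N M <= k)%N -> x k = 0 by rewrite geq_max => /andP[/xN].
have yK k : (maxn N M <= k)%N -> y k = 0 by rewrite geq_max => /andP[_ /yM].
rewrite (delim_funE g xK) (delim_funE g yK) (@delim_funE _ _ (maxn N M)).
  rewrite scaler_sumr -big_split /=; apply: eq_bigr => k _.
  by rewrite linearP.
by move=> k kK; rewrite dcoordD dcoordZ xK // yK // scaler0 addr0.
Qed.

Definition delim g : {linear dsum -> W} := mk_linear (delim_linear g).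

End DirectSum.

(* Graded linear map of degree l. The target degree is a separate index, the
   map being 0 unless it equals p + l: no transport along equalities between
   degrees is ever needed. *)
Record ghom (F : fieldType) (l : int) (V W : int -> lmodType F) := GHom {
  gmap :> forall p q, {linear V p -> W q};
  gshape : forall p q x, q != p + l -> gmap p q x = 0 }.

Record complex (F : fieldType) := Complex {
  cmod :> int -> lmodType F;
  cdiff : ghom (-1) cmod cmod;
  cdiff2 : forall p q r x, cdiff q r (cdiff p q x) = 0 }.

Arguments cdiff {F} c.

(* The differential f |-> d f - (-1)^|f| f d of the complex of graded maps. *)
Section HomDiff.
Variables (F : fieldType) (V W : complex F) (l : int) (f : ghom l V W).

Definition hdiff_fun p q (x : V p) : W q :=
  cdiff W (p + l) q (f p (p + l) x)
  - (-1 : F) ^ l *: f (p - 1) q (cdiff V p (p - 1) x).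

Lemma hdiff_linear p q : linear (@hdiff_fun p q).
Proof.
move=> a x y; rewrite /hdiff_fun !linearP /=.
by rewrite addrACA -scalerDr.
Qed.

Lemma hdiff_shape p q x : q != p + (l - 1) -> mk_linear (@hdiff_linear p q) x = 0.
Proof.
move=> qpl /=; rewrite /hdiff_fun gshape ?gshape ?scaler0 ?subr0 //.
  by apply: contraNneq qpl => ->; rewrite addrAC addrA.
by apply: contraNneq qpl => ->; rewrite addrA.
Qed.

Definition hdiff : ghom (l - 1) V W := GHom hdiff_shape.

Lemma hdiffE p q (x : V p) : hdiff p q x = cdiff W (p + l) q (f p (p + l) x)
  - (-1 : F) ^ l *: f (p - 1) q (cdiff V p (p - 1) x).
Proof. by []. Qed.

End HomDiff.

Lemma hdiff2 (F : fieldType) (V W : complex F) l (f : ghom l V W) p q x :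
  hdiff (hdiff f) p q x = 0.
Proof.
rewrite !hdiffE !cdiff2 linear0 scaler0 subr0 linearB cdiff2 sub0r linearZ_LR.
have -> : p + (l - 1) = p - 1 + l by rewrite addrA addrAC.
rewrite -opprD -scalerDl.
have -> : (-1 : F) ^ l = - (-1) ^ (l - 1).
  have {1}-> : l = (l - 1) + 1 by rewrite subrK.
  by rewrite exprzDr ?unitrN1 // [_ ^ 1]expr1z mulrN1.
by rewrite addNr scale0r oppr0.
Qed.

(* Com(m, n), the vector space with basis the maps from an m-element set to an
   n-element set; elements are the coefficient functions. Sets {1,...,n} are
   rendered by 'I_n, so all elements are shifted by one. *)
Definition Com (F : fieldType) (m n : nat) :=
  {ffun {ffun 'I_m -> 'I_n} -> F^o}.
HB.instance Definition _ F m n := GRing.Lmodule.on (Com F m n).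

Section ComCategory.
Variable F : fieldType.

Definition com_of m n (f : {ffun 'I_m -> 'I_n}) : Com F m n :=
  [ffun g => (g == f)%:R].

Lemma com_ofE m n (f g : {ffun 'I_m -> 'I_n}) : com_of f g = (g == f)%:R.
Proof. by rewrite ffunE. Qed.

Definition com_id n : Com F n n := com_of [ffun t => t].

Definition com_comp m n r (b : Com F n r) (a : Com F m n) : Com F m r :=
  \sum_f \sum_g (a f * b g) *: com_of [ffun t => g (f t)].

(* Com being concentrated in degree 0 with zero differential, a dg-functor
   takes morphisms to chain maps of degree 0. *)
Record dgfun := DgFun {
  dobj :> nat -> complex F;
  dmap : forall m n, Com F m n -> ghom 0 (dobj m) (dobj n);
  dmap_linear : forall m n (c : F) (a b : Com F m n) p q x,
    dmap (c *: a + b) p q x = c *: dmap a p q x + dmap b p q x;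
  dmap_id : forall n p x, dmap (com_id n) p p x = x;
  dmap_comp : forall m n r (b : Com F n r) (a : Com F m n) p q x,
    dmap (com_comp b a) p q x = dmap b p q (dmap a p p x);
  dmap_diff : forall m n (a : Com F m n) p q x,
    cdiff (dobj n) p q (dmap a p p x) = dmap a q q (cdiff (dobj m) p q x) }.

(* Elements of degree r of the complex of enriched natural transformations:
   the components are graded maps, not required to commute with d. *)
Record dgnat (r : int) (Phi Psi : dgfun) := DgNat {
  dcomp :> forall n, ghom r (Phi n) (Psi n);
  dcomp_nat : forall m n (a : Com F m n) p q x,
    dcomp n p q (dmap Phi a p p x) = dmap Psi a q q (dcomp m p q x) }.

Lemma dgnat_diff_subproof r (Phi Psi : dgfun) (eta : dgnat r Phi Psi)
    m n (a : Com F m n) p q x :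
  hdiff (eta n) p q (dmap Phi a p p x) = dmap Psi a q q (hdiff (eta m) p q x).
Proof.
rewrite /= /hdiff_fun dmap_diff !dcomp_nat dmap_diff.
by rewrite linearB [dmap Psi a q q (_ *: _)]linearZ.
Qed.

Definition dgnat_diff r (Phi Psi : dgfun) (eta : dgnat r Phi Psi) :
    dgnat (r - 1) Phi Psi :=
  DgNat (dgnat_diff_subproof eta).

End ComCategory.

Arguments com_id {F} n.

(* The map m^k_{i,i+1} for k = j + 2 and 1 <= i <= k. *)
Definition cface_val (j i s : nat) : nat :=
  if i == j.+2 then (if s == j.+1 then 0%N else s)
  else (if (s < i)%N then s else s.-1).

Definition cface (j i : nat) : {ffun 'I_j.+2 -> 'I_j.+1} :=
  [ffun s : 'I_j.+2 => inord (cface_val j i s)].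

Lemma cfaceE j i s : (0 < i <= j.+2)%N -> cface j i s = cface_val j i s :> nat.
Proof.
case/andP=> i0 ij; rewrite ffunE inordK // /cface_val; have := ltn_ord s.
by case: (eqVneq i j.+2); case: (eqVneq (s : nat) j.+1); case: (ltnP s i); lia.
Qed.

Lemma cface_comp j i i' : (0 < i')%N -> (i' < i)%N -> (i <= j.+3)%N ->
  [ffun t => cface j i' (cface j.+1 i t)]
  = [ffun t => cface j i.-1 (cface j.+1 i' t)].
Proof.
move=> i'0 i'i ij; apply/ffunP => t; apply/ord_inj; rewrite [in LHS]ffunE [in RHS]ffunE.
rewrite !cfaceE; try lia; have := ltn_ord t; rewrite /cface_val.
by do ![case: ifP]; lia.
Qed.

Lemma com_comp_of (F : fieldType) m n r (g : {ffun 'I_n -> 'I_r})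
    (f : {ffun 'I_m -> 'I_n}) :
  com_comp (com_of F g) (com_of F f) = com_of F [ffun t => g (f t)].
Proof.
rewrite /com_comp (bigD1 f) //= (bigD1 g) //= !com_ofE !eqxx mulr1 scale1r.
rewrite [X in _ + X + _]big1 => [|h hg]; last first.
  by rewrite !com_ofE (negPf hg) mulr0 scale0r.
rewrite big1 ?addr0 // => h hf; rewrite big1 // => h' _.
by rewrite !com_ofE (negPf hf) mul0r scale0r.
Qed.

Section DgfunTheory.
Variables (F : fieldType) (Phi : dgfun F).

Lemma dmap_comp_eq m n r (b : Com F n r) (a : Com F m n) p p' q x : p' = p ->
  dmap Phi b p' q (dmap Phi a p p' x) = dmap Phi (com_comp b a) p q x.
Proof. by move->; rewrite dmap_comp. Qed.

Lemma dmap_diff_eq m n (a : Com F m n) p p' q q' x : p' = p -> q' = q ->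
  cdiff (Phi n) p' q (dmap Phi a p p' x)
  = dmap Phi a q' q (cdiff (Phi m) p q' x).
Proof. by move=> -> ->; rewrite dmap_diff. Qed.

End DgfunTheory.

Lemma alternating_cancel (F : fieldType) (V : lmodType F) (n : nat)
    (G : nat -> nat -> V) :
    (forall i' i, (0 < i')%N -> (i' < i)%N -> (i <= n.+1)%N ->
      G i' i = G i.-1 i') ->
  \sum_(1 <= i' < n.+1) \sum_(1 <= i < n.+2)
    (-1 : F) ^+ i' *: ((-1 : F) ^+ i *: G i' i) = 0.
Proof.
move=> GE.
pose H i' i : V := (-1 : F) ^+ (i' + i) *: G i' i.
pose L i' i : V := if (i <= i')%N then H i' i else 0.
suff HL i' : (1 <= i' < n.+1)%N -> \sum_(1 <= i < n.+2)
    (-1 : F) ^+ i' *: ((-1 : F) ^+ i *: G i' i)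
  = \sum_(1 <= i < n.+1) L i' i - \sum_(1 <= i < n.+1) L i i'.
  rewrite (eq_big_nat _ _ HL) big_split /= sumrN.
  by rewrite [X in _ - X]exchange_big_nat subrr.
move=> /andP[i'0 i'n].
have -> : \sum_(1 <= i < n.+1) L i' i = \sum_(1 <= i < n.+2) L i' i.
  by rewrite [RHS]big_nat_recr //= /L leqNgt i'n addr0.
have -> : - \sum_(1 <= i < n.+1) L i i'
    = \sum_(1 <= i < n.+2) if (i' < i)%N then H i' i else 0.
  rewrite [RHS]big_nat_recl //= -sumrN ltnNge i'0 add0r.
  apply: eq_big_nat => i /andP[i0 iN].
  rewrite /L ltnS; case: ifP => [i'i|_]; last by rewrite oppr0.
  by rewrite /H (GE i' i.+1) ?ltnS // addnS exprS mulN1r scaleNr addnC.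
rewrite -big_split /=; apply: eq_big_nat => i _.
by rewrite /L /H ltnNge; case: (i <= i')%N;
  rewrite ?addr0 ?add0r scalerA -exprD.
Qed.

Section Hochschild.
Variables (F : fieldType) (Phi : dgfun F).

(* C(Phi)_q, the sum over k of Phi(k + 1)[k] in degree q. *)
Definition hoch_mod (q : int) : lmodType F :=
  dsum (fun k : nat => Phi k.+1 (q - k%:Z)).

(* The coordinate of d(x) in Phi(j + 1) receives the internal differential of
   x_j and the face maps applied to x_(j+1), an element of Phi(k), k = j + 2,
   of degree q - (j + 1). *)
Definition hoch_coord (q q' : int) (x : hoch_mod q) (j : nat) :
    Phi j.+1 (q' - j%:Z) :=
  cdiff (Phi j.+1) (q - j%:Z) (q' - j%:Z) (x j)
  + (-1 : F) ^ (q - j.+1%:Z) *: \sum_(1 <= i < j.+3)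
      (-1) ^+ i *: dmap Phi (com_of F (cface j i))
                     (q - j.+1%:Z) (q' - j%:Z) (x j.+1).

Lemma hoch_fin q q' (x : hoch_mod q) :
  exists N, forall j, (N <= j)%N -> hoch_coord q' x j = 0.
Proof.
have [N xN] := dsum_fin x; exists N => j Nj.
rewrite /hoch_coord !xN ?linear0 ?add0r //; last exact: leqW.
by rewrite big1 ?scaler0 // => i _; rewrite linear0 scaler0.
Qed.

Definition hoch_fun q q' (x : hoch_mod q) : hoch_mod q' := DSum (hoch_fin q' x).

Lemma hoch_linear q q' : linear (@hoch_fun q q').
Proof.
move=> a x y; apply: dsumP => j; rewrite dcoordD dcoordZ /= /hoch_coord.
rewrite !dcoordD !dcoordZ linearP scalerDr addrACA; congr (_ + _).
rewrite (scalerA a) (mulrC a) -scalerA -scalerDr; congr (_ *: _).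
rewrite scaler_sumr -big_split; apply: eq_bigr => i _ /=.
by rewrite linearP scalerDr !scalerA (mulrC a).
Qed.

Lemma hoch_shape q q' x : q' != q + -1 -> mk_linear (@hoch_linear q q') x = 0.
Proof.
move=> qq'; apply: dsumP => j; rewrite dcoord0 /= /hoch_coord gshape ?add0r.
  rewrite big1 ?scaler0 // => i _; rewrite gshape ?scaler0 //.
  apply: contraNneq qq' => /(canRL (subrK _)) ->.
  by rewrite addr0 -addn1 PoszD opprD addrA addrAC subrK.
by apply: contraNneq qq' => /(canRL (subrK _)) ->; rewrite addrAC subrK.
Qed.

Definition hoch_diff : ghom (-1) hoch_mod hoch_mod := GHom hoch_shape.

Lemma hoch_diff2 p q r x : hoch_diff q r (hoch_diff p q x) = 0.
Proof.
have [qp|/(gshape hoch_diff)->] := eqVneq q (p + -1); last by rewrite linear0.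
have [rq|/(gshape hoch_diff)->//] := eqVneq r (q + -1).
apply: dsumP => j; rewrite dcoord0 /= /hoch_coord /= /hoch_coord.
have e1 : q - j%:Z = p - j.+1%:Z by rewrite qp; lia.
have e2 : r - j%:Z = q - j.+1%:Z by rewrite rq; lia.
have e3 : q - j.+1%:Z = p - j.+2%:Z by rewrite qp; lia.
rewrite linearD cdiff2 add0r [cdiff _ _ _ (_ *: _)]linearZ linear_sum /=.
under eq_bigr => i _.
  rewrite linearZ /= (dmap_diff_eq _ _ e1 (esym e2)); over.
under [X in _ + _ *: X]eq_bigr => i _.
  rewrite linearD scalerDr [dmap _ _ _ _ (_ *: _)]linearZ linear_sum /=; over.
rewrite big_split /= scalerDr addrA -scalerDl.
have -> : (-1 : F) ^ (p - j.+1%:Z) + (-1) ^ (q - j.+1%:Z) = 0.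
  have -> : p - j.+1%:Z = (q - j.+1%:Z) + 1 by rewrite qp; lia.
  by rewrite expfzDr ?oppr_eq0 ?oner_eq0 // expr1z mulrN1 addNr.
rewrite scale0r add0r.
under eq_bigr => i' _.
  under eq_bigr => i _.
    rewrite [dmap _ _ _ _ (_ *: _)]linearZ /= (dmap_comp_eq _ _ _ _ e3) com_comp_of; over.
  rewrite scalerA mulrC -scalerA scaler_sumr; over.
rewrite -scaler_sumr alternating_cancel ?scaler0 // => i' i i'0 i'i ij.
by rewrite cface_comp.
Qed.

Definition hochschild : complex F := Complex hoch_diff2.

End Hochschild.

(* C(eta) acts as eta, without sign, on every summand: the shift is on the
   right, as in the differential of the Hochschild complex. *)
Section HochschildFunctor.
Variables (F : fieldType) (r : int) (Phi Psi : dgfun F) (eta : dgnat r Phi Psi).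

Lemma hoch_nat_fin q q' (x : hochschild Phi q) :
  exists N, forall k, (N <= k)%N ->
    eta k.+1 (q - k%:Z) (q' - k%:Z) (x k) = 0.
Proof. by have [N xN] := dsum_fin x; exists N => k /xN->; rewrite linear0. Qed.

Definition hoch_nat_fun q q' (x : hochschild Phi q) : hochschild Psi q' :=
  DSum (hoch_nat_fin q' x).

Lemma hoch_nat_linear q q' : linear (@hoch_nat_fun q q').
Proof.
by move=> a x y; apply: dsumP => k; rewrite dcoordD dcoordZ /= linearP.
Qed.

Lemma hoch_nat_shape q q' x :
  q' != q + r -> mk_linear (@hoch_nat_linear q q') x = 0.
Proof.
move=> qq'; apply: dsumP => k; rewrite dcoord0 /= gshape //.
by apply: contraNneq qq' => /(canRL (subrK _)) ->; rewrite addrAC subrK.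
Qed.

Definition hoch_nat : ghom r (hochschild Phi) (hochschild Psi) :=
  GHom hoch_nat_shape.

End HochschildFunctor.

(* Naturality is that of the dg-enriched setting: with respect to graded
   natural transformations of every degree r, up to the Koszul sign. *)
Record natop (F : fieldType) (l : int) := NatOp {
  nop :> forall Phi : dgfun F, ghom l (hochschild Phi) (hochschild Phi);
  nop_nat : forall (Phi Psi : dgfun F) r (eta : dgnat r Phi Psi) p s x,
    nop Psi (p + r) s (hoch_nat eta p (p + r) x)
    = (-1 : F) ^ (r * l) *: hoch_nat eta (p + l) s (nop Phi p (p + l) x) }.

Section NatDiff.
Variables (F : fieldType).

Lemma hoch_nat_diff r (Phi Psi : dgfun F) (eta : dgnat r Phi Psi) p q x :
  hoch_nat (dgnat_diff eta) p q x = hdiff (hoch_nat eta) p q x.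
Proof.
have [qE|qN] := eqVneq q (p + (r - 1)); last by rewrite !gshape.
apply: dsumP => j; rewrite /= /hdiff_fun /= /hoch_coord.
rewrite [eta _ _ _ (_ + _)]linearD /= scalerDr opprD addrACA.
have e1 : p - j%:Z + r = p + r - j%:Z by lia.
have e2 : p - j%:Z - 1 = p - 1 - j%:Z by lia.
have e3 : p - 1 - j%:Z = p - j.+1%:Z by lia.
have e4 : p + r - j.+1%:Z = q - j%:Z by rewrite qE; lia.
rewrite e1 e2 -[LHS]addr0; congr (_ + _).
rewrite [eta _ _ _ (_ *: _)]linearZ scalerA.
rewrite [eta _ _ _ (\sum_(_ <= _ < _) _)]linear_sum /=.
under [X in _ = _ - _ *: X]eq_bigr => i _.
  rewrite [eta _ _ _ (_ *: _)]linearZ /= e3 dcomp_nat; over.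
rewrite e4 -scalerBl -expfzDr ?oppr_eq0 ?oner_eq0 //.
by rewrite (_ : r + _ = q - j%:Z) ?subrr ?scale0r //; lia.
Qed.

Lemma nop_nat_eq l (f : natop F l) (Phi Psi : dgfun F) r
    (eta : dgnat r Phi Psi) p pr pl s x : pr = p + r -> pl = p + l ->
  f Psi pr s (hoch_nat eta p pr x)
  = (-1 : F) ^ (r * l) *: hoch_nat eta pl s (f Phi p pl x).
Proof. by move=> -> ->; apply: nop_nat. Qed.

Lemma signzB (a b : int) : (-1 : F) ^ (a - b) = (-1) ^ a * (-1) ^ b.
Proof.
by rewrite expfzDr ?oppr_eq0 ?oner_eq0 // -exprz_inv invrN1.
Qed.

Variables (l : int) (f : natop F l).

Lemma nat_diff_subproof (Phi Psi : dgfun F) r (eta : dgnat r Phi Psi) p s x :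
  hdiff (f Psi) (p + r) s (hoch_nat eta p (p + r) x)
  = (-1 : F) ^ (r * (l - 1)) *:
      hoch_nat eta (p + (l - 1)) s (hdiff (f Phi) p (p + (l - 1)) x).
Proof.
rewrite !hdiffE.
set y := f Phi p (p + l) x; set z := cdiff (hochschild Phi) p (p - 1) x.
have ty : cdiff (hochschild Psi) (p + r + l) s
      (hoch_nat eta (p + l) (p + r + l) y)
    = hoch_nat (dgnat_diff eta) (p + l) s y + (-1 : F) ^ r *:
      hoch_nat eta (p + (l - 1)) s
        (cdiff (hochschild Phi) (p + l) (p + (l - 1)) y).
  by rewrite hoch_nat_diff hdiffE addrA [p + r + l]addrAC
             subrK.
have tx : cdiff (hochschild Psi) (p + r) (p + r - 1)
      (hoch_nat eta p (p + r) x)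
    = hoch_nat (dgnat_diff eta) p (p + r - 1) x
      + (-1 : F) ^ r *: hoch_nat eta (p - 1) (p + r - 1) z.
  by rewrite hoch_nat_diff hdiffE subrK.
rewrite (nop_nat_eq _ _ _ _ erefl erefl) linearZ_LR -/y ty tx.
rewrite [f Psi _ _ (_ + _)]linearD [f Psi _ _ (_ *: _)]linearZ_LR.
have e1 : p + r - 1 = p + (r - 1) by lia.
have e2 : p + r - 1 = p - 1 + r by lia.
have e3 : p + (l - 1) = p - 1 + l by lia.
rewrite (nop_nat_eq _ _ _ _ e1 erefl) (nop_nat_eq _ _ _ _ e2 e3) -/y.
rewrite [hoch_nat _ _ _ (_ - _)]linearB [hoch_nat _ _ _ (_ *: _)]linearZ_LR.
rewrite !mulrBl !mulrBr mul1r mulr1 !signzB !scalerDr !scalerN !scalerA !opprD.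
rewrite addrACA -scalerBl mulrCA -(signzB l l) subrr expr0z mulr1 subrr scale0r add0r.
congr (_ - _ *: _).
by rewrite [LHS]mulrC [LHS]mulrA mulrAC.
Qed.

Definition nat_diff : natop F (l - 1) :=
  NatOp (nop := fun Phi => hdiff (f Phi)) nat_diff_subproof.

End NatDiff.

Section Operations.
Variables (F : fieldType) (l : nat).

(* The degree l part of the complex of operations, for l >= 0, is the product
   of the Com(k + 1, k + l + 1) for k >= 0. *)
Definition opfam := forall k : nat, Com F k.+1 (l + k).+1.

Section OpOf.
Variables (f : opfam) (Phi : dgfun F) (q q' : int).

Definition op_of_summand (k : nat) (v : Phi k.+1 (q - k%:Z)) :
    hochschild Phi q' :=
  (-1 : F) ^ (l%:Z * (q - k%:Z)) *:
    dinj _ (l + k)%N (dmap Phi (f k) (q - k%:Z) (q' - (l + k)%N%:Z) v).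

Lemma op_of_summand_linear k : linear (@op_of_summand k).
Proof.
move=> a u v; rewrite /op_of_summand linearP linearP scalerDr !scalerA.
by rewrite (mulrC a).
Qed.

Definition op_of_map : {linear hochschild Phi q -> hochschild Phi q'} :=
  delim (fun k => mk_linear (@op_of_summand_linear k)).

Lemma op_of_mapE (x : hochschild Phi q) N : (forall k, (N <= k)%N -> x k = 0) ->
  op_of_map x = \sum_(k < N) op_of_summand (x k).
Proof. by move=> xN; rewrite [LHS](delim_funE _ xN). Qed.

Lemma op_of_shape x : q' != q + l%:Z -> op_of_map x = 0.
Proof.
move=> qq'; have [N xN] := dsum_fin x; rewrite (op_of_mapE xN).
apply: big1 => k _; rewrite /op_of_summand gshape ?linear0 ?scaler0 //.
apply: contraNneq qq' => /(canRL (subrK _)) ->.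
by rewrite PoszD addr0 [_ + k%:Z]addrC addrA subrK.
Qed.

End OpOf.

Lemma op_of_nat f (Phi Psi : dgfun F) r (eta : dgnat r Phi Psi) p s x :
  op_of_map f Psi (p + r) s (hoch_nat eta p (p + r) x)
  = (-1 : F) ^ (r * l%:Z) *:
      hoch_nat eta (p + l%:Z) s (op_of_map f Phi p (p + l%:Z) x).
Proof.
have [sE|sN] := eqVneq s (p + r + l%:Z); last first.
  by rewrite op_of_shape // gshape ?scaler0 // addrAC.
have [N xN] := dsum_fin x.
have yN k : (N <= k)%N -> hoch_nat eta p (p + r) x k = 0.
  by move=> /xN /= ->; rewrite linear0.
rewrite (op_of_mapE _ _ yN) (op_of_mapE _ _ xN) linear_sum scaler_sumr.
apply: eq_bigr => k _; rewrite /op_of_summand linearZ_LR scalerA.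
have e1 : p + l%:Z - (l + k)%N%:Z = p - k%:Z by lia.
have e2 : s - (l + k)%N%:Z = p + r - k%:Z by rewrite sE; lia.
congr (_ *: _).
  by rewrite -expfzDr ?oppr_eq0 ?oner_eq0 //; congr (_ ^ _); lia.
apply: dsumP => j /=; case: (eqVneq (l + k)%N j) => [<-|lkj].
  by rewrite !dfwith_in e1 e2 dcomp_nat.
by rewrite !dfwith_out // linear0.
Qed.

(* The operation acting on the summand Phi(k + 1) by Phi(f_k), with the Koszul
   sign (-1)^(l|x|). *)
Definition op_of (f : opfam) : natop F l%:Z :=
  NatOp (nop := fun Phi => GHom (@op_of_shape f Phi)) (op_of_nat f).

Definition opfam_lcomb (c : nat -> F) (y : nat -> opfam) : opfam :=
  fun i => \sum_(k \in [set: nat]) c k *: y k i.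

Definition locally_finite (y : nat -> opfam) : Prop :=
  forall i, finite_set [set k | y k i != 0].

End Operations.

Section Homology.
Variables (F : fieldType) (l : int).

Definition is_cycle (z : natop F l) : Prop :=
  forall Phi p q x, nat_diff z Phi p q x = 0.

Definition homologous (z z' : natop F l) : Prop :=
  exists b : natop F (l + 1), forall Phi p q x,
    z Phi p q x - z' Phi p q x = nat_diff b Phi p q x.

(* Homology classes are the equivalence classes of cycles. The type of natural
   operations quantifies over all dg-functors and is too large to carry a
   MathComp structure, so the quotient is formed by hand. *)
Definition homology : Type :=
  {S : natop F l -> Prop | exists2 z, is_cycle z & S = homologous z}.

Definition hclass (z : natop F l) (zc : is_cycle z) : homology :=
  exist _ (homologous z) (ex_intro2 _ _ z zc erefl).

Lemma nat_zero_shape (Phi : dgfun F) p q (x : hochschild Phi p) :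
  q != p + l ->
  (\0 : {linear hochschild Phi p -> hochschild Phi q}) x = 0.
Proof. by []. Qed.

Lemma nat_zero_nat (Phi Psi : dgfun F) r (eta : dgnat r Phi Psi) p s x :
  GHom (@nat_zero_shape Psi) (p + r) s (hoch_nat eta p (p + r) x)
  = (-1 : F) ^ (r * l) *:
      hoch_nat eta (p + l) s (GHom (@nat_zero_shape Phi) p (p + l) x).
Proof.
apply/esym; rewrite [X in _ *: X](_ : _ = 0) ?scaler0 //.
exact: (linear0 (hoch_nat eta (p + l) s)).
Qed.

Definition nat_zero : natop F l :=
  NatOp (nop := fun Phi => GHom (@nat_zero_shape Phi)) nat_zero_nat.

Lemma nat_zero_cycle : is_cycle nat_zero.
Proof.
move=> Phi p q x; rewrite [LHS]hdiffE scaler0 subr0.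
exact: (linear0 (cdiff (hochschild Phi) (p + l) q)).
Qed.

Definition homology0 : homology := hclass nat_zero_cycle.

End Homology.

Section ShuffleOperations.
Variable F : fieldType.

Definition descents n (s : 'S_n) : nat :=
  #|[set ij : 'I_n * 'I_n | (ij.2 == ij.1.+1 :> nat) && (s ij.2 < s ij.1)%N]|.

(* lift_perm ord0 ord0 s fixes the first element and is s on the others. *)
Definition shuffle_l (n k : nat) : Com F n.+1 n.+1 :=
  \sum_(s : 'S_n | (descents s).+1 == k)
    (-1) ^+ (lift_perm ord0 ord0 s) *:
      com_of F [ffun t => lift_perm ord0 ord0 s t].

Definition sh (k : nat) : opfam F 0 := fun n =>
  if (n == 0%N) && (k == 0%N) then com_id n.+1
  else if (n < k)%N then 0
  else \sum_(1 <= i < k.+1) 'C(n - i, k - i)%:R *: shuffle_l n i.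

(* The map g_i for 1 <= i <= l, in the zero-based numbering. *)
Definition connes_g (l i : nat) : {ffun 'I_l -> 'I_l.+1} :=
  [ffun t : 'I_l => inord (if (t + i.+1 <= l)%N then t + i.+1
                           else t + i.+1 - l)%N].

Definition connes (l : nat) : Com F l l.+1 :=
  \sum_(1 <= i < l.+1) (-1) ^+ (i * l.+1) *: com_of F (connes_g l i).

Definition connes_sh (k : nat) : opfam F 1 := fun n =>
  com_comp (connes n.+1) (sh k n).

End ShuffleOperations.

(* Main.v *)
(* Evaluating an operation on the representable functors identifies it with a
   family of elements of Com(k+1, k+l+1), and the complex of operations with the
   product total complex of the spaces Com(k+1, j+1): simplicial in j, where the
   k-th column is the complex of chains of the torus (S^1)^(k+1), and cosimplicial
   in k. Filter by k. A cycle with lowest component k restricts there to a cycle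
   of the torus; after normalizing in the cosimplicial direction its class dies on
   all coordinate subtori omitting a coordinate other than the base point. Hence
   it vanishes unless l = 0, where it is a multiple of the class of (S^1)^k, or
   l = 1, where it is a multiple of the class of (S^1)^(k+1); these are the lowest
   components of the cycles sh^k and B^k. Subtracting multiples of these cycles
   and boundaries, component by component, gives existence. For uniqueness, a
   primitive of a combination of the cycles can be pushed in the same way to start
   at the first component where the combination does not vanish, which is then a
   boundary of the torus and so zero.

   The element sh^k commutes with the Hochschild differential: in the inner faces,
   exchanging two adjacent values of a permutation cancels everything but
   the terms where they are at adjacent positions, and there the weights
   binom(n-i,k-i) subtract by Pascal's rule; the two outer faces cancel likewise,
   the first and the last value playing the role of adjacent values. *)

From HB Require Import structures.
Require Import Defs.
From mathcomp Require Import all_boot all_order all_algebra.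
From mathcomp Require Import fingroup perm zify ring.
From mathcomp Require Import boolp classical_sets cardinality fsbigop.

Set Implicit Arguments.
Unset Strict Implicit.
Unset Printing Implicit Defensive.

Import GRing.Theory.
Local Open Scope ring_scope.

(** * Linear algebra of Com *)

Section ComAlgebra.
Variable F : fieldType.

Lemma com_sum_of m n (a : Com F m n) : a = \sum_f a f *: com_of F f.
Proof.
apply/ffunP => g; rewrite sum_ffunE (bigD1 g) //= big1 => [|f fg].
  by rewrite !ffunE eqxx addr0 [_ *: _]mulr1.
by rewrite !ffunE eq_sym (negPf fg) [_ *: _]mulr0.
Qed.

(** Linear extension from the basis of set maps. Operators on [Com] are defined through it, so that
    identities between them can be checked on [com_of] by [com_ind]. *)
Definition com_lift m n (V : lmodType F) (u : {ffun 'I_m -> 'I_n} -> V)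
  (a : Com F m n) : V := \sum_f a f *: u f.

Lemma com_lift_linear m n V u : linear (@com_lift m n V u).
Proof.
move=> c a b; rewrite /com_lift scaler_sumr -big_split /=.
by apply: eq_bigr => f _; rewrite !ffunE scalerDl scalerA.
Qed.

HB.instance Definition _ m n (V : lmodType F) (u : {ffun 'I_m -> 'I_n} -> V) :=
  GRing.isLinear.Build F (Com F m n) V *:%R (@com_lift m n V u)
    (@com_lift_linear m n V u).

Lemma com_lift_of m n V u (f : {ffun 'I_m -> 'I_n}) :
  @com_lift m n V u (com_of F f) = u f.
Proof.
rewrite /com_lift (bigD1 f) //= com_ofE eqxx scale1r big1 ?addr0 // => g gf.
by rewrite com_ofE (negPf gf) scale0r.
Qed.

Lemma com_ind m n (P : Com F m n -> Prop) : P 0 ->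
  (forall c a b, P a -> P b -> P (c *: a + b)) ->
  (forall f, P (com_of F f)) -> forall a, P a.
Proof.
move=> P0 PL Pf a; rewrite [a]com_sum_of.
elim: (index_enum _) => [|f s IH]; first by rewrite big_nil.
by rewrite big_cons; apply: PL.
Qed.

Lemma com_compE m n r (b : Com F n r) (a : Com F m n) :
  com_comp b a = com_lift (fun f => com_lift (fun g => com_of F [ffun t => g (f t)]) b) a.
Proof.
rewrite /com_comp /com_lift; apply: eq_bigr => f _.
by rewrite scaler_sumr; apply: eq_bigr => g _; rewrite scalerA.
Qed.

Lemma com_comp_linear m n r (b : Com F n r) : linear (@com_comp F m n r b).
Proof. by move=> c a a'; rewrite !com_compE linearP. Qed.

HB.instance Definition _ m n r (b : Com F n r) :=
  GRing.isLinear.Build F (Com F m n) (Com F m r) *:%R (@com_comp F m n r b)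
    (@com_comp_linear m n r b).

(** Composition with its arguments exchanged, which makes linearity in the left factor available as
    an instance too. *)
Definition com_pre m n r (a : Com F m n) (b : Com F n r) := com_comp b a.

Lemma com_pre_linear m n r (a : Com F m n) : linear (@com_pre m n r a).
Proof.
move=> c b b'; rewrite /com_pre !com_compE /com_lift scaler_sumr -big_split /=.
apply: eq_bigr => f _; rewrite -/(com_lift _ b) -/(com_lift _ b').
rewrite scalerA mulrC -scalerA -scalerDr -linearP.
by congr (_ *: _); apply: eq_bigr => g _.
Qed.

HB.instance Definition _ m n r (a : Com F m n) :=
  GRing.isLinear.Build F (Com F n r) (Com F m r) *:%R (@com_pre m n r a)
    (@com_pre_linear m n r a).

Lemma com_preE m n r (a : Com F m n) (b : Com F n r) : com_comp b a = com_pre a b.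
Proof. by []. Qed.

Lemma com_comp0l m n r (a : Com F m n) : com_comp (0 : Com F n r) a = 0.
Proof. by rewrite com_preE linear0. Qed.
Lemma com_comp0r m n r (b : Com F n r) : com_comp b (0 : Com F m n) = 0.
Proof. by rewrite linear0. Qed.
Lemma com_compDl m n r (b b' : Com F n r) (a : Com F m n) :
  com_comp (b + b') a = com_comp b a + com_comp b' a.
Proof. by rewrite com_preE linearD. Qed.
Lemma com_compBl m n r (b b' : Com F n r) (a : Com F m n) :
  com_comp (b - b') a = com_comp b a - com_comp b' a.
Proof. by rewrite com_preE linearB. Qed.
Lemma com_compZl m n r c (b : Com F n r) (a : Com F m n) :
  com_comp (c *: b) a = c *: com_comp b a.
Proof. by rewrite com_preE linearZ. Qed.
Lemma com_comp_suml m n r I (s : seq I) P (b : I -> Com F n r) (a : Com F m n) :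
  com_comp (\sum_(i <- s | P i) b i) a = \sum_(i <- s | P i) com_comp (b i) a.
Proof. by rewrite com_preE linear_sum. Qed.

Lemma com_compDr m n r (b : Com F n r) (a a' : Com F m n) :
  com_comp b (a + a') = com_comp b a + com_comp b a'.
Proof. by rewrite linearD. Qed.
Lemma com_compBr m n r (b : Com F n r) (a a' : Com F m n) :
  com_comp b (a - a') = com_comp b a - com_comp b a'.
Proof. by rewrite linearB. Qed.
Lemma com_compZr m n r c (b : Com F n r) (a : Com F m n) :
  com_comp b (c *: a) = c *: com_comp b a.
Proof. by rewrite linearZ. Qed.
Lemma com_comp_sumr m n r I (s : seq I) P (b : Com F n r) (a : I -> Com F m n) :
  com_comp b (\sum_(i <- s | P i) a i) = \sum_(i <- s | P i) com_comp b (a i).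
Proof. by rewrite linear_sum. Qed.

Lemma com_compA m n r s (c : Com F r s) (b : Com F n r) (a : Com F m n) :
  com_comp c (com_comp b a) = com_comp (com_comp c b) a.
Proof.
elim/com_ind: a => [|x a a' IH IH'|f]; first by rewrite !linear0.
  by rewrite !com_compDr !com_compZr IH IH'.
elim/com_ind: b => [|x b b' IH IH'|g].
- by rewrite !(com_comp0l, com_comp0r).
- by rewrite com_compDr com_compZr !com_compDl !com_compZl com_compDr com_compZr IH IH'.
elim/com_ind: c => [|x c c' IH IH'|h]; first by rewrite !com_comp0l.
  by rewrite !com_compDl !com_compZl IH IH'.
by rewrite !com_comp_of; congr com_of; apply/ffunP => t; rewrite !ffunE.
Qed.

Lemma com_comp1l m n (a : Com F m n) : com_comp (com_id n) a = a.
Proof.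
elim/com_ind: a => [|x a a' IH IH'|f]; first by rewrite !com_comp0r.
  by rewrite com_compDr com_compZr IH IH'.
by rewrite com_comp_of; congr com_of; apply/ffunP => t; rewrite !ffunE.
Qed.

Lemma com_comp1r m n (a : Com F m n) : com_comp a (com_id m) = a.
Proof.
elim/com_ind: a => [|x a a' IH IH'|f]; first by rewrite com_comp0l.
  by rewrite com_compDl com_compZl IH IH'.
by rewrite com_comp_of; congr com_of; apply/ffunP => t; rewrite !ffunE.
Qed.

(** ['I_j.+1] is the set of [j]-simplices of the simplicial circle with one non-degenerate edge, 0
    being the base point. Postcomposition with [bd] makes the [Com F n j.+1] the unnormalized chain
    complex of the [n]-torus, up to an overall sign; precomposition is the cosimplicial
    differential. *)
Definition bd j : Com F j.+2 j.+1 :=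
  \sum_(1 <= i < j.+3) (-1) ^+ i *: com_of F (cface j i).

(* Faces are numbered from 0, unlike cface; degen j i omits i + 1, hence never the
   base point. *)
Definition face j i : {ffun 'I_j.+2 -> 'I_j.+1} := cface j i.+1.
Definition degen j i : {ffun 'I_j -> 'I_j.+1} := [ffun s : 'I_j => inord (bump i.+1 s)].

Lemma bdE j : bd j = \sum_(i < j.+2) (-1) ^+ i.+1 *: com_of F (face j i).
Proof. by rewrite /bd big_add1 big_mkord. Qed.

Lemma bd_bd j : com_comp (bd j) (bd j.+1) = 0.
Proof.
rewrite {2}/bd com_comp_sumr -[RHS](alternating_cancel (n := j.+2)
  (G := fun i' i => com_comp (com_of F (cface j i')) (com_of F (cface j.+1 i)))).
  rewrite exchange_big_nat; apply: eq_bigr => i _; rewrite com_compZr /bd com_comp_suml.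
  rewrite scaler_sumr; apply: eq_bigr => i' _.
  by rewrite com_compZl scalerA mulrC -scalerA.
by move=> i' i i'0 i'i ij; rewrite !com_comp_of cface_comp.
Qed.

End ComAlgebra.

(** * Simplicial identities of the circle *)

Lemma degenE j i (s : 'I_j) : degen j i s = bump i.+1 s :> nat.
Proof. by rewrite ffunE inordK // /bump; case: leqP; have := ltn_ord s; lia. Qed.

Lemma faceE j i s : (i < j.+2)%N -> face j i s = cface_val j i.+1 s :> nat.
Proof. by move=> ij; rewrite cfaceE //; lia. Qed.

Lemma face_degen_lt j i r : (i < r)%N -> (r <= j.+1)%N ->
  [ffun s => face j.+1 i (degen j.+2 r s)] = [ffun s => degen j.+1 r.-1 (face j i s)].
Proof.
move=> ir rj; apply/ffunP => s; apply/ord_inj; rewrite [in LHS]ffunE [in RHS]ffunE.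
rewrite ?faceE ?degenE ?faceE ?degenE ?faceE; try lia.
have := ltn_ord s.
rewrite /cface_val /bump; do ?[case: ifP => ?]; lia.
Qed.

Lemma face_degen_id j i r : (r <= j)%N -> (i == r) || (i == r.+1) ->
  [ffun s => face j i (degen j.+1 r s)] = [ffun s => s].
Proof.
move=> rj ir; apply/ffunP => s; apply/ord_inj; rewrite [in LHS]ffunE [in RHS]ffunE.
have := ltn_ord s.
rewrite faceE ?degenE; last by lia.
rewrite /cface_val /bump; do ?[case: ifP => ?]; lia.
Qed.

Lemma face_degen_gt j i r : (r.+1 < i)%N -> (i <= j.+2)%N ->
  [ffun s => face j.+1 i (degen j.+2 r s)] = [ffun s => degen j.+1 r (face j i.-1 s)].
Proof.
move=> ir rj; apply/ffunP => s; apply/ord_inj; rewrite [in LHS]ffunE [in RHS]ffunE.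
rewrite ?faceE ?degenE ?faceE ?degenE ?faceE; try lia.
have := ltn_ord s.
rewrite /cface_val /bump; do ?[case: ifP => ?]; lia.
Qed.

Lemma degen_degen j i r : (i < r)%N ->
  [ffun s => degen j.+1 i (degen j r.-1 s)] = [ffun s => degen j.+1 r (degen j i s)].
Proof.
move=> ir; apply/ffunP => s; apply/ord_inj; rewrite [in LHS]ffunE [in RHS]ffunE.
rewrite !degenE; rewrite /bump; do ?[case: leqP => ?]; lia.
Qed.

(** * Homology of tori *)

Section Torus.
Variable F : fieldType.

Definition fcons n m (t : 'I_m) (x : {ffun 'I_n -> 'I_m}) : {ffun 'I_n.+1 -> 'I_m} :=
  [ffun s => oapp x t (unlift ord0 s)].

Definition ftail n m (f : {ffun 'I_n.+1 -> 'I_m}) : {ffun 'I_n -> 'I_m} :=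
  [ffun s => f (lift ord0 s)].

Lemma fcons0 n m (t : 'I_m) (x : {ffun 'I_n -> 'I_m}) : fcons t x ord0 = t.
Proof. by rewrite ffunE unlift_none. Qed.

Lemma fconsS n m (t : 'I_m) (x : {ffun 'I_n -> 'I_m}) s :
  fcons t x (lift ord0 s) = x s.
Proof. by rewrite ffunE liftK. Qed.

Lemma fconsK n m (t : 'I_m) (x : {ffun 'I_n -> 'I_m}) : ftail (fcons t x) = x.
Proof. by apply/ffunP => s; rewrite ffunE fconsS. Qed.

Lemma fcons_eta n m (f : {ffun 'I_n.+1 -> 'I_m}) : f = fcons (f ord0) (ftail f).
Proof.
apply/ffunP => s; case: (unliftP ord0 s) => [s'|] ->; last by rewrite fcons0.
by rewrite fconsS ffunE.
Qed.

Lemma comp_fcons n m r (g : {ffun 'I_m -> 'I_r}) t (x : {ffun 'I_n -> 'I_m}) :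
  [ffun s => g (fcons t x s)] = fcons (g t) [ffun s => g (x s)].
Proof.
apply/ffunP => s; rewrite [LHS]ffunE.
by case: (unliftP ord0 s) => [s'|] ->; rewrite ?fcons0 // !fconsS ffunE.
Qed.

Definition com_cons n m (t : 'I_m) : Com F n m -> Com F n.+1 m :=
  com_lift (fun x => com_of F (fcons t x)).

Lemma com_cons_linear n m (t : 'I_m) : linear (@com_cons n m t).
Proof. exact: com_lift_linear. Qed.
HB.instance Definition _ n m (t : 'I_m) :=
  GRing.isLinear.Build F (Com F n m) (Com F n.+1 m) *:%R (@com_cons n m t)
    (@com_cons_linear n m t).

Lemma com_cons_of n m (t : 'I_m) (x : {ffun 'I_n -> 'I_m}) :
  com_cons t (com_of F x) = com_of F (fcons t x).
Proof. exact: com_lift_of. Qed.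

Lemma comp_com_cons n m r (g : {ffun 'I_m -> 'I_r}) t (a : Com F n m) :
  com_comp (com_of F g) (com_cons t a) = com_cons (g t) (com_comp (com_of F g) a).
Proof.
elim/com_ind: a => [|c a b IHa IHb|f]; first by rewrite !linear0.
  by rewrite linearP !com_compDr !com_compZr IHa IHb linearP.
by rewrite com_comp_of !com_cons_of com_comp_of comp_fcons.
Qed.

(** A simplex of the shuffle triangulation of edge times [a]: the new coordinate [r.+1] is the edge
    of the circle degenerated everywhere but at [r], and it is paired with [a] degenerated at
    [r]. *)
Definition prism n j (r : nat) (a : Com F n j.+1) : Com F n.+1 j.+2 :=
  com_cons (inord r.+1) (com_comp (com_of F (degen j.+1 r)) a).

Lemma prism_linear n j r : linear (@prism n j r).
Proof. by move=> c a b; rewrite /prism com_compDr com_compZr linearP. Qed.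
HB.instance Definition _ n j r :=
  GRing.isLinear.Build F (Com F n j.+1) (Com F n.+1 j.+2) *:%R (@prism n j r)
    (@prism_linear n j r).

Definition prisms n j (t : nat) (a : Com F n j.+1) : Com F n.+1 j.+2 :=
  \sum_(t <= r < j.+1) (-1) ^+ r *: prism r a.

Lemma prisms_linear n j t : linear (@prisms n j t).
Proof.
move=> c a b; rewrite /prisms scaler_sumr -big_split; apply: eq_bigr => r _ /=.
by rewrite linearP scalerDr !scalerA mulrC.
Qed.
HB.instance Definition _ n j t :=
  GRing.isLinear.Build F (Com F n j.+1) (Com F n.+1 j.+2) *:%R (@prisms n j t)
    (@prisms_linear n j t).

Definition fc j i : Com F j.+2 j.+1 := com_of F (face j i).

(* Vertex numbers are cyclic: the number following the last one is the base point. *)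
Definition com_consn n m t (a : Com F n m.+1) : Com F n.+1 m.+1 :=
  com_cons (inord (if t == m.+1 then 0 else t)) a.

(** The faces [t] and [t.+1] undo the degeneracy and are the two walls of the prism; every other
    face is a prism over a face of [a]. *)
Lemma bd_prism n j t (a : Com F n j.+2) : (t <= j.+1)%N ->
  com_comp (bd F j.+1) (prism t a) =
  (-1) ^+ t *: (com_consn t.+1 a - com_consn t a)
  - \sum_(i < j.+2) (-1) ^+ i *: (if (i < t)%N then prism t.-1 (com_comp (fc j i) a)
                      else if (i == t :> nat) then 0 else - prism t (com_comp (fc j i) a)).
Proof.
move=> tj; rewrite bdE com_comp_suml.
(* [U] lists the faces of the prism, [V] is indexed by the faces of [a]. Beyond the walls the two
   indices differ by one, whence the change of sign in [V]. *)
pose U i := (if (i < t)%N then prism t.-1 (com_comp (fc j i) a)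
     else if i == t then com_consn t a else if i == t.+1 then com_consn t.+1 a
     else prism t (com_comp (fc j i.-1) a)).
pose V i := (if (i < t)%N then prism t.-1 (com_comp (fc j i) a)
                      else if (i == t :> nat) then 0 else - prism t (com_comp (fc j i) a)).
have key (i : nat) : (0 <= i < j.+3)%N ->
  com_comp ((-1) ^+ i.+1 *: com_of F (face j.+1 i)) (prism t a) =
  (-1) ^+ i.+1 *: U i.
  case/andP=> _ ij; rewrite com_compZl comp_com_cons com_compA com_comp_of /U;
    congr (_ *: _).
  have hd : face j.+1 i (inord t.+1) = cface_val j.+1 i.+1 t.+1 :> nat.
    by rewrite faceE // inordK.
  case: (ltngtP i t) hd => [it|ti|->] hd.
  - rewrite face_degen_lt //.
    rewrite /prism !com_compA !com_comp_of; congr (com_cons _ _).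
    apply/ord_inj; rewrite hd inordK; last by lia.
    by rewrite /cface_val; do ?[case: ifP => ?]; lia.
  - case: (eqVneq i t.+1) hd => [->|it1] hd.
      rewrite face_degen_id ?eqxx ?orbT // -[X in com_comp X]/(com_id _) com_comp1l.
      congr (com_cons _ _); apply/ord_inj; rewrite hd inordK.
        by rewrite /cface_val; do ?[case: ifP => ?]; lia.
      by case: ifP; lia.
    rewrite face_degen_gt //; try by lia.
    rewrite /prism !com_compA !com_comp_of; congr (com_cons _ _).
    apply/ord_inj; rewrite hd inordK; last by lia.
    by rewrite /cface_val; do ?[case: ifP => ?]; lia.
  - rewrite face_degen_id ?eqxx ?orbT // -[X in com_comp X]/(com_id _) com_comp1l.
    congr (com_cons _ _); apply/ord_inj; rewrite hd inordK.
      by rewrite /cface_val; do ?[case: ifP => ?]; lia.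
    by case: ifP; lia.
rewrite -(big_mkord xpredT (fun i =>
  com_comp ((-1) ^+ i.+1 *: com_of F (face j.+1 i)) (prism t a))).
rewrite (eq_big_nat _ _ key) {key} -(big_mkord xpredT (fun i => (-1) ^+ i *: V i)).
rewrite (big_cat_nat (n := t)) //=; last by lia.
rewrite [in RHS](big_cat_nat (n := t)) //=; last by lia.
rewrite [in LHS](big_ltn (m := t)); last by lia.
rewrite (big_ltn (m := t.+1)); last by lia.
rewrite [in RHS](big_ltn (m := t)); last by lia.
have -> : \sum_(0 <= i < t) (-1) ^+ i.+1 *: U i = - \sum_(0 <= i < t) (-1) ^+ i *: V i.
  rewrite -sumrN; apply: eq_big_nat => i /andP[_ it].
  by rewrite /U /V it exprS mulN1r scaleNr.
have -> : \sum_(t.+2 <= i < j.+3) (-1) ^+ i.+1 *: U i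
    = - \sum_(t.+1 <= i < j.+2) (-1) ^+ i *: V i.
  rewrite big_add1 -sumrN; apply: eq_big_nat => i /andP[ti _]; rewrite /U /V.
  do 5 (case: ifP => ?; try by lia).
  by rewrite scalerN opprK !exprS !mulN1r opprK.
have -> : U t = com_consn t a by rewrite /U ltnn eqxx.
have -> : U t.+1 = com_consn t.+1 a.
  by rewrite /U ltnNge leqnSn /= eqxx; case: eqP => //; lia.
have -> : V t = 0 by rewrite /V ltnn eqxx.
rewrite scaler0 add0r opprD [in RHS]addrCA; congr (_ + _).
rewrite addrA; congr (_ + _).
by rewrite !exprS !mulN1r opprK scaleNr scalerBr addrC.
Qed.

(** The walls of consecutive prisms telescope. The last wall has number [j.+2], which is the base
    point again. *)
Lemma bd_prisms n j t (a : Com F n j.+2) : (t <= j.+2)%N ->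
  com_comp (bd F j.+1) (prisms t a) =
  com_consn 0 a - com_consn t a
  + \sum_(i < j.+2) (-1) ^+ i *: prisms (t - (i < t)) (com_comp (fc j i) a).
Proof.
(* Downward induction on [t], starting from the empty sum of prisms at [t = j.+2]. *)
move=> tj; rewrite -(subKn tj); move: (j.+2 - t)%N (leq_subr t j.+2) => {tj}t.
elim: t => [|t IH] tj.
  rewrite subn0 /prisms big_geq // com_comp0r {1}/com_consn /= {1}/com_consn eqxx subrr
    add0r.
  rewrite big1 // => i _; rewrite big_geq ?scaler0 // ltn_ord; lia.
set s := (j.+2 - t.+1)%N; have sE : (j.+2 - t)%N = s.+1 by rewrite /s; lia.
have sj : (s <= j.+1)%N by rewrite /s; lia.
rewrite {1}/prisms big_ltn // -/(prisms s.+1 a) com_compDr com_compZr.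
rewrite bd_prism // -sE IH; last by lia.
rewrite sE scalerBr scalerA -expr2 sqrr_sign scale1r.
rewrite addrACA [X in X + _ = _]addrC [X in X + _ = _]addrA subrK; congr (_ + _).
rewrite scaler_sumr -sumrN -big_split; apply: eq_bigr => i _ /=.
rewrite scalerA mulrC -scalerA -scalerN -scalerDr; congr (_ *: _).
rewrite ltnS; case: (ltngtP i s) => [is_|si|->].
- have e : (-1) ^+ s = - (-1) ^+ s.-1 :> F by rewrite -{1}(ltn_predK is_) exprS mulN1r.
  rewrite !subn1 /= [in RHS]/prisms big_ltn; last by lia.
  by rewrite (ltn_predK is_) e scaleNr opprK.
- rewrite !subn0 [in RHS]/prisms big_ltn; last by have := ltn_ord i; lia.
  by rewrite scalerN opprK.
- by rewrite subn0 subn1 /= scaler0 oppr0 add0r.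
Qed.

(** The first coordinate is pushed along the circle from its position to the base point; a simplex
    already lying over the base point stays fixed. *)
Definition prism_homotopy n j : Com F n.+1 j.+1 -> Com F n.+1 j.+2 :=
  com_lift (fun f => if f ord0 == ord0 then 0 else prisms (f ord0) (com_of F (ftail f))).
Lemma prism_homotopy_linear n j : linear (@prism_homotopy n j).
Proof. exact: com_lift_linear. Qed.
HB.instance Definition _ n j :=
  GRing.isLinear.Build F (Com F n.+1 j.+1) (Com F n.+1 j.+2) *:%R (@prism_homotopy n j)
    (@prism_homotopy_linear n j).

(** The component of the Alexander-Whitney map with the edge of the circle in the first factor: the
    front edge is non-degenerate only for first coordinate 1, and the other coordinates contribute
    their face 0. *)
Definition peel n j : Com F n.+1 j.+2 -> Com F n j.+1 :=
  com_lift (fun f => if f ord0 == 1 :> nat then com_comp (fc j 0) (com_of F (ftail f))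
    else 0).
Lemma peel_linear n j : linear (@peel n j).
Proof. exact: com_lift_linear. Qed.
HB.instance Definition _ n j :=
  GRing.isLinear.Build F (Com F n.+1 j.+2) (Com F n j.+1) *:%R (@peel n j)
    (@peel_linear n j).

Lemma prism_homotopy_fcons n j t (x : {ffun 'I_n -> 'I_j.+1}) :
  prism_homotopy (com_of F (fcons t x)) = if t == ord0 then 0 else prisms t (com_of F x).
Proof. by rewrite [LHS]com_lift_of fcons0 fconsK. Qed.

Lemma peel_fcons n j t (x : {ffun 'I_n -> 'I_j.+2}) :
  peel (com_of F (fcons t x)) = if t == 1 :> nat then com_comp (fc j 0) (com_of F x) else 0.
Proof. by rewrite [LHS]com_lift_of fcons0 fconsK. Qed.

Definition com_tail n m (a : Com F n.+1 m) : Com F n m :=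
  com_comp a (com_of F [ffun s => lift ord0 s]).

Lemma com_tail_linear n m : linear (@com_tail n m).
Proof. by move=> c a b; rewrite /com_tail com_compDl com_compZl. Qed.
HB.instance Definition _ n m :=
  GRing.isLinear.Build F (Com F n.+1 m) (Com F n m) *:%R (@com_tail n m)
    (@com_tail_linear n m).

Lemma com_tail_of n m (f : {ffun 'I_n.+1 ->
  'I_m}) : com_tail (com_of F f) = com_of F (ftail f).
Proof. by rewrite /com_tail com_comp_of; congr com_of; apply/ffunP => s;
  rewrite !ffunE. Qed.

Lemma bd_fcons n j t (x : {ffun 'I_n -> 'I_j.+2}) :
  com_comp (bd F j) (com_of F (fcons t x)) =
  \sum_(i < j.+2) (-1) ^+ i.+1 *: com_of F (fcons (face j i t) [ffun s => face j i (x s)]).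
Proof.
rewrite bdE com_comp_suml; apply: eq_bigr => i _.
by rewrite com_compZl com_comp_of comp_fcons.
Qed.

(** Künneth for one circle factor: up to homotopy a chain is the sum of its projection to the slice
    over the base point and of the product of the circle with its [peel]. *)
Lemma torus_homotopy n j (z : Com F n.+1 j.+2) :
  com_comp (bd F j.+1) (prism_homotopy z) + prism_homotopy (com_comp (bd F j) z)
  = com_cons ord0 (com_tail z) + prisms 0 (peel z) - z.
Proof.
elim/com_ind: z => [|c a b IHa IHb|f].
- by rewrite !linear0 !addr0.
- rewrite [prism_homotopy _]linearP [com_tail _]linearP [com_cons _ _]linearP [peel
  _]linearP.
  rewrite [prisms 0 _]linearP !com_compDr !com_compZr [prism_homotopy _]linearP.
  rewrite addrACA -scalerDr IHa IHb scalerBr scalerDr.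
  by rewrite [X in _ = X - _]addrACA opprD [RHS]addrACA.
rewrite [f]fcons_eta; move: (f ord0) (ftail f) => {f} t x.
rewrite bd_fcons [prism_homotopy (\sum_(_ < _) _)]linear_sum com_tail_of fconsK com_cons_of.
under [X in _ + X = _]eq_bigr =>
  i _ do rewrite linearZ /= prism_homotopy_fcons exprS mulN1r scaleNr.
rewrite sumrN prism_homotopy_fcons peel_fcons.
have fE i : (i < j.+2)%N -> face j i t = cface_val j i.+1 t :> nat by move=> ?;
  rewrite faceE.
have [->|t0] := eqVneq t ord0.
  rewrite com_comp0r add0r /= linear0 addr0 subrr big1 ?oppr0 // => i _.
  rewrite (_ : face j i ord0 == ord0) ?scaler0 //.
  apply/eqP/ord_inj; rewrite faceE // /cface_val /=;
    have := ltn_ord i. do ?[case: ifP => ?]; lia.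
have {}t0 : (0 < t)%N by rewrite lt0n; apply: contraNneq t0 => t0; apply/eqP/ord_inj.
have tj := ltn_ord t.
rewrite bd_prisms; last by lia.
rewrite -addrA [RHS]addrAC /com_consn /= (ltn_eqF tj) inord_val !com_cons_of.
rewrite (_ : inord 0 = ord0); last by apply/ord_inj; rewrite inordK.
congr (_ + _).
rewrite -sumrB.
(* The face sums agree except for face 0 at [t = 1]: it lands on the base point, where the homotopy
   is 0, and so leaves [prisms 0] of the peeled simplex. *)
rewrite big_ord_recl big1 ?addr0 => [|i _].
  rewrite expr0 !scale1r /fc com_comp_of t0 /=; have f0 := fE 0%N isT.
  case: (eqVneq (t : nat) 1%N) => t1.
    rewrite t1 subnn (_ : face j 0 t == ord0) ?subr0 //.
    by apply/eqP/ord_inj; rewrite f0 /cface_val t1.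
  rewrite [prisms 0 0]linear0; have -> : face j 0 t == ord0 = false.
    by apply/eqP => /(congr1 val) /=; rewrite f0 /cface_val; do ?[case: ifP => ?]; lia.
  apply/eqP; rewrite subr_eq0; apply/eqP; congr (prisms _ _).
  by rewrite f0 /cface_val; do ?[case: ifP => ?]; lia.
rewrite -scalerBr lift0 /fc com_comp_of.
have fi := fE i.+1 (ltn_ord i); have ij := ltn_ord i.
(* Among the faces after face 0, only the last one reaches the base point, from the last vertex, and
   there the range of prisms is empty. *)
case: eqP => [/(congr1 val) /= |ft0].
  rewrite fi /cface_val subr0 => e; rewrite /prisms big_geq ?scaler0 //.
  by move: e; do ?[case: ifP => ?]; lia.
apply/eqP; rewrite scaler_eq0 subr_eq0; apply/orP; right; apply/eqP.
congr (prisms _ _).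
move: ft0; rewrite fi.
suff: face j i.+1 t <> 0%N :> nat -> (t - (i.+1 < t) = cface_val j i.+2 t)%N.
  by move=> h h'; apply: h => h0; apply: h'; apply/ord_inj.
by rewrite fi /cface_val; do ?[case: ifP => ?]; lia.
Qed.

Lemma com_tail_comp n m r (b : Com F m r) (a : Com F n.+1 m) :
  com_tail (com_comp b a) = com_comp b (com_tail a).
Proof. by rewrite /com_tail com_compA. Qed.

Lemma bd_com_cons0 n j (a : Com F n j.+2) :
  com_comp (bd F j) (com_cons ord0 a) = com_cons ord0 (com_comp (bd F j) a).
Proof.
rewrite bdE !com_comp_suml linear_sum; apply: eq_bigr => i _.
rewrite !com_compZl comp_com_cons linearZ /=; congr (_ *: com_cons _ _).
apply/ord_inj; rewrite faceE // /cface_val /=; have := ltn_ord i.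
by do ?[case: ifP => ?]; lia.
Qed.

(** Both end walls lie over the base point and cancel, so the product with the whole circle commutes
    with the boundary up to sign. *)
Lemma bd_prisms0 n j (a : Com F n j.+2) :
  com_comp (bd F j.+1) (prisms 0 a) = - prisms 0 (com_comp (bd F j) a).
Proof.
rewrite bd_prisms // subrr add0r bdE com_comp_suml [prisms 0 (\sum_(_ < _)
  _)]linear_sum -sumrN.
apply: eq_bigr => i _.
by rewrite sub0n com_compZl linearZ /= exprS mulN1r scaleNr opprK.
Qed.

(** Faces 0 and 1 both move the first coordinate 2 to 1 and cancel; coordinate 1 is kept by all
    faces but face 0, and no other coordinate is moved to 1. *)
Lemma peel_bd n j (z : Com F n.+1 j.+3) :
  peel (com_comp (bd F j.+1) z) = - com_comp (bd F j) (peel z).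
Proof.
elim/com_ind: z => [|c a b IHa IHb|f].
- by rewrite !(com_comp0r, linear0).
- rewrite com_compDr com_compZr [LHS]linearP /= IHa IHb [peel (_ + _)]linearP /=.
  by rewrite com_compDr com_compZr opprD scalerN.
rewrite [f]fcons_eta; move: (f ord0) (ftail f) => {f} t x.
rewrite bd_fcons linear_sum peel_fcons.
under eq_bigr => i _ do rewrite linearZ /= peel_fcons /fc com_comp_of.
have fE i : (i < j.+3)%N -> face j.+1 i t = cface_val j.+1 i.+1 t :> nat.
  by move=> ?; rewrite faceE.
have f0 i : (0 < i)%N -> (i <= j.+2)%N ->
  [ffun s => face j 0 ([ffun s0 => face j.+1 i (x s0)] s)]
    = [ffun s => face j i.-1 ([ffun s0 => face j.+1 0 (x s0)] s)].
  move=> i0 ij; apply/ffunP => s; rewrite !ffunE.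
  have /ffunP/(_ (x s)) := @cface_comp j i.+1 1 isT i0 ij.
  by rewrite !ffunE prednK.
case: (eqVneq (t : nat) 1%N) => t1.
  rewrite big_ord_recl; under [X in _ + X = _]eq_bigr do rewrite lift0.
  rewrite fE // {1}/cface_val t1 /= scaler0 add0r.
  rewrite bdE com_comp_suml -sumrN; apply: eq_bigr => i _.
  have ij := ltn_ord i.
  rewrite fE // (_ : cface_val _ _ _ = 1%N); last first.
    by rewrite t1 /cface_val; do ?[case: ifP => ?]; lia.
  rewrite eqxx f0 // com_compZl com_comp_of /= com_comp_of.
  by rewrite !exprS !mulN1r opprK scaleNr opprK.
rewrite com_comp0r oppr0.
case: (eqVneq (t : nat) 2%N) => t2.
  rewrite big_ord_recl; under [X in _ + X = _]eq_bigr do rewrite lift0.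
  rewrite big_ord_recl; under [X in _ + (_ + X) = _]eq_bigr do rewrite lift0.
  rewrite big1 ?addr0 => [|i _]; last first.
    have ij := ltn_ord i.
    rewrite fE // (_ : cface_val _ _ _ == 1%N = false) ?scaler0 //.
    by rewrite t2 /cface_val; do ?[case: ifP => ?]; lia.
  rewrite !fE // t2 /cface_val /=.
  by rewrite (f0 1%N) // expr1 expr2 mulN1r opprK scaleN1r scale1r addNr.
apply: big1 => i _; have ij := ltn_ord i; have tj := ltn_ord t.
rewrite fE // (_ : cface_val _ _ _ == 1%N = false) ?scaler0 //.
by move: t1 t2; rewrite /cface_val; do ?[case: ifP => ?]; lia.
Qed.

Definition no_fun m : {ffun 'I_0 -> 'I_m.+1} := [ffun=> ord0].

Lemma no_funE m (f : {ffun 'I_0 -> 'I_m.+1}) : f = no_fun m.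
Proof. by apply/ffunP => -[]. Qed.

Lemma com_no_fun m (a : Com F 0 m.+1) : a = a (no_fun m) *: com_of F (no_fun m).
Proof.
apply/ffunP => f; rewrite (no_funE f) !ffunE eqxx.
by rewrite [_ *: _]mulr1.
Qed.

Lemma sum_sign n : \sum_(i < n) (-1) ^+ i = (odd n)%:R :> F.
Proof.
elim: n => [|n IH]; first by rewrite big_ord0.
rewrite big_ord_recr /= IH -signr_odd.
by case: (odd n); rewrite ?expr1 ?expr0 ?subrr ?add0r.
Qed.

Lemma bd_no_fun j :
  com_comp (bd F j) (com_of F (no_fun j.+1)) = - ((odd j)%:R *: com_of F (no_fun j)).
Proof.
rewrite bdE com_comp_suml.
under eq_bigr => i _ do rewrite com_compZl com_comp_of (no_funE [ffun _ => _]) exprS mulN1r.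
rewrite -scaler_suml -scaleNr; congr (_ *: _).
by rewrite sumrN sum_sign /= negbK.
Qed.

(* The cohomology class of the torus dual to the coordinate subtorus on U: its
   value on f is 1 if f maps U increasingly onto the nonzero elements, else 0. *)
Fixpoint phi n : (nat -> bool) -> forall j, Com F n j.+1 -> F :=
  match n with
  | 0 => fun U j z => if j == 0%N then z (no_fun j) else 0
  | n'.+1 => fun U j => if U 0%N then
       match j return Com F n'.+1 j.+1 -> F with
       | 0 => fun _ => 0
       | j'.+1 => fun z => phi (fun i => U i.+1) (peel z)
       end
     else fun z => phi (fun i => U i.+1) (com_tail z)
  end.

Lemma phi_linear n U j c (a b : Com F n j.+1) :
  phi U (c *: a + b) = c * phi U a + phi U b.
Proof.
elim: n U j a b => [|n IH] U j a b /=.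
  by case: ifP => _; rewrite ?mulr0 ?addr0 // !ffunE.
case: (U 0%N); last by rewrite linearP IH.
case: j a b => [|j] a b; first by rewrite mulr0 addr0.
by rewrite linearP IH.
Qed.

Lemma phi0 n U j : phi U (0 : Com F n j.+1) = 0.
Proof. by have := phi_linear U (-1) (0 : Com F n j.+1) 0;
  rewrite scaler0 addr0 mulN1r addNr. Qed.
Lemma phiZ n U j c (a : Com F n j.+1) : phi U (c *: a) = c * phi U a.
Proof. by rewrite -[c *: a]addr0 phi_linear phi0 addr0. Qed.
Lemma phiD n U j (a b : Com F n j.+1) : phi U (a + b) = phi U a + phi U b.
Proof. by rewrite -[a]scale1r phi_linear mul1r scale1r. Qed.
Lemma phiN n U j (a : Com F n j.+1) : phi U (- a) = - phi U a.
Proof. by rewrite -scaleN1r phiZ mulN1r. Qed.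
Lemma phiB n U j (a b : Com F n j.+1) : phi U (a - b) = phi U a - phi U b.
Proof. by rewrite phiD phiN. Qed.

Lemma phi_ext n (U U' : nat -> bool) j (z : Com F n j.+1) :
  (forall i, (i < n)%N -> U i = U' i) -> phi U z = phi U' z.
Proof.
elim: n U U' j z => [|n IH] U U' j z UU' //=.
rewrite -UU' //; case: (U 0%N); last by apply: IH => i ni; apply: UU'.
by case: j z => // j z; apply: IH => i ni; apply: UU'.
Qed.

(** The functional is a cocycle: factors are removed by [com_tail] or [peel], which commute with the
    boundary up to sign, and the boundary from degree 1 to degree 0 of a point is zero. *)
Lemma phi_bd n U j (y : Com F n j.+2) : phi U (com_comp (bd F j) y) = 0.
Proof.
elim: n U j y => [|n IH] U j y /=.
  case: eqP => // j0; move: y; rewrite j0 => y.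
  by rewrite [y]com_no_fun com_compZr bd_no_fun scale0r oppr0 scaler0 ffunE.
case: (U 0%N); last by rewrite com_tail_comp IH.
by case: j y => // j y; rewrite peel_bd phiN IH oppr0.
Qed.

Lemma phi_card n (U : nat -> bool) j (z : Com F n j.+1) :
  j != (\sum_(i < n) U i)%N -> phi U z = 0.
Proof.
elim: n U j z => [|n IH] U j z; first by rewrite big_ord0 /= => /negPf ->.
rewrite big_ord_recl /=; case: (U 0%N); last by rewrite add0n => /(IH (fun i => U i.+1)).
by case: j z => // j z; rewrite add1n eqSS => /(IH (fun i => U i.+1)).
Qed.

Definition column_cycle n j : Com F n j.+1 -> Prop :=
  match j with
  | 0 => fun _ => True
  | j'.+1 => fun z => com_comp (bd F j') z = 0
  end.

Definition column_bdry n j (z : Com F n j.+1) := exists y, z = com_comp (bd F j) y.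

Lemma column_cycleP n j c (a b : Com F n j.+1) : column_cycle a -> column_cycle b ->
  column_cycle (c *: a + b).
Proof.
case: j a b => //= j a b ea eb.
by rewrite com_compDr com_compZr ea eb scaler0 addr0.
Qed.

Lemma column_cycle_pre m n j (z : Com F n j.+1) (a : Com F m n) : column_cycle z ->
  column_cycle (com_comp z a).
Proof. by case: j z => //= j z e; rewrite com_compA e com_comp0l. Qed.

Lemma column_cycle_bdry n j (z : Com F n j.+1) : column_bdry z -> column_cycle z.
Proof.
case: j z => //= j z [y ->].
by rewrite com_compA bd_bd com_comp0l.
Qed.

Lemma column_bdryP n j c (a b : Com F n j.+1) : column_bdry a -> column_bdry b ->
  column_bdry (c *: a + b).
Proof.
move=> [a' ->] [b' ->]; exists (c *: a' + b').
by rewrite com_compDr com_compZr.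
Qed.

Lemma column_bdry0 n j : column_bdry (0 : Com F n j.+1).
Proof. by exists 0; rewrite com_comp0r. Qed.
Lemma column_bdryZ n j c (a : Com F n j.+1) : column_bdry a -> column_bdry (c *: a).
Proof. by move=> ba; rewrite -[_ *: _]addr0; apply: column_bdryP => //;
  apply: column_bdry0. Qed.
Lemma column_bdryD n j (a b : Com F n j.+1) : column_bdry a -> column_bdry b ->
  column_bdry (a + b).
Proof. by rewrite -{2}[a]scale1r; apply: column_bdryP. Qed.
Lemma column_bdryN n j (a : Com F n j.+1) : column_bdry a -> column_bdry (- a).
Proof. by rewrite -scaleN1r; apply: column_bdryZ. Qed.
Lemma column_bdryB n j (a b : Com F n j.+1) : column_bdry a -> column_bdry b ->
  column_bdry (a - b).
Proof. by move=> ha hb; apply/column_bdryD/column_bdryN. Qed.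
Lemma column_bdry_sum n j I (s : seq I) (P : pred I) (a : I -> Com F n j.+1) :
  (forall i, P i -> column_bdry (a i)) -> column_bdry (\sum_(i <- s | P i) a i).
Proof. by move=> h; elim/big_ind: _ => //; [apply: column_bdry0 | apply: column_bdryD]. Qed.

Lemma column_bdry_pre m n j (z : Com F n j.+1) (a : Com F m n) : column_bdry z ->
  column_bdry (com_comp z a).
Proof. by case=> y ->; exists (com_comp y a); rewrite com_compA. Qed.

(* torus_homotopy splits off one circle factor at a time. *)
Lemma torus_homology n j (z : Com F n j.+1) :
  column_cycle z -> (forall U, phi U z = 0) -> column_bdry z.
Proof.
elim: n j z => [|n IH] j z cz pz.
  have [c0|c0] := eqVneq (z (no_fun j)) 0.
    by rewrite [z]com_no_fun c0 scale0r; apply: column_bdry0.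
  have j0 : j != 0%N.
    by apply: contraNneq c0 => j0; have /= := pz xpredT; rewrite {1}j0 eqxx => ->.
  (* The unnormalized complex of a point: in odd degree everything is a boundary, in positive even
     degree only 0 is a cycle. *)
  have [oj|oj] := boolP (odd j).
    exists (- z (no_fun j) *: com_of F (no_fun j.+1)).
    by rewrite com_compZr bd_no_fun oj scale1r scalerN scaleNr opprK -com_no_fun.
  case: j z cz {pz} c0 j0 oj => // j z /= cz c0 _; rewrite negbK => oj.
  move: cz; rewrite [z]com_no_fun com_compZr bd_no_fun oj scale1r scalerN => /eqP.
  rewrite oppr_eq0 scaler_eq0 (negPf c0) /= => /eqP/ffunP/(_ (no_fun j))/eqP.
  by rewrite !ffunE eqxx oner_eq0.
(* Masks with first entry [false] or [true] turn the hypothesis on [z] into the one for [com_tail z]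
   or [peel z]. *)
pose cons b (U : nat -> bool) i := if i is i'.+1 then U i' else b.
have [y ey] : column_bdry (com_tail z).
  apply: IH => [|U]; first exact: column_cycle_pre.
  exact: pz (cons false U).
(* In degree 0 the base point is the only simplex of the circle, so [z] lies over it entirely. *)
case: j z cz pz y ey => [|j] z cz pz y ey.
  exists (com_cons ord0 y); rewrite bd_com_cons0 -ey.
  elim/com_ind: z {cz pz ey} => [|c a b ha hb|f]; first by rewrite !linear0.
    by rewrite [com_tail (_ + _)]linearP [com_cons _ _]linearP /= -ha -hb.
  rewrite com_tail_of com_cons_of; congr com_of; rewrite [LHS]fcons_eta; congr fcons.
  by apply: ord_inj; case: (f ord0) => -[].
have [y' ey'] : column_bdry (peel z).
  apply: IH => [|U]; last exact: pz (cons true U).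
  case: j z cz pz y ey => //= j z cz _ _ _.
  by apply/eqP; rewrite -oppr_eq0 -peel_bd cz linear0.
exists (com_cons ord0 y - prisms 0 y' - prism_homotopy z).
have := torus_homotopy z; rewrite cz linear0 addr0 ey ey' => e.
by rewrite !com_compBr bd_com_cons0 bd_prisms0 opprK e opprB addrC subrK.
Qed.

Lemma degenS0 n t : degen n.+1 t ord0 = ord0.
Proof. by apply/ord_inj; rewrite degenE. Qed.

Lemma degenSS n t (s : 'I_n) : degen n.+1 t.+1 (lift ord0 s) = lift ord0 (degen n t s).
Proof. by apply/ord_inj; rewrite lift0 !degenE /bump lift0 ltnS addnS. Qed.

Lemma degen0S n (s : 'I_n) : degen n.+1 0 (lift ord0 s) = lift ord0 (lift ord0 s).
Proof. by apply/ord_inj; rewrite degenE !lift0 /bump. Qed.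

Lemma peel_pre n j (z : Com F n.+2 j.+2) t :
  peel (com_comp z (com_of F (degen n.+1 t.+1))) = com_comp (peel z) (com_of F (degen n t)).
Proof.
elim/com_ind: z => [|c a b ha hb|f].
- by rewrite com_comp0l !linear0 com_comp0l.
- by rewrite com_compDl com_compZl [peel (_ + _)]linearP [peel (_ + _)]linearP /= ha hb
  com_compDl com_compZl.
rewrite com_comp_of [f]fcons_eta; move: (f ord0) (ftail f) => {f} h x.
have -> : [ffun s => fcons h x (degen n.+1 t.+1 s)] = fcons h [ffun s => x (degen n t s)].
  apply/ffunP => s; rewrite [LHS]ffunE; case: (unliftP ord0 s) => [s'|] ->.
    by rewrite degenSS !fconsS [RHS]ffunE.
  by rewrite degenS0 !fcons0.
rewrite !peel_fcons; case: ifP => _; last by rewrite com_comp0l.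
by rewrite -com_compA com_comp_of.
Qed.

Lemma peel_pre0 n j (z : Com F n.+2 j.+2) :
  peel (com_comp z (com_of F (degen n.+1 0))) = com_tail (peel z).
Proof.
elim/com_ind: z => [|c a b ha hb|f].
- by rewrite com_comp0l !linear0.
- by rewrite com_compDl com_compZl [peel (_ + _)]linearP [peel (_ + _)]linearP
     [com_tail (_ + _)]linearP /= ha hb.
rewrite com_comp_of [f]fcons_eta; move: (f ord0) (ftail f) => {f} h x.
have -> : [ffun s => fcons h x (degen n.+1 0 s)] = fcons h (ftail x).
  apply/ffunP => s; rewrite [LHS]ffunE; case: (unliftP ord0 s) => [s'|] ->.
    by rewrite degen0S !fconsS ffunE.
  by rewrite degenS0 !fcons0.
rewrite !peel_fcons; case: ifP => _; last by rewrite linear0.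
by rewrite com_tail_comp com_tail_of.
Qed.

Lemma com_tail_pre n m (z : Com F n.+2 m) t :
  com_tail (com_comp z (com_of F (degen n.+1 t.+1))) =
    com_comp (com_tail z) (com_of F (degen n t)).
Proof.
rewrite /com_tail -!com_compA !com_comp_of; congr (com_comp _ (com_of _ _)).
by apply/ffunP => s; rewrite [LHS]ffunE [X in degen _ _ X]ffunE degenSS ![RHS]ffunE.
Qed.

Lemma com_tail_pre0 n m (z : Com F n.+2 m) :
  com_tail (com_comp z (com_of F (degen n.+1 0))) = com_tail (com_tail z).
Proof.
rewrite /com_tail -!com_compA !com_comp_of; congr (com_comp _ (com_of _ _)).
apply/ffunP => s; rewrite [LHS]ffunE [X in degen _ _ X]ffunE degen0S [RHS]ffunE.
by rewrite !ffunE.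
Qed.

Lemma phi_tail n (U : nat -> bool) j (z : Com F n.+1 j.+1) : U 0%N = false ->
  phi U z = phi (fun i => U i.+1) (com_tail z).
Proof. by move=> /= ->. Qed.

Lemma phi_peel n (U : nat -> bool) j (z : Com F n.+1 j.+2) : U 0%N ->
  phi U z = phi (fun i => U i.+1) (peel z).
Proof. by move=> /= ->. Qed.

Lemma phi_peel0 n (U : nat -> bool) (z : Com F n.+1 1) : U 0%N -> phi U z = 0.
Proof. by move=> /= ->. Qed.

(** A coordinate outside [U] is forgotten by [phi U], and precomposition with [degen n t] forgets
    the coordinate [t.+1]. *)
Lemma phi_degen n t (U : nat -> bool) j (z : Com F n.+1 j.+1) : (t < n)%N ->
  U t.+1 = false ->
  phi U z = phi (fun i => U (bump t.+1 i)) (com_comp z (com_of F (degen n t))).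
Proof.
elim: n t U j z => // n IH t U j z tn Ut.
case U0 : (U 0%N).
  case: j z => [|j] z; first by rewrite !phi_peel0.
  rewrite phi_peel // [RHS]phi_peel //.
  case: t tn Ut => [|t] tn Ut; first by rewrite peel_pre0 phi_tail.
  by rewrite peel_pre (IH t) //; apply: phi_ext => i _; rewrite /bump addnS.
rewrite phi_tail // [RHS]phi_tail //.
case: t tn Ut => [|t] tn Ut; first by rewrite com_tail_pre0 phi_tail.
by rewrite com_tail_pre (IH t) //; apply: phi_ext => i _; rewrite /bump addnS.
Qed.

(** * Normalization in the cosimplicial direction *)

Definition face_degen k q j (a : Com F k.+2 j.+1) i : Com F k.+2 j.+1 :=
  (-1) ^+ i.+1 *: com_comp (com_comp a (com_of F (face k.+1 i))) (com_of F (degen k.+2 q)).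

Lemma comp_bdE k j (a : Com F k.+1 j.+1) :
  com_comp a (bd F k) =
  \sum_(0 <= i < k.+2) (-1) ^+ i.+1 *: com_comp a (com_of F (face k i)).
Proof.
rewrite bdE big_mkord com_comp_sumr; apply: eq_bigr => i _.
by rewrite com_compZr.
Qed.

(** The terms [face_degen q a i] make up codegeneracy [q] of the coboundary of [a]. For [i < q] such
    a term factors through codegeneracy [q.-1] of [a], a boundary by hypothesis. *)
Lemma face_degen_low k q j (a : Com F k.+2 j.+1) M : (q <= k.+1)%N -> (M <= q)%N ->
  ((0 < q)%N -> column_bdry (com_comp a (com_of F (degen k.+1 q.-1)))) ->
  column_bdry (\sum_(0 <= i < M) face_degen q a i).
Proof.
move=> qk Mq bq; rewrite big_seq; apply: column_bdry_sum => i.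
rewrite mem_index_iota => /andP[_ iM]; have iq := leq_trans iM Mq; apply: column_bdryZ.
rewrite -com_compA com_comp_of face_degen_lt // -(com_comp_of F (degen _ _) (face _ _))
  com_compA.
by apply/column_bdry_pre/bq; apply: leq_trans iq.
Qed.

Lemma face_degen_mid k q j (a : Com F k.+2 j.+1) i : (q <= k.+1)%N ->
  (i == q) || (i == q.+1) -> face_degen q a i = (-1) ^+ i.+1 *: a.
Proof.
move=> qk iq; rewrite /face_degen -com_compA com_comp_of face_degen_id //.
by rewrite -[com_of _ _]/(com_id _) com_comp1r.
Qed.

Lemma face_degen_high k q j (a : Com F k.+2 j.+1) i : (q.+1 < i)%N -> (i <= k.+2)%N ->
  face_degen q a i = (-1) ^+ i.+1 *:
    com_comp (com_comp a (com_of F (degen k.+1 q))) (com_of F (face k i.-1)).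
Proof.
move=> qi ik; rewrite /face_degen -com_compA com_comp_of face_degen_gt //.
by rewrite -(com_comp_of F (degen _ _) (face _ _)) com_compA.
Qed.

Lemma face_degen_sum k q j (a : Com F k.+2 j.+1) M : (q <= k.+1)%N -> (q.+2 <= M)%N ->
  \sum_(0 <= i < M) face_degen q a i =
  \sum_(0 <= i < q) face_degen q a i + \sum_(q.+2 <= i < M) face_degen q a i.
Proof.
move=> qk qM; rewrite (@big_cat_nat _ _ _ q.+2) //= !big_nat_recr //=.
rewrite !face_degen_mid ?eqxx ?orbT //.
by rewrite -[_ + _ + _ *: a]addrA [_ ^+ q.+2]exprS mulN1r scaleNr subrr addr0.
Qed.

(** For [i < p] the terms [i] and [i.+1] cancel and the others factor through codegeneracies of [w]
    below [p]; for [i = p] the term [p] is left over, a multiple of [w]. *)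
Lemma low_faces k j (w : Com F k.+1 j.+1) p i : (p <= k)%N -> (i <= p)%N ->
  (forall i, (i < p)%N -> column_bdry (com_comp w (com_of F (degen k i)))) ->
  column_bdry (com_comp (\sum_(0 <= r < p.+1) (-1) ^+ r.+1 *: com_comp w (com_of F
    (face k r)))
      (com_of F (degen k.+1 i)) - ((i == p)%:R * (-1) ^+ p.+1) *: w).
Proof.
case: k w => [|k] w pk ip bw.
  have {pk}p0 : p = 0%N by lia. have {ip}i0 : i = 0%N by lia.
  rewrite p0 i0 big_nat1 eqxx mul1r com_compZl -com_compA com_comp_of face_degen_id //.
  by rewrite -[com_of _ _]/(com_id _) com_comp1r subrr; apply: column_bdry0.
rewrite com_comp_suml (eq_bigr (face_degen i w)); last by move=> r _; rewrite com_compZl.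
have low : column_bdry (\sum_(0 <= r < i) face_degen i w r).
  apply: face_degen_low => // [|i0]; first exact: leq_trans ip pk.
  by apply: bw; rewrite prednK.
have [ip'|pi|pi] := ltngtP i p; last 1 first.
- rewrite mul1r -pi big_nat_recr //= face_degen_mid ?eqxx //; last by rewrite pi.
  by rewrite addrK.
- rewrite mul0r scale0r subr0 face_degen_sum //; last exact: leq_trans ip pk.
  apply: column_bdryD => //; rewrite big_seq; apply: column_bdry_sum => r.
  rewrite mem_index_iota => /andP[ir rp]; rewrite face_degen_high //; last by lia.
  by apply/column_bdryZ/column_bdry_pre/bw.
- by lia.
Qed.

(** Modulo boundaries, codegeneracy [p] of the coboundary of [w] is [(-1) ^+ p.+1 *: w], so the
    subtraction kills codegeneracy [p] of [z]; the lower ones, already killed, stay so. *)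
Lemma normalize_step k j (z : Com F k.+2 j.+1) p : (p <= k)%N ->
  column_bdry (com_comp z (bd F k.+1)) ->
  (forall i, (i < p)%N -> column_bdry (com_comp z (com_of F (degen k.+1 i)))) ->
  let w := com_comp z (com_of F (degen k.+1 p)) in
  forall i, (i <= p)%N ->
    column_bdry (com_comp (z - (-1) ^+ p.+1 *: com_comp w (bd F k)) (com_of F (degen
      k.+1 i))).
Proof.
move=> pk bz bp w.
have bp1 : (0 < p)%N -> column_bdry (com_comp z (com_of F (degen k.+1 p.-1))).
  by move=> p0; apply: bp; rewrite prednK.
(* Codegeneracy [p] of the coboundary of [z] is a boundary; up to its low terms, which are
   boundaries as well, it is minus this sum. *)
have w_high : column_bdry (\sum_(p.+1 <= i < k.+2) (-1) ^+ i.+1 *: com_comp w (com_of F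
  (face k i))).
  have := column_bdry_pre (com_of F (degen k.+2 p)) bz.
  rewrite comp_bdE com_comp_suml (eq_bigr (face_degen p z)); last first.
    by move=> i _; rewrite com_compZl.
  rewrite face_degen_sum; [|lia|lia].
  have b1 := face_degen_low (leqW pk) (leqnn _) bp1.
  move=> /column_bdryB/(_ b1); rewrite addrC addKr big_add1 /= => /column_bdryN;
    rewrite -sumrN.
  congr column_bdry; apply: eq_big_nat => i /andP[ip ik].
  by rewrite face_degen_high //= [_ ^+ i.+2]exprS mulN1r scaleNr opprK.
have w_degen i : (i < p)%N -> column_bdry (com_comp w (com_of F (degen k i))).
  move=> ip; rewrite -com_compA com_comp_of -degen_degen //.
  rewrite -(com_comp_of F (degen _ _) (degen _ _)) com_compA.
  exact/column_bdry_pre/bp.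
move=> i ip; have bl := low_faces pk ip w_degen.
have bh := column_bdry_pre (com_of F (degen k.+1 i)) w_high.
have -> : com_comp (z - (-1) ^+ p.+1 *: com_comp w (bd F k)) (com_of F (degen k.+1 i)) =
   (com_comp z (com_of F (degen k.+1 i)) - (i == p)%:R *: w) - (-1) ^+ p.+1 *:
   ((com_comp (\sum_(0 <= r < p.+1) (-1) ^+ r.+1 *: com_comp w (com_of F (face k r)))
      (com_of F (degen k.+1 i)) - ((i == p)%:R * (-1) ^+ p.+1) *: w)
    + com_comp (\sum_(p.+1 <= r < k.+2) (-1) ^+ r.+1 *: com_comp w (com_of F (face k r)))
      (com_of F (degen k.+1 i))).
  rewrite com_compBl com_compZl comp_bdE (@big_cat_nat _ _ _ p.+1 0 k.+2) //=; last by lia.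
  rewrite com_compDl; set A := com_comp (bigop _ _ _) _; set B := com_comp (bigop _ _ _) _.
  rewrite [A - _ + B]addrAC scalerBr scalerA mulrCA -expr2 sqrr_sign mulr1.
  by rewrite opprB addrA subrK.
apply: column_bdryB; last by apply/column_bdryZ/column_bdryD.
move: ip; rewrite leq_eqVlt; case: eqP => [->|_] /= ip.
  by rewrite scale1r subrr; apply: column_bdry0.
by rewrite scale0r subr0; apply: bp.
Qed.

(* Dold-Kan normalization in the cosimplicial direction, modulo boundaries of
   the columns: the codegeneracies are killed one after the other. *)
Lemma normalize k j (z : Com F k.+2 j.+1) : column_cycle z ->
  column_bdry (com_comp z (bd F k.+1)) ->
  exists2 y : Com F k.+1 j.+1, column_cycle y & forall i, (i <= k)%N ->
    column_bdry (com_comp (z - com_comp y (bd F k)) (com_of F (degen k.+1 i))).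
Proof.
move=> cz bz.
suff H p : (p <= k.+1)%N -> exists2 y :
  Com F k.+1 j.+1, column_cycle y & forall i, (i < p)%N ->
    column_bdry (com_comp (z - com_comp y (bd F k)) (com_of F (degen k.+1 i))).
  by have [y cy yP] := H k.+1 (leqnn _); exists y.
elim: p => [|p IH] pk.
  by exists 0 => //; have := column_cycleP (-1) cz cz; case: j z cz bz => //= *;
    rewrite com_comp0r.
have [y cy yP] := IH (ltnW pk); set z' := z - com_comp y (bd F k) in yP.
have bz' : column_bdry (com_comp z' (bd F k.+1)).
  by rewrite com_compBl -com_compA bd_bd com_comp0r subr0.
exists ((-1) ^+ p.+1 *: com_comp z' (com_of F (degen k.+1 p)) + y).
  apply: column_cycleP => //; apply: column_cycle_pre; rewrite /z' addrC -scaleN1r.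
  by apply: column_cycleP => //; apply: column_cycle_pre.
move=> i ip; set w := com_comp z' (com_of F (degen k.+1 p)).
have -> : z - com_comp ((-1) ^+ p.+1 *: w + y) (bd F k)
    = z' - (-1) ^+ p.+1 *: com_comp w (bd F k).
  by rewrite com_compDl com_compZl opprD addrCA addrC.
exact: normalize_step.
Qed.

End Torus.

(** * Connes' boundary operator *)

Arguments phi : simpl never.

Ltac split_ifs :=
  repeat match goal with |- context [if ?b then _ else _] =>
    lazymatch b with
    | context [if _ then _ else _] => fail
    | _ => let H := fresh in case H : b
    end end.

Section Connes.
Variable F : fieldType.

Definition rot_val (l i t : nat) : nat :=
  if (t + i.+1 <= l)%N then (t + i.+1)%N else (t + i.+1 - l)%N.

Lemma connes_gE l i (t : 'I_l) : (i <= l)%N -> connes_g l i t = rot_val l i t :> nat.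
Proof.
move=> il; rewrite ffunE inordK // /rot_val; have := ltn_ord t.
by case: ifP => ?; lia.
Qed.

(** The rotation numbered [l.+1] is the one numbered 0, with sign 1 because [l.+1 * l.+2] is
    even. *)
Lemma connesE l :
  connes F l.+1 = \sum_(0 <= a < l.+1) (-1) ^+ (a * l.+2) *: com_of F (connes_g l.+1 a).
Proof.
rewrite /connes big_nat_recr //= [in RHS]big_nat_recl //= big_add1 addrC; congr (_ + _).
rewrite mul0n -signr_odd oddM /= andbN; congr (_ *: com_of _ _).
apply/ffunP => t; apply/ord_inj; rewrite !connes_gE // /rot_val; have := ltn_ord t.
by split_ifs; lia.
Qed.

Lemma face_connes_first l a t : (a <= l.+2)%N ->
  face l.+1 0 (connes_g l.+2 a t) = (rot_val l.+2 a t).-1 :> nat.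
Proof.
move=> al; rewrite faceE // connes_gE // /cface_val.
have : (0 < rot_val l.+2 a t)%N by rewrite /rot_val; case: ifP => ?; lia.
by split_ifs; lia.
Qed.

Lemma bd_connes l : com_comp (bd F l.+1) (connes F l.+2) =
  - com_comp (connes F l.+1) (bd F l).
Proof.
rewrite !connesE com_comp_sumr.
pose f a : Com F l.+2 l.+2 := com_of F [ffun t => face l.+1 0 (connes_g l.+2 a t)].
pose s a : F := (-1) ^+ (a * l.+3).
pose G a i : Com F l.+2 l.+2 :=
  s a *: ((-1) ^+ i *: com_of F [ffun t => face l.+1 i.+1 (connes_g l.+2 a t)]).
(* The last face of rotation [a] is face 0 of rotation [a.+1], with a sign that makes the outer
   faces telescope over [a]. The rotations 0 and [l.+2] agree, so these faces cancel altogether. *)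
have ends a : (a < l.+2)%N -> com_comp (bd F l.+1) (s a *: com_of F (connes_g l.+2 a))
    = (s a.+1 *: f a.+1 - s a *: f a) + \sum_(i < l.+1) G a i.
  move=> al; rewrite bdE com_comp_suml big_ord_recl big_ord_recr /=.
  rewrite !com_compZl !com_compZr !com_comp_of.
  rewrite [X in _ + X]addrC addrA; congr (_ + _).
    rewrite expr1 scaleN1r addrC; congr (_ - _).
    rewrite scalerA /s -exprD.
    have -> : (-1) ^+ (l.+3 + a * l.+3) = (-1) ^+ (a.+1 * l.+3) :> F by rewrite mulSn.
    congr (_ *: com_of _ _); apply/ffunP => t; apply/ord_inj;
      rewrite /bump /= [in LHS]ffunE [in RHS]ffunE.
    have := ltn_ord t; rewrite face_connes_first // faceE // connes_gE; last exact: ltnW.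
    by rewrite /cface_val /rot_val; split_ifs; lia.
  apply: eq_bigr => i _; rewrite com_compZl com_compZr com_comp_of /G scalerA scalerA mulrC.
  by rewrite /bump /= exprS exprS !mulN1r opprK.
under eq_big_nat => a /andP[_ al] do rewrite ends //.
rewrite big_split /= telescope_sumr // {ends}.
have -> : s l.+2 *: f l.+2 = s 0 *: f 0.
  rewrite /s mul0n -signr_odd oddM /= !negbK andbN; congr (_ *: com_of _ _).
  apply/ffunP => t; apply/ord_inj; rewrite [in LHS]ffunE [in RHS]ffunE.
  rewrite !face_connes_first // /rot_val; have := ltn_ord t.
  by split_ifs; lia.
rewrite subrr add0r com_comp_suml -sumrN !big_mkord.
under [RHS]eq_bigr => a _ do
  rewrite com_compZl bdE com_comp_sumr scaler_sumr -sumrN.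
rewrite !pair_big /=.
(* Merging at [i] and then rotating by [a] equals rotating first and merging at the image; past the
   wrap-around the rotation that comes first is by [a.+1]. *)
pose h (p : 'I_l.+1 * 'I_l.+2) : 'I_l.+2 * 'I_l.+1 :=
  if (p.1 + p.2 <= l)%N then (inord p.1, inord (p.1 + p.2))
  else (inord p.1.+1, inord (p.1 + p.2 - l.+1)).
pose h' (p : 'I_l.+2 * 'I_l.+1) : 'I_l.+1 * 'I_l.+2 :=
  if (p.1 <= p.2)%N then (inord p.1, inord (p.2 - p.1))
  else (inord p.1.-1, inord (l.+2 + p.2 - p.1)).
have bh : bijective h.
  have eqI n (x : 'I_n.+1) y : y = x :> nat -> inord y = x.
    by move=> ->; rewrite inord_val.
  exists h' => -[a i]; have := ltn_ord a; have := ltn_ord i; rewrite /h /h' /= => ib ab.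
    case: (leqP (a + i) l) => ai /=.
      by rewrite !inordK ?leq_addr; try lia; congr (_, _); apply: eqI; lia.
    rewrite !inordK; try lia.
    case: (leqP a.+1 (a + i - l.+1)) => ?; first lia.
    by congr (_, _); apply: eqI; lia.
  case: (leqP a i) => ai /=; rewrite !inordK; try lia.
    case: (leqP (a + (i - a)) l) => ?; last lia.
    by congr (_, _); apply: eqI; lia.
  case: (leqP (a.-1 + (l.+2 + i - a)) l) => ?; first lia.
  by congr (_, _); apply: eqI; lia.
rewrite (reindex h) /=; last exact: onW_bij.
apply: eq_bigr => -[a i] _; have := ltn_ord a; have := ltn_ord i; rewrite /h /= => ib ab.
rewrite /G com_compZr com_comp_of !scalerA -scaleNr.
case: (leqP (a + i) l) => ai /=; rewrite !inordK; try lia.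
  congr (_ *: com_of _ _).
    rewrite exprS mulN1r mulrN opprK /s -!exprD -signr_odd -[RHS]signr_odd;
      congr (_ ^+ nat_of_bool _).
    by rewrite !(oddD, oddM) /= !negbK; case: (odd a); case: (odd l); case: (odd i).
  apply/ffunP => t; apply/ord_inj; rewrite [in LHS]ffunE [in RHS]ffunE.
  have := ltn_ord t; rewrite faceE; last lia.
  rewrite !connes_gE; try lia.
  rewrite faceE // /cface_val /rot_val; split_ifs; lia.
congr (_ *: com_of _ _).
  rewrite exprS mulN1r mulrN opprK /s -!exprD -signr_odd -[RHS]signr_odd;
    congr (_ ^+ nat_of_bool _).
  rewrite !(oddD, oddM) /= oddB; last lia.
  by rewrite !oddD /= ?negbK; case: (odd a); case: (odd l); case: (odd i).
apply/ffunP => t; apply/ord_inj; rewrite [in LHS]ffunE [in RHS]ffunE.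
have := ltn_ord t; rewrite faceE; last lia.
rewrite !connes_gE; try lia.
rewrite faceE // /cface_val /rot_val; split_ifs; lia.
Qed.

Lemma bd_connes0 : com_comp (bd F 0) (connes F 1) = 0.
Proof.
rewrite connesE big_nat1 com_compZr bdE com_comp_suml !big_ord_recl big_ord0.
rewrite !com_compZl !com_comp_of addr0 expr1 expr2 mulN1r opprK scaleN1r scale1r.
set f := [ffun _ => _]; set g := [ffun _ => _].
have -> : f = g by apply/ffunP => t; apply: ord_inj; case: (f t) => -[] //;
  case: (g t) => -[].
by rewrite !scale1r addNr ?scaler0.
Qed.
End Connes.

(** * Shuffle operations *)

Section Descents.

Definition desn n (f : nat -> nat) : nat := (\sum_(0 <= v < n) (f v.+1 < f v))%N.

Definition perm_val n (s : 'S_n.+1) (v : nat) : nat := s (inord v).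

Lemma descentsE n (s : 'S_n.+1) : descents s = desn n (perm_val s).
Proof.
rewrite /descents -sum1dep_card big_mkcond /=.
rewrite -(pair_bigA _ (fun i j : 'I_n.+1 =>
  if (j == i.+1 :> nat) && (s j < s i)%N then 1%N else 0%N)) /=.
rewrite /desn big_mkord big_ord_recr /= [X in (_ + X)%N]big1 ?addn0 => [|j _]; last first.
  by rewrite ltn_eqF.
apply: eq_bigr => i _; rewrite (bigD1 (inord i.+1)) //= [X in (_ + X)%N]big1 ?addn0 => [|j].
  rewrite inordK ?ltnS // eqxx /= /perm_val.
  have -> : inord i = widen_ord (leqnSn n) i.
    by apply/ord_inj; rewrite inordK //; exact: ltnW (ltn_ord i).
  by case: ifP.
move=> ji; case: eqP => //= e; case/eqP: ji; apply/ord_inj.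
by rewrite inordK -?e.
Qed.

Definition insert q j (f : nat -> nat) v :=
  if (v < q)%N then bump j (f v) else if v == q then j else bump j (f v.-1).

Lemma bump_lt j a b : (bump j a < bump j b)%N = (a < b)%N.
Proof. by rewrite /bump; case: leqP; case: leqP; lia. Qed.

(** [insert] is the value function of [lift_perm]. The gap between positions [q.-1] and [q] gives
    way to the gaps on both sides of the new value; the old gap stands on the left to avoid
    truncated subtraction. *)
Lemma desn_insert n q j f : (q <= n.+1)%N ->
  (desn n.+1 (insert q j f) + ((0 < q <= n) && (f q < f q.-1)) =
   desn n f + ((0 < q) && (j <= f q.-1)) + ((q <= n) && (f q < j)))%N.
Proof.
move=> qn; rewrite /desn; case: q qn => [|q] qn.
  rewrite big_nat_recl //= !addn0 addnC; congr (_ + _)%N; last first.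
    by rewrite /insert /= /bump; case: leqP => ?; case: ltngtP => //; lia.
  by apply: eq_big_nat => v _; rewrite /insert /= bump_lt.
rewrite /= (@big_cat_nat _ _ _ q) //=; last exact: leqW.
have -> : (\sum_(0 <= i < q) (insert q.+1 j f i.+1 < insert q.+1 j f i) =
   \sum_(0 <= i < q) (f i.+1 < f i))%N.
  apply: eq_big_nat => v /andP[_ vq]; rewrite /insert.  rewrite ltnS vq (ltn_trans vq) //. 
  by rewrite bump_lt.
rewrite (big_ltn (m := q)) //.
have -> : (insert q.+1 j f q.+1 < insert q.+1 j f q)%N = (j <= f q)%N.
  by rewrite /insert ltnn eqxx ltnSn /bump; case: leqP; lia.
case: (leqP q.+1 n) => qn' /=; last first.
  have -> : n = q by lia.
  by rewrite [X in (_ + (_ + X))%N]big_geq // !addn0.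
rewrite [in RHS](@big_cat_nat _ _ _ q) //=.
rewrite [in LHS](big_ltn (m := q.+1)) // [in RHS](big_ltn (m := q)) //.
have -> : (insert q.+1 j f q.+2 < insert q.+1 j f q.+1)%N = (f q.+1 < j)%N.
  rewrite /insert ltnn eqxx (_ : (q.+2 < q.+1)%N = false) ?(gtn_eqF (ltnSn _)) /=;
    last by lia.
  by rewrite /bump; case: leqP; lia.
have -> : (\sum_(q.+2 <= i < n.+1) (insert q.+1 j f i.+1 < insert q.+1 j f i) =
   \sum_(q.+1 <= i < n) (f i.+1 < f i))%N.
  rewrite big_add1; apply: eq_big_nat => v /andP[qv _]; rewrite /insert.
  do 4 (case: ifP => ?; try by lia).
  by rewrite bump_lt.
lia.
Qed.

Lemma perm_val_lift n q j (s : 'S_n.+1) v : (v <= n.+1)%N ->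
  perm_val (lift_perm q j s) v = insert q j (perm_val s) v.
Proof.
move=> vn; rewrite /perm_val /insert; have qn := ltn_ord q.
have [vq|qv|vq] := ltngtP v q.
- have -> : inord v = lift q (inord v).
    apply/ord_inj; rewrite /= !inordK //; last by lia.
    by rewrite /bump leqNgt vq.
  by rewrite lift_perm_lift.
- have -> : inord v = lift q (inord v.-1).
    apply/ord_inj; rewrite /= !inordK //; last by lia.
    by rewrite /bump (_ : q <= v.-1)%N; lia.
  by rewrite lift_perm_lift.
by rewrite vq inord_val lift_perm_id.
Qed.

Lemma desn_ext n f g : (forall v, (v <= n)%N -> f v = g v) -> desn n f = desn n g.
Proof.
move=> fg; apply: eq_big_nat => v /andP[_ vn].
by rewrite !fg // ltnW.
Qed.

Lemma descents_lift n (q j : 'I_n.+2) (s : 'S_n.+1) :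
  let f := perm_val s in
  (descents (lift_perm q j s) + ((0 < q <= n) && (f q < f q.-1)) =
   descents s + ((0 < q) && (j <= f q.-1)) + ((q <= n) && (f q < j)))%N.
Proof.
rewrite /= !descentsE (desn_ext (g := insert q j (perm_val s))).
  by apply: desn_insert; rewrite -ltnS.
by move=> v vn; apply: perm_val_lift.
Qed.

Lemma descents_le n (s : 'S_n.+1) : (descents s <= n)%N.
Proof.
rewrite descentsE /desn -[leqRHS]subn0 -[leqRHS]muln1 -sum_nat_const_nat.
by apply: leq_sum => v _; case: (_ < _)%N.
Qed.

Lemma perm_valE n (s : 'S_n.+1) (v : 'I_n.+1) : perm_val s v = s v.
Proof. by rewrite /perm_val inord_val. Qed.

(** At an interior position a minimum brings a descent just before it, a maximum one just after
    it. *)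
Lemma descents_lift_min n (s : 'S_n.+1) q : (0 < q <= n)%N ->
  descents (lift_perm (inord q) ord0 s) = descents (lift_perm (inord q) ord_max s).
Proof.
move=> qn; have := descents_lift (inord q) ord0 s;
  have := descents_lift (inord q) ord_max s.
rewrite /= inordK; last by lia.
case/andP: qn => -> -> /=; rewrite /perm_val.
have := ltn_ord (s (inord q)); have := ltn_ord (s (inord q.-1)).
lia.
Qed.

Lemma descents_lift0 n (s : 'S_n.+1) :
  descents (lift_perm ord0 ord0 s) = descents s /\
  descents (lift_perm ord0 ord_max s) = (descents s).+1.
Proof.
have := descents_lift ord0 ord0 s; have := descents_lift ord0 ord_max s.
by rewrite /= /perm_val; have := ltn_ord (s (inord 0)); lia.
Qed.

Lemma descents_lift_max n (s : 'S_n.+1) :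
  descents (lift_perm ord_max ord0 s) = (descents s).+1 /\
  descents (lift_perm ord_max ord_max s) = descents s.
Proof.
have := descents_lift ord_max ord0 s; have := descents_lift ord_max ord_max s.
by rewrite /= ltnn /perm_val; have := ltn_ord (s (inord n)); lia.
Qed.

(** The inserted value directly follows [s p] in position and in value: this creates an ascent, and
    the new value compares with the next one as [s p] did. *)
Lemma descents_lift_adj n (s : 'S_n.+1) p :
  descents (lift_perm (lift ord0 p) (lift ord0 (s p)) s) = descents s.
Proof.
have := descents_lift (lift ord0 p) (lift ord0 (s p)) s.
rewrite !lift0 /= perm_valE ltnn addn0 ltnS.
have [pn|pn] := ltnP p n => /=; last by rewrite !addn0.
have ne : (perm_val s p.+1 == s p) = false.
  apply/negbTE; rewrite /perm_val; apply/eqP => /ord_inj/perm_inj/(congr1 val) /=.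
  by rewrite inordK ?ltnS // => /eqP; rewrite gtn_eqF.
by rewrite (leq_eqVlt (perm_val s p.+1)) ne => /addIn.
Qed.

Lemma tperm_adj_val n (c : 'I_n.+1) (x : 'I_n.+2) :
  tperm (widen_ord (leqnSn _) c) (lift ord0 c) x =
  (if x == c :> nat then c.+1 else if x == c.+1 :> nat then c : nat else x) :> nat.
Proof.
case: tpermP => [->|->|/eqP/negbTE x0 /eqP/negbTE x1]; rewrite ?lift0 /= ?eqxx //.
  by rewrite gtn_eqF.
by rewrite -val_eqE /= in x0; rewrite -val_eqE /= /bump add1n in x1; rewrite x0 x1.
Qed.

(** The comparison at a gap changes only if both exchanged values stand there, and then the ascent
    becomes a descent. *)
Lemma descents_swap n (s : 'S_n.+2) (c : 'I_n.+1) :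
  let c0 := widen_ord (leqnSn _) c in let c1 := lift ord0 c in
  ((s^-1)%g c0 < (s^-1)%g c1)%N ->
  descents (s * tperm c0 c1)%g =
  (descents s + ((s^-1)%g c1 == ((s^-1)%g c0).+1 :> nat))%N.
Proof.
move=> c0 c1; set p := (s^-1)%g c0; set q := (s^-1)%g c1 => pq.
have sp : s p = c0 by rewrite permKV. have sq : s q = c1 by rewrite permKV.
have c0E : c0 = c :> nat by []. have c1E : c1 = c.+1 :> nat by rewrite lift0.
have gap v : (v <= n)%N -> ((perm_val (s * tperm c0 c1)%g v.+1 < perm_val (s * tperm c0
  c1)%g v) =
   (perm_val s v.+1 < perm_val s v) || ((v == p) && (v.+1 == q)))%N.
  move=> vn; rewrite /perm_val !permM.
  have -> : (v == p)%N = (s (inord v) == c0).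
    rewrite -sp (inj_eq perm_inj) -val_eqE /= inordK //; lia.
  have -> : (v.+1 == q)%N = (s (inord v.+1) == c1).
    by rewrite -sq (inj_eq perm_inj) -val_eqE /= inordK.
  have pq' : s (inord v) = c1 -> s (inord v.+1) = c0 -> False.
    rewrite -sp -sq => /perm_inj/(congr1 val) /= + /perm_inj/(congr1 val) /=.
    by rewrite !inordK //; lia.
  have ne : s (inord v) != s (inord v.+1).
    by rewrite (inj_eq perm_inj) -val_eqE /= !inordK //; lia.
  rewrite !tperm_adj_val.
  have {}pq' : s (inord v) = c1 :> nat -> s (inord v.+1) = c0 :> nat -> False.
    by move=> /ord_inj h1 /ord_inj h2; apply: pq'.
  move: ne pq'; rewrite -!val_eqE /= /bump /= add1n.
  move: (nat_of_ord (s (inord v))) (nat_of_ord (s (inord v.+1))) => a b.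
  by split_ifs; lia.
rewrite !descentsE /desn.
have [qp|qp] := eqVneq (q : nat) p.+1.
  have pn : (p < n.+1)%N by have := ltn_ord q; lia.
  rewrite !big_mkord (bigD1 (Ordinal pn)) //= [in RHS](bigD1 (Ordinal pn)) //=.
  rewrite gap // eqxx qp eqxx orbT.
  have -> : (perm_val s p.+1 < perm_val s p)%N = false.
    by rewrite /perm_val -qp !inord_val sp sq c0E c1E; lia.
  rewrite add0n addnC; congr (_ + _)%N; apply: eq_bigr => v vp.
  rewrite gap; last by rewrite -ltnS.
  by rewrite -val_eqE /= in vp; rewrite (negbTE vp) orbF.
rewrite addn0; apply: eq_big_nat => v /andP[_ vn]; rewrite gap //.
case: eqP => [->|_]; last by rewrite orbF.
by rewrite eq_sym (negbTE qp) andbF orbF.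
Qed.
End Descents.

(** * Compatibility of the shuffle operations with the boundary *)

Section ShuffleCycle.
Variable F : fieldType.

Lemma sum_lift_perm (V : nmodType) n (j : 'I_n.+1) (G : 'S_n.+1 -> V) :
  \sum_s G s = \sum_(q < n.+1) \sum_(t : 'S_n) G (lift_perm q j t).
Proof.
rewrite pair_bigA /= (reindex (fun p : 'I_n.+1 * 'S_n => lift_perm p.1 j p.2)) //=.
apply: onW_bij; apply: inj_card_bij; last first.
  by rewrite card_prod card_ord !card_Sn factS.
move=> [q t] [q' t'] /= e.
have qq : q = q'.
  apply: (perm_inj (s := lift_perm q j t)); rewrite {2}e !lift_perm_id //.
rewrite -qq in e *; congr (_, _); apply/permP => v; apply: (lift_inj (h := j)).
by rewrite -!(lift_perm_lift q) e.
Qed.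

(** The unsigned coefficient in [sh] of a permutation with [d] descents, which belongs to
    [shuffle_l] of index [d.+1]. *)
Definition sh_weight (n k d : nat) : nat :=
  if (d < k)%N then 'C(n - d.+1, k - d.+1) else 0%N.

Lemma sh_weight_pascal n k d : (d < n)%N ->
  sh_weight n.+1 k d = (sh_weight n.+1 k d.+1 + sh_weight n k d)%N.
Proof.
move=> dn; rewrite /sh_weight; case: (ltngtP d.+1 k) => // [dk|<-].
- rewrite (_ : n.+1 - d.+1 = (n - d.+1).+1)%N; last by lia.
  rewrite (_ : k - d.+1 = (k - d.+2).+1)%N; last by lia.
  by rewrite binS addnC; congr ('C(_, _) + _)%N; lia.
- by rewrite ?ltnn ?ltnSn ?subnn !bin0.
Qed.

Definition hat n (s : 'S_n) : {ffun 'I_n.+1 -> 'I_n.+1} :=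
  [ffun t => lift_perm ord0 ord0 s t].

Lemma hat0 n (s : 'S_n) : hat s ord0 = ord0.
Proof. by rewrite ffunE lift_perm_id. Qed.

Lemma hatS n (s : 'S_n) v : hat s (lift ord0 v) = lift ord0 (s v).
Proof. by rewrite ffunE lift_perm_lift. Qed.

Definition sh_coef n k (s : 'S_n) : F := (-1) ^+ s * (sh_weight n k (descents s))%:R.

Lemma shE n k : sh F k n.+1 = \sum_(s : 'S_n.+1) sh_coef k s *: com_of F (hat s).
Proof.
rewrite /sh /=; case: ltnP => nk.
  rewrite big1 // => s _; rewrite /sh_coef /sh_weight; have := descents_le s.
  by case: ifP => ? ?; rewrite ?bin_small ?mulr0 ?scale0r //; lia.
rewrite /shuffle_l.
under eq_bigr => i _ do rewrite big_mkcond scaler_sumr.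
rewrite exchange_big; apply: eq_bigr => s _; rewrite /sh_coef /sh_weight odd_lift_perm /=.
case: ifP => dk; last first.
  rewrite mulr0 scale0r big_nat_cond big1 // => i /andP[/andP[_ ik] _].
  by case: eqP => [e|_]; rewrite ?scaler0 //; move: dk; rewrite -ltnS e ik.
rewrite big_add1 /= (bigD1_seq (descents s)) ?mem_index_iota ?iota_uniq //= eqxx.
rewrite big1 ?addr0 => [|i id]; last by rewrite eqSS eq_sym (negbTE id) scaler0.
by rewrite scalerA mulrC.
Qed.

Definition merged n (s : 'S_n.+1) j : {ffun 'I_n.+3 -> 'I_n.+2} :=
  [ffun u => hat s (face n.+1 j u)].

Lemma ffun_split n m (q : 'I_n.+2) (f g : {ffun 'I_n.+3 -> 'I_m}) :
  f ord0 = g ord0 -> f (lift ord0 q) = g (lift ord0 q) ->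
  (forall v, f (lift ord0 (lift q v)) = g (lift ord0 (lift q v))) -> f = g.
Proof.
move=> f0 fq fv; apply/ffunP => u; case: (unliftP ord0 u) => [x|] -> //.
by case: (unliftP q x) => [v|] ->.
Qed.

Lemma face0 n i : (i < n.+2)%N -> face n i ord0 = ord0.
Proof. by move=> ?; apply/ord_inj; rewrite faceE // /cface_val /=; split_ifs; lia. Qed.

(** Face 0 glues the smallest nonzero value to the base point, the last face glues the largest one;
    either way the inserted value disappears into the base point. *)
Lemma merge_min_max n (s : 'S_n.+1) (q : 'I_n.+2) :
  [ffun u => face n.+1 0 (hat (lift_perm q ord0 s) u)] =
  [ffun u => face n.+1 n.+2 (hat (lift_perm q ord_max s) u)].
Proof.
apply: (@ffun_split _ _ q) => [||v]; rewrite [LHS]ffunE [RHS]ffunE.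
- by rewrite !hat0 !face0.
- rewrite !hatS !lift_perm_id; apply/ord_inj.
  by rewrite !faceE // /cface_val /= /bump /=; split_ifs; lia.
- rewrite !hatS !lift_perm_lift; apply/ord_inj; have := ltn_ord (s v).
  by rewrite !faceE // /cface_val /= /bump /=; split_ifs; lia.
Qed.

Lemma merge_min_first n (s : 'S_n.+1) :
  [ffun u => face n.+1 0 (hat (lift_perm ord0 ord0 s) u)] = merged s 0.
Proof.
apply: (@ffun_split _ _ ord0) => [||v]; rewrite [LHS]ffunE [RHS]ffunE.
- by rewrite hat0 face0 // hat0.
- rewrite hatS lift_perm_id (_ : face n.+1 0 _ = ord0) ?hat0 //.
  by apply/ord_inj; rewrite !faceE.
- rewrite hatS lift_perm_lift.
  have e (x : 'I_n.+1) : face n.+1 0 (lift ord0 (lift ord0 x)) = lift ord0 x.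
    by apply/ord_inj; rewrite faceE // /cface_val /= /bump /=; split_ifs; lia.
  by rewrite !e hatS.
Qed.

Lemma merge_max_last n (s : 'S_n.+1) :
  [ffun u => face n.+1 n.+2 (hat (lift_perm ord_max ord_max s) u)] = merged s n.+2.
Proof.
apply: (@ffun_split _ _ ord_max) => [||v]; rewrite [LHS]ffunE [RHS]ffunE.
- by rewrite hat0 face0 // hat0.
- rewrite hatS lift_perm_id (_ : face n.+1 n.+2 _ = ord0) ?hat0 //.
  by apply/ord_inj; rewrite !faceE // /cface_val /= /bump /=; split_ifs; lia.
- rewrite hatS lift_perm_lift.
  have e (x : 'I_n.+1) : face n.+1 n.+2 (lift ord0 (lift ord_max x)) = lift ord0 x.
    apply/ord_inj; have := ltn_ord x.
    by rewrite faceE // /cface_val /= /bump /=; split_ifs; lia.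
  by rewrite !e hatS.
Qed.

(** Two values adjacent both in size and in position: merging the values amounts to merging the
    positions. *)
Lemma merge_adj n (s : 'S_n.+1) (p : 'I_n.+1) :
  [ffun u => face n.+1 (s p).+1 (hat (lift_perm (lift ord0 p) (lift ord0 (s p)) s) u)]
  = merged s p.+1.
Proof.
have e (j x : 'I_n.+1) : face n.+1 j.+1 (lift ord0 (lift (lift ord0 j) x)) = lift ord0 x.
  apply/ord_inj; have xn := ltn_ord x; have jn := ltn_ord j.
  by rewrite faceE; [rewrite /cface_val /= /bump /=; split_ifs; lia | lia].
have e' (j : 'I_n.+1) : face n.+1 j.+1 (lift ord0 (lift ord0 j)) = lift ord0 j.
  apply/ord_inj; have jn := ltn_ord j.
  by rewrite faceE; [rewrite /cface_val /= /bump /=; split_ifs; lia | lia].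
apply: (@ffun_split _ _ (lift ord0 p)) => [||v]; rewrite [LHS]ffunE [RHS]ffunE.
- by rewrite hat0 !face0 ?hat0 // ltnS; [exact: leqW (ltn_ord _) | exact: leqW (ltn_ord _)].
- by rewrite hatS lift_perm_id !e' hatS.
- by rewrite hatS lift_perm_lift !e hatS.
Qed.

Lemma merge_swap n (s : 'S_n.+2) (c : 'I_n.+1) :
  [ffun u => face n.+1 c.+1 (hat (s * tperm (widen_ord (leqnSn _) c) (lift ord0 c))%g u)]
  = [ffun u => face n.+1 c.+1 (hat s u)].
Proof.
apply/ffunP => u; rewrite [LHS]ffunE [RHS]ffunE; case: (unliftP ord0 u) => [x|] ->.
  rewrite !hatS permM; apply/ord_inj; have cn := ltn_ord c.
  rewrite !faceE; try by lia.
  by rewrite /cface_val !lift0 tperm_adj_val; split_ifs; lia.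
by rewrite !hat0.
Qed.

(* Exchanging the values c and c+1 cancels all terms of a middle face in which
   these values are not at consecutive positions. *)
Lemma sum_inversion_pairs (V : lmodType F) n (c0 c1 : 'I_n) (G : 'S_n -> V) : c0 != c1 ->
  \sum_s G s = \sum_(s : 'S_n | ((s^-1)%g c0 < (s^-1)%g c1)%N) (G s + G (s * tperm c0
    c1)%g).
Proof.
move=> c01; rewrite (bigID (fun s :
  'S_n => (s^-1)%g c0 < (s^-1)%g c1)%N) big_split /=; congr (_ + _).
rewrite (reindex_inj (mulIg (tperm c0 c1))); apply: eq_bigl => s.
rewrite invMg !permM tpermV tpermL tpermR -leqNgt leq_eqVlt val_eqE.
by rewrite (inj_eq perm_inj) (negbTE c01).
Qed.

Lemma sign_lift_perm n (s : 'S_n) q j :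
  (-1) ^+ (lift_perm q j s) = (-1) ^+ (q + j) * (-1) ^+ s :> F.
Proof. by rewrite odd_lift_perm signr_addb signr_addb !signr_odd exprD. Qed.

Lemma sqr_sign_mul n : (-1) ^+ n * (-1) ^+ n = 1 :> F.
Proof. by rewrite -expr2 sqrr_sign. Qed.

Lemma sign3 n : (-1) ^+ n.+3 = - (-1) ^+ n :> F.
Proof. by rewrite !exprS !mulN1r !opprK. Qed.

Lemma sh_weight_diff n k (s : 'S_n.+1) :
  (sh_weight n.+2 k (descents s))%:R - (sh_weight n.+2 k (descents s).+1)%:R
  = (sh_weight n.+1 k (descents s))%:R :> F.
Proof. by rewrite sh_weight_pascal ?ltnS ?descents_le // natrD addrC addKr. Qed.

(** Permutations differing by the exchange of [c] and [c.+1] have equal image and opposite sign.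
    Their weights differ only if [c.+1] comes right after [c], and then [sh_weight_diff] gives the
    weight one level down. *)
Lemma sh_middle n k (c : 'I_n.+1) :
  \sum_(s : 'S_n.+2) sh_coef k s *: com_of F [ffun u => face n.+1 c.+1 (hat s u)] =
  \sum_(s : 'S_n.+1) ((-1) ^+ (c + (s^-1)%g c) * sh_coef k s) *:
    com_of F (merged s ((s^-1)%g c).+1).
Proof.
pose c0 := widen_ord (leqnSn _) c; pose c1 := lift ord0 c.
have c01 : c0 != c1 by rewrite -val_eqE /= /bump; lia.
rewrite (sum_inversion_pairs _ c01).
have step (s : 'S_n.+2) : ((s^-1)%g c0 < (s^-1)%g c1)%N ->
  sh_coef k s *: com_of F [ffun u => face n.+1 c.+1 (hat s u)] +
  sh_coef k (s * tperm c0 c1)%g *: com_of F [ffun u =>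
    face n.+1 c.+1 (hat (s * tperm c0 c1)%g u)] =
  (if (s^-1)%g c1 == ((s^-1)%g c0).+1 :> nat then
    ((-1) ^+ s * ((sh_weight n.+2 k (descents s))%:R - (sh_weight n.+2 k (descents
      s).+1)%:R)) *:
      com_of F [ffun u => face n.+1 c.+1 (hat s u)] else 0).
  move=> sc; rewrite merge_swap -scalerDl /sh_coef odd_permM odd_tperm c01 signr_addb
    mulrN1 mulNr.
  rewrite descents_swap // -mulrBr; case: eqP => _; first by rewrite addn1.
  by rewrite addn0 subrr mulr0 scale0r.
rewrite (eq_bigr _ step) {step} big_mkcond (sum_lift_perm c1) exchange_big.
apply: eq_bigr => s _; set p := (s^-1)%g c.
have sp : s p = c by rewrite permKV.
(* Of all positions of the value [c.+1], only the one right after that of [c] contributes. *)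
rewrite (bigD1 (lift ord0 p)) //= [X in _ + X]big1 ?addr0 => [|q qp].
  rewrite lift_permV lift_perm_id.
  have -> : c0 = lift c1 c by apply/ord_inj; rewrite /= /bump /= add1n ltnn.
  rewrite lift_perm_lift /= /bump /= add1n ltnn add0n ltnSn eqxx.
  rewrite -/p /c1 -sp merge_adj descents_lift_adj sh_weight_diff sign_lift_perm;
    congr (_ *: _).
  by rewrite !lift0 addSn addnS !exprS !mulN1r opprK addnC mulrA.
rewrite lift_permV lift_perm_id.
have -> : c0 = lift c1 c by apply/ord_inj; rewrite /= /bump /= add1n ltnn.
rewrite lift_perm_lift -/p; case: ifP => // _; case: eqP => // e.
by case/eqP: qp; apply/ord_inj; move: e; rewrite /= /bump; case: leqP; lia.
Qed.

(** The sums are split by the position of the smallest, respectively the largest, value. Interior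
    positions cancel, with equal descents and opposite signs; at the two end positions the descents
    differ by one and Pascal's rule applies. *)
Lemma sh_ends n k :
  - \sum_(s : 'S_n.+2) sh_coef k s *: com_of F [ffun u => face n.+1 0 (hat s u)]
  + (-1) ^+ n.+3 *: \sum_(s :
    'S_n.+2) sh_coef k s *: com_of F [ffun u => face n.+1 n.+2 (hat s u)]
  = \sum_(s : 'S_n.+1) sh_coef k s *: (- com_of F (merged s 0) + (-1) ^+ n.+3 *: com_of
    F (merged s n.+2)).
Proof.
rewrite (sum_lift_perm ord0) (sum_lift_perm ord_max) scaler_sumr -sumrN -big_split /=.
under eq_bigr => q _ do rewrite scaler_sumr -sumrN -big_split /=.
rewrite exchange_big; apply: eq_bigr => s _.
under eq_bigr => q _.
  rewrite merge_min_max /sh_coef !sign_lift_perm scalerA -scaleNr -scalerDl addn0; over.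
rewrite big_ord_recl big_ord_recr big1 ?add0r => [|q _].
  rewrite -merge_min_first -merge_max_last merge_min_max /= /bump /= add1n.
  rewrite (_ : lift ord0 ord_max = ord_max); last by apply/ord_inj; rewrite lift0.
  have [-> ->] := descents_lift0 s; have [-> ->] := descents_lift_max s.
  rewrite add0r scalerDr scalerN scalerA -scaleNr; congr (_ *: _ + _ *: _).
    rewrite /sh_coef -sh_weight_diff expr0 mul1r add0n [in LHS]sign3 [_ ^+ n.+1]exprS
      mulN1r.
    rewrite -!mulrA !mulNr mulrN opprK (mulrA ((-1) ^+ n)) sqr_sign_mul mul1r.
    by rewrite mulrBr opprB addrC.
  rewrite /sh_coef -sh_weight_diff exprD sqr_sign_mul sign3 [_ ^+ n.+1]exprS mulN1r.
  have key (a g w w' : F) : - (- a * g * w') + - a * (1 * g * w) = g * (w - w') * - a.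
    by ring.
  exact: key.
set Q := lift ord0 _.
have := @descents_lift_min n s Q; rewrite inord_val => -> //; last first.
  by rewrite /Q lift0 /= ltn_ord.
rewrite exprD /= sign3 [_ ^+ n.+1]exprS mulN1r.
have key (a g w x : F) : - (x * g * w) + - a * (x * - a * g * w)
    = (x * g * w) * (a * a - 1) by ring.
by rewrite key sqr_sign_mul subrr mulr0 scale0r.
Qed.

Lemma bd_sh n k :
  com_comp (bd F n.+1) (sh F k n.+2) = com_comp (sh F k n.+1) (bd F n.+1).
Proof.
rewrite !shE com_comp_sumr com_comp_suml.
under [RHS]eq_bigr => s _.
  rewrite com_compZl bdE com_comp_sumr big_ord_recl big_ord_recr /=.
  rewrite !com_compZr !com_comp_of addrCA addrC expr1 scaleN1r scalerDr; over.
rewrite big_split -sh_ends.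
rewrite bdE.
under [LHS]eq_bigr => s _ do rewrite com_compZr com_comp_suml scaler_sumr.
rewrite exchange_big big_ord_recl big_ord_recr /= addrCA addrC.
congr (_ + _); first congr (_ + _).
- rewrite -sumrN; apply: eq_bigr => s _.
  by rewrite com_compZl com_comp_of expr1 scaleN1r scalerN.
- rewrite scaler_sumr; apply: eq_bigr => s _.
  by rewrite com_compZl com_comp_of !scalerA mulrC.
transitivity (\sum_(c < n.+1) \sum_(s : 'S_n.+1)
   ((-1) ^+ c.+2 * ((-1) ^+ (c + (s^-1)%g c) * sh_coef k s)) *:
    com_of F (merged s ((s^-1)%g c).+1)).
  apply: eq_bigr => c _; under [RHS]eq_bigr => s _ do rewrite -scalerA.
  rewrite -scaler_sumr -sh_middle scaler_sumr; apply: eq_bigr => s _.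
  by rewrite com_compZl com_comp_of !scalerA mulrC.
(* Reindexing by [c = s p] turns the sum over merged values into the sum over merged positions on
   the right. *)
rewrite exchange_big; apply: eq_bigr => s _;
  rewrite scaler_sumr (reindex_inj (@perm_inj _ s)).
apply: eq_bigr => p _; rewrite permK com_compZr com_comp_of scalerA; congr (_ *: _).
rewrite /bump /= exprD !exprS !mulN1r opprK mulrA mulrA.
by rewrite sqr_sign_mul mul1r opprK mulrC.
Qed.
End ShuffleCycle.

(** * The product total complex *)

Section Families.
Variable F : fieldType.

(* An operation of degree l has components in Com(k+1, j+1) with j = k + l;
   the other components of a bifamily of degree l vanish. *)
Definition bifamily := forall k j, Com F k.+1 j.+1.

Definition graded (l : int) (a : bifamily) : Prop :=
  forall k j, j%:Z != k%:Z + l -> a k j = 0.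

Definition prev_bd (a : bifamily) k j : Com F k.+1 j.+1 :=
  match k with
  | 0 => 0
  | k'.+1 => com_comp (a k' j) (bd F k')
  end.

(** The degree [l] of [a] enters only through the sign; it is an argument because the type of [a]
    does not record it. *)
Definition fdiff (l : int) (a : bifamily) : bifamily := fun k j =>
  com_comp (bd F j) (a k j.+1) - (-1) ^ l *: prev_bd a k j.

Definition family_add (a b : bifamily) : bifamily := fun k j => a k j + b k j.
Definition family_scale c (a : bifamily) : bifamily := fun k j => c *: a k j.
Definition family0 : bifamily := fun k j => 0.

Lemma prev_bdD a b k j : prev_bd (family_add a b) k j = prev_bd a k j + prev_bd b k j.
Proof. by case: k => [|k] /=; rewrite ?addr0 // com_compDl. Qed.
Lemma prev_bdZ c a k j : prev_bd (family_scale c a) k j = c *: prev_bd a k j.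
Proof. by case: k => [|k] /=; rewrite ?scaler0 // com_compZl. Qed.

Lemma fdiffD l a b k j : fdiff l (family_add a b) k j = fdiff l a k j + fdiff l b k j.
Proof. by rewrite /fdiff com_compDr prev_bdD scalerDr opprD addrACA. Qed.
Lemma fdiffZ l c a k j : fdiff l (family_scale c a) k j = c *: fdiff l a k j.
Proof. by rewrite /fdiff com_compZr prev_bdZ scalerBr !scalerA mulrC. Qed.
Lemma fdiff_sum l I (s : seq I) (a : I -> bifamily) k j :
  fdiff l (fun k j => \sum_(i <- s) a i k j) k j = \sum_(i <- s) fdiff l (a i) k j.
Proof.
elim: s k j => [|i s IH] k j.
  rewrite big_nil /fdiff big_nil com_comp0r sub0r /prev_bd.
  by case: k => [|k]; rewrite ?big_nil ?com_comp0l scaler0 oppr0.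
rewrite big_cons -IH -fdiffD /fdiff /family_add big_cons; congr (_ - _ *: _).
by case: k => //= k; rewrite big_cons.
Qed.

Lemma fdiff_fdiff l a k j : fdiff l (fdiff (l + 1) a) k j = 0.
Proof.
rewrite /fdiff; have -> : (-1 : F) ^ (l + 1) = - (-1) ^ l.
  by rewrite exprzDr ?unitrN1 // expr1z mulrN1.
rewrite com_compBr com_compA bd_bd com_comp0l sub0r com_compZr.
case: k => [|k] /=; first by rewrite com_comp0r !scaler0 !oppr0 addr0.
rewrite com_compBl com_compZl -com_compA scalerBr.
have -> : com_comp (prev_bd a k j) (bd F k) = 0.
  by case: k => [|k] /=; rewrite ?com_comp0l // -com_compA bd_bd com_comp0r.
by rewrite !scaler0 subr0 scaleNr opprK subrr.
Qed.

Lemma graded_fdiff l l' a : graded (l + 1) a -> graded l (fdiff l' a).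
Proof.
move=> ga k j jk; rewrite /fdiff ga ?com_comp0r ?sub0r; last first.
  by apply: contraNneq jk; lia.
case: k jk => [|k] jk /=; first by rewrite scaler0 oppr0.
rewrite ga ?com_comp0l ?scaler0 ?oppr0 //.
by apply: contraNneq jk; lia.
Qed.

Definition opfam_family l (f : opfam F l) : bifamily := fun k j =>
  if (l + k)%N =P j is ReflectT e then ecast j (Com F k.+1 j.+1) e (f k) else 0.

Lemma opfam_family_eq l (f : opfam F l) k : opfam_family f k (l + k)%N = f k.
Proof. by rewrite /opfam_family; case: eqP => // e; rewrite (eq_axiomK e). Qed.

Lemma opfam_family_neq l (f : opfam F l) k j : j != (l + k)%N -> opfam_family f k j = 0.
Proof. by rewrite /opfam_family; case: eqP => // e; rewrite -{1}e eqxx. Qed.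

Lemma graded_opfam l (f : opfam F l) : graded l%:Z (opfam_family f).
Proof.
by move=> k j jk; apply: opfam_family_neq; apply: contraNneq jk => ->; lia.
Qed.

Lemma bd_shA n k : com_comp (bd F n) (sh F k n.+1) = com_comp (sh F k n) (bd F n).
Proof.
case: n => [|n]; last exact: bd_sh.
have -> : bd F 0 = 0.
  rewrite bdE !big_ord_recl big_ord0 addr0 expr1 expr2 mulN1r opprK scaleN1r scale1r.
  set f := face 0 _; set g := face 0 _.
  have -> : f = g by apply/ffunP => t; apply: ord_inj; case: (f t) => -[] //;
    case: (g t) => -[].
  by rewrite addNr.
by rewrite com_comp0l com_comp0r.
Qed.

Definition sh_family k : bifamily := opfam_family (sh F k).
Definition B_family k : bifamily := opfam_family (connes_sh F k).

Lemma fdiff_sh k n j : fdiff 0 (sh_family k) n j = 0.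
Proof.
rewrite /fdiff expr0z scale1r; have [->|jn] := eqVneq n j.+1.
  by rewrite [prev_bd _ _ _]/= /sh_family !opfam_family_eq bd_shA subrr.
rewrite /sh_family opfam_family_neq 1?eq_sym // com_comp0r sub0r.
case: n jn => [|n] jn /=; first by rewrite oppr0.
rewrite opfam_family_neq ?com_comp0l ?oppr0 //.
by apply: contraNneq jn => ->.
Qed.

Lemma fdiff_B k n j : fdiff 1 (B_family k) n j = 0.
Proof.
rewrite /fdiff expr1z scaleN1r opprK; have [->|jn] := eqVneq j n; last first.
  rewrite /B_family opfam_family_neq ?com_comp0r ?add0r //.
  case: n jn => [|n] jn //=.
  by rewrite opfam_family_neq ?com_comp0l.
rewrite /B_family (opfam_family_eq (connes_sh F k)) /connes_sh com_compA.
case: n => [|n] /=; first by rewrite bd_connes0 com_comp0l addr0.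
rewrite (opfam_family_eq (connes_sh F k)) /connes_sh bd_connes.
rewrite -[com_comp (com_comp _ (sh _ _ _)) _]com_compA -bd_shA com_compA.
by rewrite -com_compDl addNr com_comp0l.
Qed.

(* All coordinates but the base point: phi tail_mask detects sh^K in component K,
   whereas B^K is detected by phi xpredT. *)
Definition tail_mask (i : nat) : bool := (0 < i)%N.

(** Peeling requires first value 1 and lowers the others by one through face 0, so only the
    increasing enumeration of the nonzero elements survives. *)
Lemma phi_all n (z : Com F n n.+1) :
  phi xpredT z = z [ffun t => lift ord0 t].
Proof.
elim: n z => [|n IH] z.
  rewrite /= ; congr (z _); exact: esym (no_funE _).
rewrite phi_peel // IH.
elim/com_ind: z => [|c a b ha hb|f].
- by rewrite linear0 !ffunE.
- by rewrite [peel _]linearP /= [in RHS]ffunE [in RHS]ffunE -ha -hb !ffunE.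
rewrite [f]fcons_eta; move: (f ord0) (ftail f) => {f} t x.
rewrite peel_fcons com_ofE.
case: eqP => t1; last first.
  rewrite ffunE; case: eqP => // /ffunP/(_ ord0); rewrite fcons0 ffunE => e.
  by case: t1; rewrite -e.
rewrite com_comp_of com_ofE; congr ((_ : bool)%:R).
apply/eqP/eqP => [e|e].
  apply/ffunP => s; case: (unliftP ord0 s) => [s'|] ->.
    rewrite ffunE fconsS; apply/ord_inj; have es : face n 0 (x s') = lift ord0 s'.
      by move/ffunP/(_ s'): e; rewrite [X in X = _ -> _]ffunE [X in _ = X -> _]ffunE.
    move/(congr1 val): es; rewrite /= faceE // /cface_val /= /bump /=.
    by split_ifs; lia.
  by rewrite ffunE fcons0; apply/ord_inj; rewrite t1.
apply/ffunP => s; rewrite [LHS]ffunE [RHS]ffunE; apply/ord_inj; rewrite faceE //.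
move/ffunP/(_ (lift ord0 s)): e; rewrite ffunE fconsS => <-.
by rewrite /cface_val /= /bump /=; split_ifs; lia.
Qed.
End Families.

(** * Leading components of cycles *)

Section LeadingTerms.
Variable F : fieldType.

Lemma sh_lt k n : (n < k)%N -> sh F k n = 0.
Proof. by rewrite /sh; case: k n => [|k] [|n] //= ->. Qed.

(** For [k = n] every weight is 1: [sh] is the antisymmetrizer, a fundamental cycle of the torus on
    the coordinates other than the base point. *)
Lemma sh_diag n : sh F n n = \sum_(s : 'S_n) (-1) ^+ s *: com_of F (hat s).
Proof.
case: n => [|n].
  rewrite /sh /= (big_pred1 1%g) => [|s]; last by apply/esym/eqP/permP => -[].
  rewrite odd_perm1 scale1r; congr com_of; apply/ffunP => t.
  by apply: ord_inj; case: (_ t) => -[] //; case: (_ t) => -[].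
rewrite shE; apply: eq_bigr => s _; congr (_ *: _).
by rewrite /sh_coef /sh_weight ltnS descents_le binn mulr1.
Qed.

Lemma hat_lift_eq n (s : 'S_n) : (ftail (hat s) == [ffun t => lift ord0 t]) = (s == 1%g).
Proof.
apply/eqP/eqP => [e|->].
  apply/permP => t; apply: (@lift_inj _ ord0); rewrite perm1 -hatS.
  by move/ffunP/(_ t): e; rewrite [X in X = _ -> _]ffunE [X in _ = X -> _]ffunE.
by apply/ffunP => t; rewrite [LHS]ffunE [RHS]ffunE hatS perm1.
Qed.

Lemma phi_sum n U j I (s : seq I) (P : pred I) (a : I -> Com F n j.+1) :
  phi U (\sum_(i <- s | P i) a i) = \sum_(i <- s | P i) phi U (a i).
Proof.
elim/big_rec2: _ => [|i x y _ <-]; first exact: phi0.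
by rewrite phiD.
Qed.

Lemma phi_of_all n (f : {ffun 'I_n -> 'I_n.+1}) :
  phi xpredT (com_of F f) = (f == [ffun t => lift ord0 t])%:R.
Proof. by rewrite phi_all com_ofE eq_sym. Qed.

Lemma phi_sh n : phi tail_mask (sh F n n) = 1.
Proof.
rewrite phi_tail // -[fun _ => _]/xpredT sh_diag linear_sum phi_sum (bigD1 1%g) //=.
rewrite big1 ?addr0 => [|s s1].
  by rewrite linearZ /= phiZ com_tail_of phi_of_all hat_lift_eq eqxx odd_perm1 mulr1.
by rewrite linearZ /= phiZ com_tail_of phi_of_all hat_lift_eq (negbTE s1) mulr0.
Qed.

(** The base coordinate is constantly 0 and cannot be peeled; a mask omitting it and one more
    coordinate has fewer than [n] elements. *)
Lemma phi_sh_tail n (U : nat -> bool) : (exists2 i, (i < n)%N & U i.+1 = false) \/ U 0%N ->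
  phi U (sh F n n) = 0.
Proof.
case U0 : (U 0%N) => h.
  rewrite sh_diag phi_sum big1 // => s _; rewrite phiZ.
  case: n s {h} => [|n] s; first by rewrite phi_peel0 ?mulr0.
  rewrite phi_peel // [hat s]fcons_eta hat0 peel_fcons.
  by case: eqP => // _; rewrite phi0 mulr0.
case: h => // -[i ni Ui].
apply: phi_card; rewrite big_ord_recl U0 add0n.
rewrite (bigD1 (Ordinal ni)) //= /bump /= add1n Ui add0n.
rewrite neq_ltn; apply/orP; right.
apply: (@leq_ltn_trans (\sum_(j < n | j != Ordinal ni) 1)%N).
  by apply: leq_sum => j _; case: (U _).
by rewrite sum1_card cardC1 card_ord; lia.
Qed.

Lemma connes_g0 n : connes_g n.+1 0 = [ffun t => lift ord0 t].
Proof.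
apply/ffunP => t; apply/ord_inj; rewrite connes_gE // [in RHS]ffunE lift0 /rot_val.
by have := ltn_ord t; case: ifP; lia.
Qed.

(** A rotation by [a > 0] moves the base point to [a.+1], not to 1. For [a = 0] only the identity
    permutation gives the enumeration detected by [phi_all]. *)
Lemma phi_B n : phi xpredT (connes_sh F n n) = 1.
Proof.
rewrite /connes_sh connesE com_comp_suml phi_sum.
rewrite (bigD1_seq 0%N) ?iota_uniq ?mem_index_iota //= big_nat_cond big1 ?addr0.
  rewrite mul0n expr0 scale1r sh_diag com_comp_sumr phi_sum (bigD1 1%g) //= big1 ?addr0.
    rewrite com_compZr phiZ com_comp_of phi_of_all odd_perm1 mul1r connes_g0.
    rewrite (_ : _ == _ = true) //; apply/eqP/ffunP => t;
      rewrite [LHS]ffunE [in LHS]ffunE [RHS]ffunE.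
    by congr (lift _ _); rewrite ffunE lift_perm1 perm1.
  move=> s s1; rewrite com_compZr phiZ com_comp_of phi_of_all connes_g0.
  rewrite (_ : _ == _ = false) ?mulr0 //; apply: contraNF s1 => /eqP e.
  rewrite -hat_lift_eq; apply/eqP/ffunP => t; rewrite ffunE.
  move/ffunP/(_ (lift ord0 t)): e;
    rewrite [X in X = _ -> _]ffunE [X in X = _ -> _]ffunE [X in _ = X -> _]ffunE.
  by move=> /lift_inj ->; rewrite ffunE.
move=> a /andP[/andP[_ an] a0].
rewrite sh_diag com_comp_sumr phi_sum big1 // => s _.
rewrite com_compZl com_compZr !phiZ com_comp_of phi_of_all (_ : _ == _ = false) ?mulr0 //.
apply/eqP => /ffunP/(_ ord0) /(congr1 val) /=;
  rewrite [in LHS]ffunE [in RHS]ffunE hat0 connes_gE; last exact: ltnW.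
by rewrite /rot_val /= /bump /=; case: ifP; lia.
Qed.

Lemma sh_family_eq K k : sh_family F K k k = sh F K k.
Proof. exact: (opfam_family_eq (sh F K)). Qed.

Lemma B_family_eq K k : B_family F K k k.+1 = connes_sh F K k.
Proof. exact: (opfam_family_eq (connes_sh F K)). Qed.

(** One name for the generators in all degrees, so that existence in degrees 0 and 1 and vanishing
    in the others have a common proof. *)
Definition leading_family (l : int) (K : nat) : bifamily F :=
  match l with
  | Posz 0 => sh_family F K
  | Posz 1 => B_family F K
  | _ => family0 F
  end.

Lemma leading_family_graded l K : graded l (leading_family l K).
Proof. by case: l => [[|[|l]]|l] k j // jk; rewrite /leading_family;
  apply: graded_opfam. Qed.

Lemma leading_family_lt l K k j : (k < K)%N -> leading_family l K k j = 0.
Proof.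
move=> kK; case: l => [[|[|l]]|l] //; rewrite /leading_family.
  have [->|jk] := eqVneq j (0 + k)%N; last exact: opfam_family_neq.
  by rewrite /sh_family opfam_family_eq sh_lt.
have [->|jk] := eqVneq j (1 + k)%N; last exact: opfam_family_neq.
by rewrite /B_family opfam_family_eq /connes_sh sh_lt // com_comp0r.
Qed.

Lemma fdiff_leading_family l K k j : fdiff l (leading_family l K) k j = 0.
Proof.
case: l => [[|[|l]]|l]; rewrite /leading_family; [exact: fdiff_sh|exact: fdiff_B| |];
by rewrite /fdiff com_comp0r; case: k => [|k] /=; rewrite ?com_comp0l scaler0 subr0.
Qed.

Lemma sqr_signz (l : int) : (-1) ^ l * (-1) ^ l = 1 :> F.
Proof. by rewrite -signzB subrr expr0z. Qed.

Lemma column_cycle0 n j : column_cycle (0 : Com F n j.+1).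
Proof. exact/column_cycle_bdry/column_bdry0. Qed.

(** In column [K] the cycle equation receives nothing from earlier columns; in column [K.+1] it
    equates the coboundary of the leading term with a column boundary, up to sign. *)
Lemma leading_cycle l (a : bifamily F) K j : (forall k i, (k < K)%N -> a k i = 0) ->
  (forall k i, fdiff l a k i = 0) ->
    column_cycle (a K j) /\ column_bdry (com_comp (a K j) (bd F K)).
Proof.
move=> a0 da; have prev0 i : prev_bd a K i = 0.
  by case: K a0 => //= K ->; rewrite ?com_comp0l.
split.
  case: j => //= j; have := da K j; rewrite /fdiff prev0 scaler0 subr0; exact.
exists ((-1) ^ l *: a K.+1 j.+1); rewrite com_compZr.
have /eqP := da K.+1 j; rewrite /fdiff subr_eq0 /= => /eqP ->.
by rewrite scalerA sqr_signz scale1r.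
Qed.

Lemma mask_sum_ge K (U : nat -> bool) : (forall i, (i < K)%N -> U i.+1) ->
  (\sum_(i < K.+1) U i = U 0%N + K)%N.
Proof.
move=> UK; rewrite big_ord_recl; congr (_ + _)%N.
rewrite (eq_bigr (fun=> 1%N)) => [|i _]; first by rewrite sum1_card card_ord.
by rewrite lift0 UK.
Qed.

Lemma mask_sum_lt K (U : nat -> bool) i : (i < K)%N -> U i.+1 = false ->
  (\sum_(i < K.+1) U i < U 0%N + K)%N.
Proof.
move=> iK Ui; rewrite big_ord_recl ltn_add2l (bigD1 (Ordinal iK)) // lift0 Ui /= add0n.
apply: (@leq_ltn_trans (\sum_(j < K | j != Ordinal iK) 1)%N).
  by apply: leq_sum => j _; case: (U _).
by rewrite sum1_card cardC1 card_ord; lia.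
Qed.

(** Only masks containing all coordinates except possibly the base point matter. They have [K] or
    [K.+1] elements, so in row [K + l] only [tail_mask] for [l = 0] and the full mask for [l = 1]
    can detect anything, and there the generator takes the value 1. *)
Lemma leading_class l K j (z : Com F K.+1 j.+1) : j%:Z = K%:Z + l -> column_cycle z ->
  (forall (U : nat -> bool) i, (i < K)%N -> U i.+1 = false -> phi U z = 0) ->
  exists c, column_bdry (z - c *: leading_family l K K j).
Proof.
move=> jl cz z0.
have cg : column_cycle (leading_family l K K j).
  by have [] := leading_cycle (l := l) (K :=
    K) j (@leading_family_lt l K) (fdiff_leading_family l K).
have cd c : column_cycle (z - c *: leading_family l K K j) by rewrite addrC -scaleNr;
  apply: column_cycleP.
have split (U : nat -> bool) : (exists2 i, (i < K)%N & U i.+1 = false) \/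
    (forall i, (i < K)%N -> U i.+1).
  case: (boolP [forall i : 'I_K, U i.+1]) => [/forallP h|].
    by right=> i iK; apply: (h (Ordinal iK)).
  by rewrite negb_forall => /existsP[i /negbTE Ui]; left; exists i.
have [l0|l0] := eqVneq l 0.
  have jK : j = K by lia.
  subst j l; exists (phi tail_mask z); apply: torus_homology => // U.
  rewrite phiB phiZ /leading_family /= sh_family_eq.
  case: (split U) => [[i iK Ui]|UK].
    by rewrite (z0 _ _ iK Ui) phi_sh_tail ?mulr0 ?subrr //; left; exists i.
  case U0 : (U 0%N).
    rewrite phi_sh_tail ?mulr0 ?subr0; last by right; rewrite U0.
    by apply: phi_card; rewrite mask_sum_ge // U0; lia.
  rewrite !(@phi_ext _ _ U tail_mask) ?phi_sh ?mulr1 ?subrr // => -[|i] // iK;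
    by rewrite UK.
have [l1|l1] := eqVneq l 1.
  have jK : j = K.+1 by lia.
  subst j l; exists (phi xpredT z); apply: torus_homology => // U.
  rewrite phiB phiZ /leading_family /= B_family_eq.
  case: (boolP (K.+1 == \sum_(i < K.+1) U i)%N) => [/eqP e|ne]; last first.
    by rewrite !(@phi_card F _ U) // ?mulr0 ?subrr.
  have UK i : (i < K)%N -> U i.+1.
    move=> iK; apply/negPn/negP => /negbTE /(mask_sum_lt iK).
    by rewrite -e; case: (U _); lia.
  have U0 : U 0%N by move: e; rewrite mask_sum_ge //; case: (U _) => //; lia.
  rewrite !(@phi_ext _ _ U xpredT) ?phi_B ?mulr1 ?subrr // => -[|i] // iK;
    by rewrite UK.
exists 0; rewrite scale0r subr0; apply: torus_homology => // U.
case: (split U) => [[i iK Ui]|UK]; first exact: z0 Ui.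
apply: phi_card; rewrite mask_sum_ge //; case: (U _); lia.
Qed.

Definition single_component k0 j0 (z : Com F k0.+1 j0.+1) : bifamily F := fun k j =>
  if k0 =P k is ReflectT ek then
    if j0 =P j is ReflectT ej then
      ecast k (Com F k.+1 j.+1) ek (ecast j (Com F k0.+1 j.+1) ej z)
    else 0
  else 0.

Lemma single_eq k j (z : Com F k.+1 j.+1) : single_component z k j = z.
Proof.
rewrite /single_component; case: eqP => // ek; case: eqP => // ej.
by rewrite (eq_axiomK ek) (eq_axiomK ej).
Qed.

Lemma single_neq k0 j0 (z : Com F k0.+1 j0.+1) k j : (k != k0) || (j != j0) ->
  single_component z k j = 0.
Proof.
rewrite /single_component; case: eqP => // ek; case: eqP => // ej.
by rewrite -{1}ek -{1}ej !eqxx.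
Qed.

Lemma single_graded k0 j0 (z : Com F k0.+1 j0.+1) l : j0%:Z = k0%:Z + l ->
  graded l (single_component z).
Proof.
move=> jl k j jk; apply: single_neq; apply: contraNT jk.
by rewrite negb_or !negbK => /andP[/eqP -> /eqP ->]; apply/eqP.
Qed.

Lemma graded_add l (a b : bifamily F) : graded l a -> graded l b ->
  graded l (family_add a b).
Proof. by move=> ga gb k j jk; rewrite /family_add ga // gb // addr0. Qed.

Lemma graded_scale l c (a : bifamily F) : graded l a -> graded l (family_scale c a).
Proof. by move=> ga k j jk; rewrite /family_scale ga // scaler0. Qed.

(** The correction [b] may start one column before [K], because normalizing column [K] subtracts the
    coboundary of an element of the preceding column. *)
Lemma leading_term_exact l (a : bifamily F) K : graded l a ->
  (forall k j, (k < K)%N -> a k j = 0) -> (forall k j, fdiff l a k j = 0) ->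
  exists c b, [/\ graded (l + 1) b, (forall k j, (k.+1 < K)%N -> b k j = 0)
    & forall k j, (k <= K)%N -> a k j - c *: leading_family l K k j - fdiff (l + 1) b k
      j = 0].
Proof.
move=> ga a0 da.
(* If [K + l] is negative, column [K] is zero in this degree and no correction is made. *)
have [[j jl]|noj] := pselect (exists j : nat, j%:Z = K%:Z + l); last first.
  exists 0, (@family0 F); split=> // k j kK; rewrite scale0r subr0.
  rewrite /fdiff com_comp0r; case: k kK => [|k] kK /=; rewrite ?com_comp0l scaler0 !subr0.
    move: kK; rewrite leq_eqVlt => /orP[/eqP K0|]; last exact: a0.
    by apply: ga; apply/eqP => e; apply: noj; exists j; rewrite -K0.
  move: kK; rewrite leq_eqVlt => /orP[/eqP K0|]; last exact: a0.
  by apply: ga; apply/eqP => e; apply: noj; exists j; rewrite -K0.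
have [cz bz] := leading_cycle j a0 da.
(* b1 normalizes the leading term; what is left is a multiple of the leading
   family plus the boundary of y. *)
have [b1 [gb1 b10 cb1 zb1]] : exists b1 : bifamily F, [/\ graded (l + 1) b1,
    (forall k i, k.+1 != K -> b1 k i = 0), (forall k i, column_cycle (b1 k i)) &
    forall (U : nat -> bool) i, (i < K)%N -> U i.+1 = false ->
      phi U (a K j - prev_bd b1 K j) = 0].
  case: K {a0} jl cz bz => [|K] jl cz bz.
    by exists (@family0 F); split=> // k i; apply: column_cycle0.
  have [y cy yP] := normalize cz bz.
  exists (single_component y); split=> [||k i|U i iK Ui].
  - by apply: single_graded; lia.
  - by move=> k i kK; apply: single_neq; rewrite -eqSS kK.
  - have [->|kK] := eqVneq k K; last by rewrite single_neq ?kK //; apply: column_cycle0.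
    have [->|ij] := eqVneq i j; last by rewrite single_neq ?ij ?orbT //;
      apply: column_cycle0.
    by rewrite single_eq.
  - by rewrite /= single_eq (phi_degen _ iK Ui); have [y' ->] := yP i iK; apply: phi_bd.
have cz1 : column_cycle (a K j - prev_bd b1 K j).
  rewrite addrC -scaleN1r; apply: column_cycleP => //.
  by case: K {jl a0 cz bz b10 zb1} => [|K] /=;
    [apply: column_cycle0 | apply: column_cycle_pre].
have [c [y ey]] := leading_class jl cz1 zb1.
(* The factor cancels the sign in [fdiff], so that [b2] contributes exactly [prev_bd b1] in column
   [K]. *)
pose b2 := family_scale (- (-1) ^ (l + 1)) b1.
have fb1 k i : (k <= K)%N -> fdiff (l + 1) b2 k i = if k == K then prev_bd b1 k i else 0.
  move=> kK; rewrite fdiffZ /fdiff.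
  have -> : com_comp (bd F i) (b1 k i.+1) = 0.
    by have := cb1 k i.+1.
  rewrite sub0r scalerN scaleNr opprK scalerA sqr_signz scale1r.
  case: eqP => // kK'; case: k kK kK' => //= k kK kK'.
  by rewrite b10 ?com_comp0l //; apply/eqP.
have fy k i : (k <= K)%N -> fdiff (l + 1) (single_component y) k i =
    com_comp (bd F i) (single_component y k i.+1).
  move=> kK; rewrite /fdiff; case: k kK => [|k] kK /=; first by rewrite scaler0 subr0.
  by rewrite [single_component y k i]single_neq ?com_comp0l ?scaler0 ?subr0 // ltn_eqF.
exists c, (family_add (single_component y) b2); split=> [|k i kK|k i kK].
- by apply: graded_add; [apply: single_graded; lia | apply: graded_scale].
- rewrite /family_add /b2 /family_scale b10 ?ltn_eqF // scaler0 addr0.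
  by apply: single_neq; rewrite ltn_eqF // ltnW.
rewrite fdiffD fy // fb1 //; have [->|kK'] := eqVneq k K; last first.
  have kK2 : (k < K)%N by rewrite ltn_neqAle kK' kK.
  by rewrite a0 // leading_family_lt // scaler0 single_neq ?kK' // com_comp0r !addr0 !subr0.
have [->|ij] := eqVneq i j.
  by rewrite single_eq -ey [_ - _ - c *: _]addrAC subrK subrr.
have ne : i%:Z != K%:Z + l by apply: contraNneq ij => e; apply/eqP; lia.
rewrite ga // leading_family_graded // scaler0 single_neq ?ij ?orbT // com_comp0r subrr
  !add0r.
case: (K) ne => [|k'] ne /=; first by rewrite oppr0.
by rewrite gb1 ?com_comp0l ?oppr0 //; lia.
Qed.

End LeadingTerms.

(** * Classification of cycles and boundaries of families *)

Section Classification.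
Variable F : fieldType.

Definition lcomb l (c : nat -> F) : bifamily F :=
  fun k j => \sum_(m < k.+1) c m *: leading_family F l m k j.

Definition family_sub (a b : bifamily F) := family_add a (family_scale (-1) b).

Lemma family_subE a b k j : family_sub a b k j = a k j - b k j.
Proof. by rewrite /family_sub /family_add /family_scale scaleN1r. Qed.

Lemma fdiff_sub l a b k j :
  fdiff l (family_sub a b) k j = fdiff l a k j - fdiff l b k j.
Proof. by rewrite fdiffD fdiffZ scaleN1r. Qed.

Lemma graded_sub l a b : graded l a -> graded l b -> graded l (family_sub a b).
Proof. by move=> ga gb; apply: graded_add => //; apply: graded_scale. Qed.

(** Leading terms are removed column by column. The infinite sum of corrections makes sense because
    the one of step [m] vanishes in the columns [k] with [k.+1 < m]. *)
Lemma cycle_class l (a : bifamily F) : graded l a -> (forall k j, fdiff l a k j = 0) ->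
  exists c b, graded (l + 1) b /\
    forall k j, a k j - lcomb l c k j = fdiff (l + 1) b k j.
Proof.
move=> ga da.
pose good (K : nat) (a : bifamily F) := [/\ graded l a,
  (forall k j, (k < K)%N -> a k j = 0) & forall k j, fdiff l a k j = 0].
pose next (p : F * bifamily F) K (a : bifamily F) :=
  family_sub (family_sub a (family_scale p.1 (leading_family F l K))) (fdiff (l + 1) p.2).
(* A correction is chosen for every stage and family at once, so that the stages can be iterated;
   outside [good] the choice is arbitrary. *)
have /choice[step stepP] : forall x : nat * bifamily F, exists y : F * bifamily F,
    good x.1 x.2 -> [/\ graded (l + 1) y.2,
      (forall k j, (k.+1 < x.1)%N -> y.2 k j = 0) &
      good x.1.+1 (next y x.1 x.2)].
  move=> -[K x] /=.
  have [gx|nx] := pselect (good K x); last by exists (0, x).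
  case: (gx) => g1 g2 g3; have [c [b [gb b0 e]]] := leading_term_exact g1 g2 g3.
  exists (c, b) => _; split => //; split.
  - apply: graded_sub; last exact: graded_fdiff.
    by apply: graded_sub => //; apply/graded_scale/leading_family_graded.
  - by move=> k j kK; rewrite /next !family_subE /= e.
  - by move=> k j; rewrite /next !fdiff_sub g3 fdiffZ fdiff_leading_family fdiff_fdiff
    scaler0 !subr0.
pose A := fix A K := if K is K'.+1 then next (step (K', A K')) K' (A K') else a.
pose cb m := step (m, A m).
have AP K : good K (A K).
  by elim: K => [|K IH] //=; have [] := stepP (K, A K) IH.
have aE M k j : a k j = \sum_(m < M) ((cb m).1 *: leading_family F l m k j + fdiff (l +
  1) (cb m).2 k j)
    + A M k j.
  elim: M => [|M IH]; first by rewrite big_ord0 add0r.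
  rewrite big_ord_recr /= {1}IH -addrA; congr (_ + _).
  rewrite /next !family_subE /family_scale -/(cb M).
  by rewrite addrC -[_ - _ - _]addrA -opprD subrK.
(* In column [k] only corrections of index at most [k.+1] can be nonzero. *)
exists (fun m => (cb m).1), (fun k j => \sum_(m < k.+2) (cb m).2 k j); split.
  move=> k j jk; apply: big1 => m _.
  by have [gm _ _] := stepP (nat_of_ord m, A m) (AP m); apply: gm.
move=> k j; have [_ A0 _] := AP k.+2.
rewrite (aE k.+2 k j) A0 // addr0 big_split /= big_ord_recr /= leading_family_lt //
  scaler0 addr0.
have -> : lcomb l (fun m => (cb m).1) k j =
  \sum_(i < k.+1) (cb i).1 *: leading_family F l i k j by [].
rewrite [X in X - _]addrC addrK -fdiff_sum /fdiff; congr (_ - _ *: _).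
case: k {A0} => [|k] //=; rewrite [in LHS]big_ord_recr /=.
have [_ b0 _] := stepP (k.+2, A k.+2) (AP k.+2).
by rewrite b0 // addr0.
Qed.

Lemma leading_family_phi l K : l = 0 \/ l = 1 -> exists j U,
  [/\ j%:Z = K%:Z + l & phi U (leading_family F l K K j) = 1].
Proof.
move=> [->|->].
  by exists K, tail_mask; rewrite addr0 /leading_family /= sh_family_eq phi_sh.
exists K.+1, xpredT; rewrite /leading_family /= B_family_eq phi_B; split=> //; lia.
Qed.

(* A primitive b of the combination is pushed into higher and higher components,
   subtracting classes of degree l + 1 and boundaries. *)
Lemma lcomb_boundary l c (b : bifamily F) : l = 0 \/ l = 1 -> graded (l + 1) b ->
  (forall k j, fdiff (l + 1) b k j = lcomb l c k j) -> forall m, c m = 0.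
Proof.
move=> l01 gb db.
suff H M : (forall m, (m < M)%N -> c m = 0) /\ exists b', [/\ graded (l + 1) b',
    (forall k j, (k < M)%N -> b' k j = 0) &
    forall k j, fdiff (l + 1) b' k j = lcomb l c k j].
  by move=> m; have [cm _] := H m.+1; apply: cm.
elim: M => [|M [cM [b' [gb' b0 db']]]].
  by split=> //; exists b.
have [j [U [jl pU]]] := leading_family_phi M l01.
have prev0 i : prev_bd b' M i = 0.
  by case: (M) b0 => //= k ->; rewrite ?com_comp0l.
have dM i : com_comp (bd F i) (b' M i.+1) = c M *: leading_family F l M M i.
  have := db' M i; rewrite /fdiff prev0 scaler0 subr0 => ->.
  rewrite /lcomb big_ord_recr /= big1 ?add0r // => m _.
  by rewrite cM ?scale0r //=.
(* [phi U] vanishes on column boundaries but is 1 on the generator. *)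
have cM0 : c M = 0.
  by have := phi_bd U (b' M j.+1); rewrite dM phiZ pU mulr1.
have cM1 m : (m < M.+1)%N -> c m = 0.
  by rewrite ltnS leq_eqVlt => /orP[/eqP -> //|]; apply: cM.
split=> //.
have cyb : column_cycle (b' M j.+1) by rewrite /= dM cM0 scale0r.
have jl1 : j.+1%:Z = M%:Z + (l + 1) by lia.
have [c' [y ey]] : exists c',
  column_bdry (b' M j.+1 - c' *: leading_family F (l + 1) M M j.+1).
  (* A mask omitting a coordinate other than the base point has at most [M] elements, fewer than the
     row number [M + l + 1]. *)
  apply: leading_class => // V i iM Vi; apply: phi_card.
  have := mask_sum_lt iM Vi; case: (V 0%N); case: l01 => ? ?; lia.
exists (family_sub b' (family_add (family_scale c' (leading_family F (l + 1) M))
   (fdiff (l + 1 + 1) (single_component y)))); split.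
- apply: graded_sub => //; apply: graded_add;
  first exact/graded_scale/leading_family_graded.
  by apply: graded_fdiff; apply: single_graded; lia.
- move=> k i kM; rewrite family_subE /family_add /family_scale /fdiff.
  have prevy : prev_bd (single_component y) k i = 0.
    case: k kM => [|k] //= kM; rewrite single_neq ?com_comp0l //.
    by rewrite ltn_eqF.
  rewrite prevy scaler0 subr0.
  have [->|kM'] := eqVneq k M; last first.
    rewrite single_neq ?kM' // com_comp0r addr0.
    have kM2 : (k < M)%N by rewrite ltn_neqAle kM' -ltnS.
    by rewrite b0 // leading_family_lt // scaler0 subr0.
  have [->|ij] := eqVneq i j.+1; first by rewrite single_eq opprD addrA ey subrr.
  have ne : i%:Z != M%:Z + (l + 1) by apply: contraNneq ij => e; apply/eqP; lia.
  by rewrite gb' // leading_family_graded // scaler0 single_neq ?ij ?orbT // com_comp0r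
    addr0 subr0.
- move=> k i; rewrite fdiff_sub fdiffD fdiffZ fdiff_leading_family scaler0 add0r
  fdiff_fdiff subr0.
  exact: db'.
Qed.

Lemma lcomb_sub l (c c' : nat -> F) k j :
  lcomb l (fun m => c m - c' m) k j = lcomb l c k j - lcomb l c' k j.
Proof. by rewrite /lcomb -sumrB; apply: eq_bigr => m _; rewrite scalerBl. Qed.

Lemma lcombE l c N k j : (k < N)%N ->
  lcomb l c k j = \sum_(m < N) c m *: leading_family F l m k j.
Proof.
move=> kN; rewrite /lcomb -!(big_mkord xpredT (fun m => c m *: leading_family F l m k j)).
rewrite [RHS](@big_cat_nat _ _ _ k.+1) //= [X in _ = _ + X]big_nat_cond.
by rewrite [X in _ = _ + X]big1 ?addr0 // => m /andP[/andP[km _] _];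
  rewrite leading_family_lt // scaler0.
Qed.

Lemma fdiff_lcomb l (c : nat -> F) k j : fdiff l (lcomb l c) k j = 0.
Proof.
transitivity (fdiff l (fun k' j' =>
  \sum_(m < k.+1) family_scale (c m) (leading_family F l m) k' j') k j).
  rewrite /fdiff (@lcombE _ _ k.+1) //; congr (_ - _ *: _).
  by case: k => //= k; rewrite (@lcombE _ _ k.+2) // ltnW.
by rewrite fdiff_sum big1 // => m _; rewrite fdiffZ fdiff_leading_family scaler0.
Qed.

Lemma graded_lcomb l c : graded l (lcomb l c).
Proof. by move=> k j jk; apply: big1 => m _; rewrite leading_family_graded // scaler0. Qed.

Lemma leading_family_other l m k j : l != 0 -> l != 1 -> leading_family F l m k j = 0.
Proof. by case: l => [[|[|l]]|l]. Qed.
End Classification.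

(** * Operations and their components *)

Section Yoneda.
Variable F : fieldType.

(* The sum of all shifts of the functor represented by m: keeping a copy of
   Com(m, n) in every degree avoids a case distinction in the types. *)
Section Representable.
Variable m : nat.

Definition rep_zero n : {linear (Com F m n : lmodType F) -> (Com F m n : lmodType F)} := \0.

Lemma rep_zero_shape n (p q : int) (x : Com F m n) : q != p + -1 -> rep_zero n x = 0.
Proof. by []. Qed.

Definition rep_diff n : ghom (-1) (fun _ : int => Com F m n :
  lmodType F) (fun _ => Com F m n) :=
  GHom (gmap := fun _ _ => rep_zero n) (@rep_zero_shape n).

Lemma rep_diff2 n p q r x : rep_diff n q r (rep_diff n p q x) = 0.
Proof. by []. Qed.

Definition rep_obj n : complex F := Complex (@rep_diff2 n).

Definition rep_fun n n' (a : Com F n n') (p q : int) (x : rep_obj n p) : rep_obj n' q :=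
  if q == p then com_comp a x else 0.

Lemma rep_fun_linear n n' (a : Com F n n') p q : linear (@rep_fun n n' a p q).
Proof.
move=> c x y; rewrite /rep_fun; case: eqP => _; last by rewrite scaler0 addr0.
by rewrite com_compDr com_compZr.
Qed.

Lemma rep_shape n n' (a : Com F n n') p q x : q != p + 0 ->
  mk_linear (@rep_fun_linear n n' a p q) x = 0.
Proof. by rewrite addr0 /= /rep_fun => /negPf ->. Qed.

Definition rep_map n n' (a : Com F n n') : ghom 0 (rep_obj n) (rep_obj n') :=
  GHom (@rep_shape n n' a).

Lemma rep_mapE n n' (a : Com F n n') p q x :
  rep_map a p q x = if q == p then com_comp a x else 0.
Proof. by []. Qed.

Lemma rep_linear n n' (c : F) (a b : Com F n n') p q x :
  rep_map (c *: a + b) p q x = c *: rep_map a p q x + rep_map b p q x.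
Proof.
rewrite !rep_mapE; case: eqP => _; last by rewrite scaler0 addr0.
by rewrite com_compDl com_compZl.
Qed.

Lemma rep_id n p x : rep_map (com_id n) p p x = x.
Proof. by rewrite rep_mapE eqxx com_comp1l. Qed.

Lemma rep_comp n n' r (b : Com F n' r) (a : Com F n n') p q x :
  rep_map (com_comp b a) p q x = rep_map b p q (rep_map a p p x).
Proof. by rewrite !rep_mapE eqxx com_compA. Qed.

Lemma rep_diffP n n' (a : Com F n n') p q x :
  cdiff (rep_obj n') p q (rep_map a p p x) = rep_map a q q (cdiff (rep_obj n) p q x).
Proof. by rewrite [RHS]linear0. Qed.

Definition rep : dgfun F := DgFun rep_linear rep_id rep_comp rep_diffP.

Variables (Phi : dgfun F) (r : int) (v : Phi m r).

Lemma dmap0 n n' p q x : dmap Phi (0 : Com F n n') p q x = 0.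
Proof.
by have := @dmap_linear F Phi n n' (-1) 0 0 p q x; rewrite scaler0 addr0 scaleN1r addNr.
Qed.

(** Only the copy in degree 0 is evaluated at [v]: a transformation of degree [r] has to carry it to
    degree [r], that of [v]. *)
Definition yoneda_fun n (p q : int) (x : rep n p) : Phi n q :=
  if p == 0 then dmap Phi (x : Com F m n) r q v else 0.

Lemma yoneda_linear n p q : linear (@yoneda_fun n p q).
Proof.
move=> c x y; rewrite /yoneda_fun; case: eqP => _; last by rewrite scaler0 addr0.
exact: dmap_linear.
Qed.

Lemma yoneda_shape n p q x : q != p + r -> mk_linear (@yoneda_linear n p q) x = 0.
Proof.
move=> qr; rewrite /= /yoneda_fun; have [p0|//] := eqVneq p 0.
by rewrite gshape // addr0 -[r]add0r -p0.
Qed.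

Definition yoneda_hom n : ghom r (rep n) (Phi n) := GHom (@yoneda_shape n).

Lemma yoneda_homE n p q x :
  yoneda_hom n p q x = if p == 0 then dmap Phi (x : Com F m n) r q v else 0.
Proof. by []. Qed.

Lemma yoneda_nat n n' (a : Com F n n') p q x :
  yoneda_hom n' p q (dmap rep a p p x) = dmap Phi a q q (yoneda_hom n p q x).
Proof.
rewrite !yoneda_homE; case: eqP => _; last by rewrite linear0.
rewrite [dmap rep _ _ _ _]rep_mapE eqxx dmap_comp.
have [->//|qr] := eqVneq q r.
by rewrite gshape ?addr0 // [X in dmap _ _ _ _ X]gshape ?linear0 ?addr0.
Qed.

Definition yoneda : dgnat r rep Phi := DgNat yoneda_nat.
End Representable.

(** The universal element of the summand [k]; the total degree [k] puts the identity in internal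
    degree 0. *)
Definition yoneda_unit k : hochschild (rep k.+1) k%:Z :=
  dinj (fun i => rep k.+1 i.+1 (k%:Z - i%:Z)) k (com_id k.+1).

Lemma dinj_eq (V : nat -> lmodType F) k (v : V k) : dinj V k v k = v.
Proof. by rewrite /= dfwith_in. Qed.
Lemma dinj_neq (V : nat -> lmodType F) k j (v : V k) : k != j -> dinj V k v j = 0.
Proof. by move=> kj; rewrite /= dfwith_out. Qed.

Lemma hoch_yoneda (Phi : dgfun F) q k (v : Phi k.+1 (q - k%:Z)) :
  hoch_nat (yoneda v) k%:Z q (yoneda_unit k) = dinj (fun i => Phi i.+1 (q - i%:Z)) k v.
Proof.
apply: dsumP => j; rewrite [LHS]/= -/(yoneda_unit k).
have [<-|kj] := eqVneq k j.
  by rewrite dinj_eq dfwith_in /yoneda_fun subrr eqxx dmap_id.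
by rewrite dinj_neq // dfwith_out // /yoneda_fun; case: eqP => // _; apply: dmap0.
Qed.

Definition component l (z : natop F l) : bifamily F := fun k j =>
  z (rep k.+1) k%:Z (k%:Z + l) (yoneda_unit k) j.

(** The argument is the image of the universal element under [yoneda v], of degree [q - k];
    naturality reduces the value to the component and yields the Koszul sign. *)
Lemma natop_dinj l (z : natop F l) (Phi : dgfun F) q s k (v : Phi k.+1 (q - k%:Z)) j :
  z Phi q s (dinj (fun i => Phi i.+1 (q - i%:Z)) k v) j =
  (-1) ^ ((q - k%:Z) * l) *:
    (if k%:Z + l - j%:Z == 0 then dmap Phi (component z k j) (q - k%:Z) (s - j%:Z) v
      else 0).
Proof.
have e : q = k%:Z + (q - k%:Z) by rewrite addrC subrK.
by rewrite -hoch_yoneda (nop_nat_eq _ _ _ _ e erefl).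
Qed.

Lemma component_graded l (z : natop F l) : graded l (component z).
Proof.
move=> k j jk; rewrite /component /yoneda_unit natop_dinj.
case: eqP => [e|_]; last by rewrite scaler0.
by move: jk; rewrite -subr_eq0 -oppr_eq0 opprB e eqxx.
Qed.

Lemma natop_dinjE l (z : natop F l) (Phi : dgfun F) q s k (v : Phi k.+1 (q - k%:Z)) j :
  z Phi q s (dinj (fun i => Phi i.+1 (q - i%:Z)) k v) j =
  (-1) ^ ((q - k%:Z) * l) *: dmap Phi (component z k j) (q - k%:Z) (s - j%:Z) v.
Proof.
rewrite natop_dinj; case: eqP => // /eqP e.
by rewrite component_graded ?dmap0 // -subr_eq0 -oppr_eq0 opprB.
Qed.

Lemma dcoord_sum (V : nat -> lmodType F) I (s : seq I) (x : I -> dsum V) j :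
  (\sum_(i <- s) x i) j = \sum_(i <- s) x i j.
Proof. by elim/big_rec2: _ => // i y z _ <-. Qed.

Lemma dsum_dinj (V : nat -> lmodType F) (x : dsum V) N : (forall k, (N <= k)%N ->
  x k = 0) ->
  x = \sum_(k < N) dinj V k (x k).
Proof.
move=> xN; apply: dsumP => j; rewrite dcoord_sum.
have [jN|Nj] := ltnP j N; last first.
  by rewrite xN // big1 // => k _; rewrite dinj_neq // ltn_eqF // (leq_trans (ltn_ord k)).
rewrite (bigD1 (Ordinal jN)) //= dfwith_in big1 ?addr0 // => k kj.
by rewrite dfwith_out //; rewrite -val_eqE in kj.
Qed.

Lemma natopE l (z : natop F l) (Phi : dgfun F) q s (x : hochschild Phi q) N j :
  (forall k, (N <= k)%N -> x k = 0) ->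
  z Phi q s x j = \sum_(k < N) (-1) ^ ((q - k%:Z) * l) *:
     dmap Phi (component z k j) (q - k%:Z) (s - j%:Z) (x k).
Proof.
move=> xN; rewrite {1}(dsum_dinj xN) linear_sum dcoord_sum.
by apply: eq_bigr => k _; rewrite natop_dinjE.
Qed.
End Yoneda.

(** * Cycles and homologies in terms of components *)

Section Components.
Variable F : fieldType.

Lemma yoneda_unit_eq k : yoneda_unit F k k = com_id k.+1.
Proof. by rewrite /yoneda_unit dinj_eq. Qed.

Lemma yoneda_unit_neq k j : k != j -> yoneda_unit F k j = 0.
Proof. by move=> kj; rewrite /yoneda_unit dinj_neq. Qed.

Lemma yoneda_unit_fin k i : (k.+1 <= i)%N -> yoneda_unit F k i = 0.
Proof. by move=> ki; rewrite yoneda_unit_neq // ltn_eqF. Qed.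

Lemma com_sum_faces m k (a : Com F m k.+2) :
  \sum_(1 <= i < k.+3) (-1) ^+ i *: com_comp (com_of F (cface k i)) a = com_comp (bd F k) a.
Proof. by rewrite /bd com_comp_suml; apply: eq_bigr => i _; rewrite com_compZl. Qed.

Lemma hoch_rep_diff m p q (x : hochschild (rep F m) p) j : q = p - 1 ->
  cdiff (hochschild (rep F m)) p q x j =
  (-1) ^ (p - j.+1%:Z) *: com_comp (bd F j) (x j.+1 : Com F m j.+2).
Proof.
move=> qp; rewrite /= /hoch_coord /= add0r; congr (_ *: _).
rewrite -com_sum_faces; apply: eq_bigr => i _; congr (_ *: _).
by rewrite /rep_fun (_ : q - j%:Z == p - j.+1%:Z) //; apply/eqP; lia.
Qed.

Lemma component_diff l (z : natop F l) k j (q : int) : q = k%:Z + (l - 1) ->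
  nat_diff z (rep F k.+1) k%:Z q (yoneda_unit F k) j = fdiff l (component z) k j.
Proof.
move=> qk; rewrite [nat_diff z _ _ _ _]hdiffE dcoordD dcoordN dcoordZ /fdiff.
congr (_ - _ *: _).
  rewrite hoch_rep_diff; last by lia.
  rewrite -/(component z k j.+1).
  (* The exponent of the sign is 0 in the one row where the component may be nonzero. *)
  have [e|e] := eqVneq (k%:Z + l - j.+1%:Z) 0; first by rewrite e expr0z scale1r.
  rewrite component_graded ?com_comp0r ?scaler0 //.
  by apply: contraNneq e => ->; rewrite subrr.
rewrite (@natopE _ _ _ _ _ _ _ k); last first.
  by move=> i ki; rewrite hoch_rep_diff // yoneda_unit_fin // com_comp0r scaler0.
case: k qk => [|k] qk; first by rewrite big_ord0.
rewrite big_ord_recr big1 => [|i _]; last first.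
  rewrite [X in dmap _ _ _ _ X](_ : _ = 0) ?linear0 ?scaler0 //.
  rewrite hoch_rep_diff // yoneda_unit_neq ?com_comp0r ?scaler0 //.
  by rewrite /= eqSS gtn_eqF.
rewrite [LHS]add0r.
have e : k.+1%:Z - 1 - k%:Z = 0 by lia.
rewrite [(_ - _) * l](_ : _ = 0) ?expr0z ?scale1r; last by rewrite /= e mul0r.
rewrite [dmap _ _ _ _ _]rep_mapE hoch_rep_diff // yoneda_unit_eq com_comp1r subrr
  expr0z scale1r.
case: eqP => // ne; rewrite [prev_bd _ _ _]/= component_graded ?com_comp0l //.
by apply: contra_notN ne => /eqP; rewrite /= => ->; rewrite qk; lia.
Qed.

Lemma is_cycleP l (z : natop F l) :
  is_cycle z <-> forall k j, fdiff l (component z) k j = 0.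
Proof.
split=> [cz k j|dz Phi p q x].
  by rewrite -(component_diff z j erefl) cz.
have [qE|qN] := eqVneq q (p + (l - 1)); last by rewrite gshape.
have [N xN] := dsum_fin x; apply: dsumP => j; rewrite (natopE _ _ _ xN) big1 // => k _.
suff -> : component (nat_diff z) k j = 0 by rewrite dmap0 scaler0.
by rewrite -(dz k j) -(component_diff z j erefl).
Qed.

Section OfFamily.
Variables (l : int) (b : bifamily F).
Hypothesis gb : graded l b.

Section Map.
Variables (Phi : dgfun F) (q s : int).

(** The bound on [k] covers the only index that can contribute, [k = j - l]. *)
Definition family_coord (x : hochschild Phi q) j : Phi j.+1 (s - j%:Z) :=
  \sum_(k < j + `|l|.+1) (-1) ^ ((q - k%:Z) * l) *:
    dmap Phi (b k j) (q - k%:Z) (s - j%:Z) (x k).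

Lemma family_fin x : exists N, forall j, (N <= j)%N -> family_coord x j = 0.
Proof.
have [N xN] := dsum_fin x; exists (N + `|l|)%N => j jN; apply: big1 => k _.
have [jk|jk] := eqVneq j%:Z (k%:Z + l); last by rewrite gb // dmap0 scaler0.
by rewrite xN ?linear0 ?scaler0 //; lia.
Qed.

Definition family_map x : hochschild Phi s := DSum (family_fin x).

Lemma family_linear : linear family_map.
Proof.
move=> c x y; apply: dsumP => j; rewrite dcoordD dcoordZ /= /family_coord.
rewrite scaler_sumr -big_split; apply: eq_bigr => k _ /=.
rewrite -[X in _ *: dmap _ _ _ _ X = _]/(c *: x k + y k) linearP scalerDr !scalerA.
by rewrite [c * _]mulrC.
Qed.

Lemma family_shape x : s != q + l -> mk_linear family_linear x = 0.
Proof.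
move=> sq; apply: dsumP => j; rewrite dcoord0 /=; apply: big1 => k _.
have [jk|jk] := eqVneq j%:Z (k%:Z + l); last by rewrite gb // dmap0 scaler0.
by rewrite gshape ?scaler0 //; apply: contraNneq sq; lia.
Qed.
End Map.

Lemma family_nat (Phi Psi : dgfun F) r (eta : dgnat r Phi Psi) p s x :
  GHom (@family_shape Psi) (p + r) s (hoch_nat eta p (p + r) x) =
  (-1) ^ (r * l) *: hoch_nat eta (p + l) s (GHom (@family_shape Phi) p (p + l) x).
Proof.
apply: dsumP => j; rewrite dcoordZ /= /family_coord linear_sum scaler_sumr.
apply: eq_bigr => k _ /=.
have [jk|jk] := eqVneq j%:Z (k%:Z + l); last first.
  by rewrite gb // !dmap0 !scaler0 linear0 scaler0.
rewrite linearZ_LR scalerA -expfzDr ?oppr_eq0 ?oner_eq0 //.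
congr (_ ^ _ *: _); first by lia.
have e : p + l - j%:Z = p - k%:Z by lia.
rewrite e dcomp_nat.
have [e2|ne] := eqVneq (s - j%:Z) (p + r - k%:Z); first by rewrite e2.
rewrite gshape ?addr0 // [X in dmap _ _ _ _ X]gshape ?linear0 //.
by apply: contraNneq ne => ->; apply/eqP; lia.
Qed.

Definition natop_of : natop F l := NatOp (nop :=
  fun Phi => GHom (@family_shape Phi)) family_nat.

Lemma component_of k j : component natop_of k j = b k j.
Proof.
have [jk|jk] := eqVneq j%:Z (k%:Z + l); last by rewrite component_graded // gb.
have kj : (k < j + `|l|.+1)%N by lia.
change (@family_coord (rep F k.+1) k%:Z (k%:Z + l) (yoneda_unit F k) j = b k j).
rewrite /family_coord (bigD1 (Ordinal kj)) // big1 => [|i ik]; last first.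
  by rewrite yoneda_unit_neq ?linear0 ?scaler0 // eq_sym.
rewrite [LHS]addr0 [dmap _ _ _ _ _]rep_mapE yoneda_unit_eq subrr mul0r expr0z scale1r.
by rewrite com_comp1r (_ : _ == _) //; apply/eqP; lia.
Qed.
End OfFamily.

Lemma component_op_of l (f : opfam F l) k j :
  component (op_of f) k j = opfam_family f k j.
Proof.
rewrite /component [op_of f _ _ _ _](op_of_mapE _ _ (@yoneda_unit_fin k)) dcoord_sum.
rewrite big_ord_recr big1 => [|i _]; last first.
  rewrite /op_of_summand yoneda_unit_neq; last by rewrite /= gtn_eqF.
  by rewrite linear0 linear0 scaler0.
rewrite [LHS]add0r /op_of_summand dcoordZ.
have [->|jk] := eqVneq j (l + k)%N; last first.
  by rewrite opfam_family_neq // dinj_neq ?scaler0 // eq_sym.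
rewrite opfam_family_eq dinj_eq [dmap _ _ _ _ _]rep_mapE yoneda_unit_eq com_comp1r.
rewrite /= subrr mulr0 expr0z scale1r; case: eqP => // ne; case: ne.
by lia.
Qed.

Lemma fdiff_ext l (a b : bifamily F) : (forall k j, a k j = b k j) ->
  forall k j, fdiff l a k j = fdiff l b k j.
Proof. by move=> ab [|k] j; rewrite /fdiff /= !ab. Qed.

Lemma dmapB (Phi : dgfun F) m n (a b : Com F m n) p q x :
  dmap Phi (a - b) p q x = dmap Phi a p q x - dmap Phi b p q x.
Proof. by rewrite [a - b]addrC -[- b]scaleN1r dmap_linear scaleN1r addrC. Qed.

(** Operations are determined by their components ([natopE]), and every graded family is realized by
    [natop_of]. *)
Lemma homologousP l (z z' : natop F l) : homologous z z' <->
  exists2 b, graded (l + 1) b &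
    forall k j, component z k j - component z' k j = fdiff (l + 1) b k j.
Proof.
split=> [[b bE]|[b gb bE]].
  exists (component b) => [|k j]; first exact: component_graded.
  rewrite -(component_diff b j (q := k%:Z + l)); last by rewrite addrK.
  by rewrite -bE.
exists (natop_of gb) => Phi p q x.
have [N xN] := dsum_fin x; apply: dsumP => j.
rewrite dcoordD dcoordN !(natopE _ _ _ xN) -sumrB; apply: eq_bigr => k _.
rewrite [(p - k%:Z) * (l + 1 - 1)](_ : _ = (p - k%:Z) * l); last by rewrite addrK.
rewrite -scalerBr; congr (_ *: _).
have -> : component (nat_diff (natop_of gb)) k j = component z k j - component z' k j.
  rewrite bE -(fdiff_ext _ (component_of gb)).
  exact: (component_diff (natop_of gb) j erefl).
by rewrite dmapB.
Qed.
End Components.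

(** * Homology classes and their generators *)

Section HomologyClasses.
Variable F : fieldType.

Lemma fdiffN l (a : bifamily F) k j : fdiff l (family_scale (-1) a) k j = - fdiff l a k j.
Proof. by rewrite fdiffZ scaleN1r. Qed.

Lemma homologous_refl l (z : natop F l) : homologous z z.
Proof.
apply/homologousP; exists (@family0 F) => // k j.
by rewrite subrr /fdiff com_comp0r; case: k => [|k] /=; rewrite ?com_comp0l scaler0 subr0.
Qed.

Lemma homologous_sym l (z z' : natop F l) : homologous z z' -> homologous z' z.
Proof.
move=> /homologousP[b gb bE]; apply/homologousP.
exists (family_scale (-1) b) => [|k j]; first exact: graded_scale.
by rewrite fdiffN -bE opprB.
Qed.

Lemma homologous_trans l (z z' z'' : natop F l) :
  homologous z z' -> homologous z' z'' -> homologous z z''.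
Proof.
move=> /homologousP[b gb bE] /homologousP[b' gb' bE']; apply/homologousP.
exists (family_add b b') => [|k j]; first exact: graded_add.
by rewrite fdiffD -bE -bE' addrA subrK.
Qed.

Lemma homologous_eq l (z z' : natop F l) :
  homologous z z' <-> homologous z = homologous z'.
Proof.
split=> [h|->]; last exact: homologous_refl.
apply: funext => w; apply: propext; split=> h'.
  exact: homologous_trans (homologous_sym h) h'.
exact: homologous_trans h h'.
Qed.

Lemma homology_eq l (h h' : homology F l) : sval h = sval h' -> h = h'.
Proof.
case: h h' => [S hS] [S' hS'] /= e; move: hS'; rewrite -e => hS'.
by congr exist; apply: Prop_irrelevance.
Qed.

Section Classification.
Variables (l : nat) (y : nat -> opfam F l).
Hypothesis yE : forall m k j, opfam_family (y m) k j = leading_family F l%:Z m k j.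

Lemma opfam_lt k i : (i < k)%N -> y k i = 0.
Proof. by move=> ik; rewrite -[LHS]opfam_family_eq yE leading_family_lt. Qed.

Lemma opfam_lcomb_sum (c : nat -> F) i N : (i < N)%N ->
  opfam_lcomb c y i = \sum_(k < N) c k *: y k i.
Proof.
move=> iN; rewrite (fsbig_ord _ N (fun k => c k *: y k i)) /opfam_lcomb.
apply/esym/fsbig_widen => // k /= [_ /negP]; rewrite -leqNgt => Nk.
by rewrite opfam_lt ?scaler0 // (leq_trans iN).
Qed.

Lemma opfam_locally_finite : locally_finite y.
Proof.
move=> i; apply: (sub_finite_set (B := `I_i.+1)); last exact: finite_II.
move=> k /= yk; rewrite ltnS leqNgt; apply: contraNN yk => ik.
by rewrite opfam_lt.
Qed.

Lemma component_lcomb (c : nat -> F) k j :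
  component (op_of (opfam_lcomb c y)) k j = lcomb l%:Z c k j.
Proof.
rewrite component_op_of.
have [->|jk] := eqVneq j (l + k)%N; last first.
  rewrite opfam_family_neq // graded_lcomb //.
  by apply: contraNneq jk; lia.
rewrite opfam_family_eq (@opfam_lcomb_sum _ _ k.+1) // /lcomb.
by apply: eq_bigr => m _; rewrite -yE opfam_family_eq.
Qed.

Lemma cycle_lcomb (c : nat -> F) : is_cycle (op_of (opfam_lcomb c y)).
Proof.
apply/is_cycleP => k j; rewrite -(fdiff_lcomb l%:Z c k j).
exact/fdiff_ext/component_lcomb.
Qed.

Hypothesis l01 : l%:Z = 0 \/ l%:Z = 1.

Lemma homology_basis (h : homology F l%:Z) :
  exists! c : nat -> F, h = hclass (cycle_lcomb c).
Proof.
case: (h) => S [z cz SE].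
have [c [b [gb bE]]] := cycle_class (@component_graded _ _ z) (proj1 (is_cycleP z) cz).
exists c; split.
  apply: homology_eq; rewrite /= SE; apply/homologous_eq/homologousP.
  by exists b => // k j; rewrite component_lcomb bE.
move=> c' /(congr1 sval) /=; rewrite SE => e'.
have /homologousP[b' gb' bE'] :
  homologous (op_of (opfam_lcomb c y)) (op_of (opfam_lcomb c' y)).
  apply/homologous_eq; rewrite -e'; apply/homologous_eq/homologous_sym/homologousP.
  by exists b => // k j; rewrite component_lcomb bE.
(* The difference of the two combinations is a boundary, so [lcomb_boundary] applies to its
   coefficients. *)
apply: funext => m; apply/eqP; rewrite -subr_eq0; apply/eqP.
apply: (lcomb_boundary (c := fun m => c m - c' m) l01 gb') => k j.
by rewrite -bE' !component_lcomb lcomb_sub.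
Qed.
End Classification.

Lemma homology_vanish (l : int) (h : homology F l) : l != 0 -> l != 1 -> h = homology0 F l.
Proof.
move=> l0 l1; case: h => S [z cz SE]; apply: homology_eq; rewrite /= SE.
have [c [b [gb bE]]] := cycle_class (@component_graded _ _ z) (proj1 (is_cycleP z) cz).
apply/homologous_eq/homologousP; exists b => // k j; rewrite -bE; congr (_ - _).
by rewrite /lcomb big1 // => m _; rewrite leading_family_other ?scaler0.
Qed.
End HomologyClasses.

Theorem theoremA (F : fieldType) :
  [/\ 
      forall l : int, l != 0 -> l != 1 ->
        forall h : homology F l, h = homology0 F l,
      
      [/\ locally_finite (sh F),
          forall (c : nat -> F) (i : nat),
            opfam_lcomb c (sh F) i = \sum_(0 <= k < i.+1) c k *: sh F k i
        & exists cyc : forall c : nat -> F,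
              is_cycle (op_of (opfam_lcomb c (sh F))),
            forall h : homology F 0,
              exists! c : nat -> F, h = hclass (cyc c)]
    & 
      [/\ locally_finite (connes_sh F),
          forall (c : nat -> F) (i : nat),
            opfam_lcomb c (connes_sh F) i
            = \sum_(0 <= k < i.+1) c k *: connes_sh F k i
        & exists cyc : forall c : nat -> F,
              is_cycle (op_of (opfam_lcomb c (connes_sh F))),
            forall h : homology F 1,
              exists! c : nat -> F, h = hclass (cyc c)]].
Proof.
have lc l (y : nat -> opfam F l) (yE :
  forall m k j, opfam_family (y m) k j = leading_family F l%:Z m k j) c i :
    opfam_lcomb c y i = \sum_(0 <= k < i.+1) c k *: y k i.
  by rewrite big_mkord; apply: opfam_lcomb_sum.
(* [leading_family] computes to the two given families in degrees 0 and 1. *)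
have shE m k j : opfam_family (sh F m) k j = leading_family F 0%N m k j by [].
have BE m k j : opfam_family (connes_sh F m) k j = leading_family F 1%N m k j by [].
split=> [l l0 l1 h||].
- exact: homology_vanish.
- split; [exact: opfam_locally_finite | exact: lc |].
  by exists (cycle_lcomb shE) => h; apply: homology_basis; left.
- split; [exact: opfam_locally_finite | exact: lc |].
  by exists (cycle_lcomb BE) => h; apply: homology_basis; right.
Qed.
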